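(* Let $\mathcal L$ be a graded subalgebra of $\mathfrak g(A)$. Then $\mathcal L$ is solvable if and only if $\mathcal L^{(2)}=[[\mathcal L,\mathcal L],[\mathcal L,\mathcal L]]$ is nilpotent.
   Context: Let $A=(a_{ij})_{i,j\in I}$ be a symmetrisable generalised Cartan matrix indexed by a finite set $I$, and $\mathfrak g(A)$ the associated complex Kac–Moody algebra with Cartan subalgebra $\mathfrak h$ and root space decomposition $\mathfrak g(A)=\mathfrak h\oplus\bigoplus_{\alpha\in\Delta}\mathfrak g_\alpha$. A subalgebra $\mathcal L$ is graded if $\mathcal L=(\mathcal L\cap\mathfrak h)\oplus\bigoplus_{\alpha\in\Delta}(\mathcal L\cap\mathfrak g_\alpha)$. Derived series $\mathcal L^{(0)}=\mathcal L$, $\mathcal L^{(n+1)}=[\mathcal L^{(n)},\mathcal L^{(n)}]$; lower central series $\mathcal L^0=\mathcal L$, $\mathcal L^{n+1}=[\mathcal L,\mathcal L^n]$; solvable (resp. nilpotent) means some term of the derived (resp. lower central) series vanishes. *)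

(* Defs.v *)
From HB Require Import structures.
From mathcomp Require Import all_boot all_order all_algebra.
Set Implicit Arguments. Unset Strict Implicit. Unset Printing Implicit Defensive.
Import Order.TTheory GRing.Theory Num.Theory.
Local Open Scope ring_scope.

Section LieDefs.
Variables (K : fieldType) (V : lmodType K) (br : V -> V -> V).

Definition is_lie_bracket : Prop :=
  [/\ forall (a : K) (x y z : V), br (a *: x + y) z = a *: br x z + br y z,
      forall x : V, br x x = 0 &
      forall x y z : V, br x (br y z) + br y (br z x) + br z (br x y) = 0].

Definition subspace (S : V -> Prop) : Prop :=
  S 0 /\ forall (a : K) (x y : V), S x -> S y -> S (a *: x + y).

Definition span_of (P : V -> Prop) : V -> Prop :=
  fun z => forall S, subspace S -> (forall y, P y -> S y) -> S z.

Definition lbracket (L M : V -> Prop) : V -> Prop :=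
  span_of (fun z => exists x y, [/\ L x, M y & z = br x y]).

Definition lie_subalgebra (L : V -> Prop) : Prop :=
  subspace L /\ forall x y, L x -> L y -> L (br x y).

Definition lie_ideal (J : V -> Prop) : Prop :=
  subspace J /\ forall x y, J y -> J (br x y).

Definition gen_subalgebra (P : V -> Prop) : V -> Prop :=
  fun z => forall S, lie_subalgebra S -> (forall y, P y -> S y) -> S z.

Fixpoint derived (L : V -> Prop) (k : nat) : V -> Prop :=
  if k is k'.+1 then lbracket (derived L k') (derived L k') else L.
Fixpoint lcs (L : V -> Prop) (k : nat) : V -> Prop :=
  if k is k'.+1 then lbracket L (lcs L k') else L.

Definition solvable_lie (L : V -> Prop) : Prop :=
  exists k, forall x, derived L k x -> x = 0.
Definition nilpotent_lie (L : V -> Prop) : Prop :=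
  exists k, forall x, lcs L k x -> x = 0.

Definition hsp (m : nat) (b : 'I_m -> V) : V -> Prop :=
  fun x => exists c : 'I_m -> K, x = \sum_(k < m) c k *: b k.

(* root space g_alpha, alpha a functional (only its restriction to h matters) *)
Definition rootsp (m : nat) (b : 'I_m -> V) (alpha : V -> K) : V -> Prop :=
  fun x => forall h, hsp b h -> br h x = alpha h *: x.

Definition is_root (m : nat) (b : 'I_m -> V) (alpha : V -> K) : Prop :=
  [/\ forall (a : K) h h', hsp b h -> hsp b h' ->
        alpha (a *: h + h') = a * alpha h + alpha h',
      exists2 h, hsp b h & alpha h != 0 &
      exists2 x, x != 0 & rootsp b alpha x].

(* graded: L = (L cap h) (+) sum_alpha (L cap g_alpha), i.e. every element of L is
   a (finite) sum of elements of L lying in h or in some root space *)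
Definition graded (m : nat) (b : 'I_m -> V) (L : V -> Prop) : Prop :=
  forall x, L x ->
    span_of (fun y => L y /\ (hsp b y \/ exists alpha, is_root b alpha /\ rootsp b alpha y)) x.

End LieDefs.

Definition is_GCM (n : nat) (A : 'M[int]_n) : Prop :=
  [/\ forall i, A i i = 2%:Z,
      forall i j, i != j -> A i j <= 0 &
      forall i j, (A i j == 0) = (A j i == 0)].

Definition intmx (K : fieldType) (n : nat) (A : 'M[int]_n) : 'M[K]_n :=
  map_mx (fun z : int => (z%:~R : K)) A.

(* A = D B with D invertible diagonal, B symmetric (Kac, Sect. 2.1) *)
Definition symmetrisable (K : fieldType) (n : nat) (A : 'M[int]_n) : Prop :=
  exists d : 'I_n -> K, (forall i, d i != 0) /\
    forall i j, (A i j)%:~R * d j = (A j i)%:~R * d i.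

(* (V, br) is (isomorphic to) the Kac-Moody algebra g(A) in Kac's sense:
   - h = span of the free family b : 'I_m -> V, m = 2n - rank A;
   - (h, {alpha_i}, {alpha_i^v}) is a realisation of A: row i of Acor gives the
     coordinates of alpha_i^v in the basis b, row j of Aroot gives the values of
     alpha_j on the basis b; both families are linearly independent and
     <alpha_i^v, alpha_j> = a_ij;
   - e_i, f_i, h satisfy the defining relations of g~(A), and generate V;
   - V has no nonzero ideal meeting h trivially (so V = g~(A)/r = g(A)). *)
Definition KacMoody_model (K : fieldType) (n m : nat) (A : 'M[int]_n)
  (V : lmodType K) (br : V -> V -> V) (b : 'I_m -> V)
  (Aroot Acor : 'M[K]_(n, m)) (e f : 'I_n -> V) : Prop :=
  let cor i := \sum_(k < m) Acor i k *: b k in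
  [/\ [/\ is_lie_bracket br,
      m = (2 * n - \rank (intmx K A))%N &
      forall c : 'I_m -> K, \sum_(k < m) c k *: b k = 0 -> forall k, c k = 0],
      [/\ \rank Aroot = n, \rank Acor = n & Acor *m Aroot^T = intmx K A],
      [/\ forall i j, br (e i) (f j) = if i == j then cor i else 0,
          forall k l, br (b k) (b l) = 0,
          forall k i, br (b k) (e i) = Aroot i k *: e i &
          forall k i, br (b k) (f i) = - (Aroot i k *: f i)],
      forall x, gen_subalgebra br
                  (fun y => (exists k, y = b k) \/ (exists i, y = e i) \/ (exists i, y = f i)) x &
      forall J, lie_ideal br J -> (forall x, J x -> hsp b x -> x = 0) ->
        forall x, J x -> x = 0].

(* Main.v *)
(* A bracket in the sense of [is_lie_bracket] is linear in its first argument only,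
   and need be neither bilinear nor antisymmetric.

   Suppose first that it is.  The contravariant Hermitian form [H] is positive
   definite on the root spaces (Kac, Theorem 11.7).  With [x'] the adjoint of a root
   vector [x] of weight [k], and [y] of weight [l], one gets
     |[x, y]|^2 = |[x', y]|^2 - (k|l) |x|^2 |y|^2.
   In a graded solvable subalgebra L these identities force two root vectors to
   commute as soon as their bracket has a nonzero weight of norm (k|k) <= 0, and force
   [L_k, L_-k] to be central in L.  So the nonzero weights of M = L^(2) have norms in
   a finite range [1, N], and the rest of M is central.  A long chain [x_1, [x_2, ... z]]
   of weight vectors of M that stays nonzero under all permutations of the x_i is
   impossible: by pigeonhole many of the weights agree modulo 2N, hence have pairwise
   inner products >= 1, and their sum has norm > N.  Since permuting the x_i taken in
   the j-th derived algebra of M costs brackets with the (j+1)-st, downward induction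
   on j shows that M is nilpotent.

   In general, [x, [y, z]] is still trilinear and alternating in y, z.  Replacing the
   bracket on the span of the Cartan subalgebra and of the root spaces by the
   bilinear antisymmetric bracket with the same values on root vectors gives an
   antisymmetric model, and on L the two brackets differ by elements of the centre
   only, which adds two steps to the lower central series. *)

Require Import Defs.
From HB Require Import structures.
From mathcomp Require Import all_boot all_order all_algebra.
From mathcomp Require Import boolp ring zify.
Set Implicit Arguments. Unset Strict Implicit. Unset Printing Implicit Defensive.
Import Order.TTheory GRing.Theory Num.Theory.
Local Open Scope ring_scope.

(** Positivity of the form is the costly ingredient. For a positive root [k] the scalar 2(rho|k) -
    (k|k) times the norm of x is the Gram sum of a cobracket of x, nonnegative by a Schur product
    argument; the scalar is positive because reflections bring a root of positive norm down to a
    simple one, which also yields the bound N on all norms. Positivity holds on root spaces and not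
    on the Cartan subalgebra, so each use of the norm identity must keep the weight of the vector it
    estimates away from 0; hence the many conditions [k != l] and [k + l != 0]. Congruences between
    inner products require integers, hence an integral symmetriser. The second derived algebra
    appears because weight-0 vectors are known to be central only inside [L, L], and imaginary
    weights are excluded among brackets of such elements. For a one-sided bracket the obstacle is
    that bracketing by z need not be additive, so that even weight spaces are not visibly subspaces;
    the remedy is to work with vectors of the form [h, [h, w]], on which it is linear. *)

(* Reflexive decision of linear identities: [module] reduces an equality in an
   [lmodType] to equalities of the coefficients of each atom, left to [ring]. *)
Inductive lexp (K : Type) : Type :=
  LVar of nat | LZero | LAdd of lexp K & lexp K | LOpp of lexp K | LScale of K & lexp K.

Section LinearExpressions.
Variables (K : comNzRingType) (V : lmodType K).
Fixpoint leval (env : seq V) (t : lexp K) : V :=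
  match t with
  | LVar i => nth 0 env i
  | LZero => 0
  | LAdd t u => leval env t + leval env u
  | LOpp t => - leval env t
  | LScale a t => a *: leval env t
  end.
(** [eqn] is used directly so that [cbn] computes the coefficients inside [module]. *)
Fixpoint lcoef (t : lexp K) (i : nat) : K :=
  match t with
  | LVar j => if eqn j i then 1 else 0
  | LZero => 0
  | LAdd t u => lcoef t i + lcoef u i
  | LOpp t => - lcoef t i
  | LScale a t => a * lcoef t i
  end.
Fixpoint lcoef_eq (t u : lexp K) (i n : nat) : Prop :=
  if n is n'.+1 then lcoef t i = lcoef u i /\ lcoef_eq t u i.+1 n' else True.

Lemma leval_sum env t : leval env t = \sum_(i < size env) lcoef t i *: env`_i.
Proof.
elim: t => [j||t Ht u Hu|t Ht|a t Ht]; rewrite [leval _ _]/=.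
- have E (i : 'I_(size env)) : lcoef (LVar K j) i *: env`_i = if j == i then env`_i else 0.
    by rewrite /= -[eqn j i]/(j == i :> nat); case: eqP; rewrite ?scale1r ?scale0r.
  rewrite (eq_bigr _ (fun i _ => E i)) -big_mkcond /=.
  have [js|js] := ltnP j (size env).
    by rewrite (big_pred1 (Ordinal js)) // => i; rewrite eq_sym.
  rewrite nth_default // big1 // => i /eqP ji.
  by have := ltn_ord i; rewrite -ji ltnNge js.
- by rewrite big1 // => i _; rewrite scale0r.
- by rewrite Ht Hu -big_split; apply: eq_bigr => i _; rewrite /= scalerDl.
- by rewrite Ht -sumrN; apply: eq_bigr => i _; rewrite scaleNr.
- by rewrite Ht scaler_sumr; apply: eq_bigr => i _; rewrite scalerA.
Qed.
Lemma leval_eq env t u : lcoef_eq t u 0 (size env) -> leval env t = leval env u.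
Proof.
move=> H; rewrite !leval_sum; apply: eq_bigr => i _; congr (_ *: _).
suff E k n : lcoef_eq t u k n -> forall j, (j < n)%N -> lcoef t (k + j)%N = lcoef u (k + j)%N.
  by have := E _ _ H i (ltn_ord i).
elim: n k => [//|n IH] k /= [E0 E1] [|j] jn; first by rewrite addn0.
by rewrite addnS -addSn; apply: IH.
Qed.
End LinearExpressions.

Ltac module_index x env :=
  lazymatch env with
  | nil => constr:(0%N)
  | cons x _ => constr:(0%N)
  | cons _ ?r => let k := module_index x r in constr:(S k)
  end.
Ltac module_mem x env :=
  lazymatch env with
  | nil => constr:(false)
  | cons x _ => constr:(true)
  | cons _ ?r => module_mem x r
  end.
Ltac module_atoms t env :=
  lazymatch t with
  | Algebra.zero => env
  | Algebra.add ?u ?v => let e := module_atoms u env in module_atoms v e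
  | Algebra.opp ?u => module_atoms u env
  | GRing.scale _ ?u => module_atoms u env
  | _ => lazymatch module_mem t env with
         | true => env
         | false => constr:(cons t env)
         end
  end.
Ltac module_reify K t env :=
  lazymatch t with
  | Algebra.zero => constr:(LZero K)
  | Algebra.add ?u ?v =>
      let u' := module_reify K u env in let v' := module_reify K v env in constr:(LAdd u' v')
  | Algebra.opp ?u => let u' := module_reify K u env in constr:(LOpp u')
  | GRing.scale ?a ?u => let u' := module_reify K u env in constr:(@LScale K a u')
  | _ => let i := module_index t env in constr:(LVar K i)
  end.
Ltac module V :=
  lazymatch type of V with
  | GRing.Lmodule.type ?R =>
    let K := constr:(GRing.PzRing.sort R) in
    lazymatch goal with
    | |- ?x = ?y =>
      let e0 := module_atoms x (@nil (GRing.Lmodule.sort V)) in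
      let env := module_atoms y e0 in
      let t := module_reify K x env in
      let u := module_reify K y env in
      change (@leval _ V env t = @leval _ V env u);
      apply: leval_eq; cbn [size lcoef_eq lcoef eqn]; do ?split; try ring
    end
  end.

(** * Subspaces and Lie brackets *)

Section Subspaces.
Variables (K : fieldType) (V : lmodType K).
Implicit Types (S P : V -> Prop) (x y : V).

Lemma sub0 S : subspace S -> S 0. Proof. by case. Qed.
Lemma subD S x y : subspace S -> S x -> S y -> S (x + y).
Proof. by move=> [_ cl] Sx Sy; rewrite -[x]scale1r; apply: cl. Qed.
Lemma subZ S a x : subspace S -> S x -> S (a *: x).
Proof. by move=> [S0 cl] Sx; rewrite -[_ *: _]addr0; apply: cl. Qed.
Lemma subN S x : subspace S -> S x -> S (- x).
Proof. by move=> HS Sx; rewrite -scaleN1r; apply: subZ. Qed.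
Lemma subB S x y : subspace S -> S x -> S y -> S (x - y).
Proof. by move=> HS Sx Sy; apply: subD => //; apply: subN. Qed.
Lemma sub_sum S (I : Type) (r : seq I) (Q : pred I) (F : I -> V) :
  subspace S -> (forall i, Q i -> S (F i)) -> S (\sum_(i <- r | Q i) F i).
Proof. by move=> HS HF; elim/big_ind: _ => //; [exact: sub0 | move=> *; apply: subD]. Qed.

Lemma span_subspace P : subspace (span_of P).
Proof.
split=> [S HS _ | a x y Hx Hy S HS HP]; first exact: sub0.
by apply: (proj2 HS); [apply: Hx | apply: Hy].
Qed.
Lemma span_in P x : P x -> span_of P x.
Proof. by move=> Px S _; apply. Qed.
Lemma span_min P S x : subspace S -> (forall y, P y -> S y) -> span_of P x -> S x.
Proof. by move=> HS HP H; apply: H. Qed.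
Lemma span_mono P Q x : (forall y, P y -> Q y) -> span_of P x -> span_of Q x.
Proof.
by move=> PQ Hx; apply: (span_min (span_subspace Q) _ Hx) => y /PQ; apply: span_in.
Qed.
Lemma subspace_zero : subspace (fun x : V => x = 0).
Proof. by split=> // a u v -> ->; rewrite scaler0 addr0. Qed.
Lemma gen_subalgebra_min br P S x : lie_subalgebra br S ->
  (forall y, P y -> S y) -> gen_subalgebra br P x -> S x.
Proof. by move=> HS HP H; apply: H. Qed.
End Subspaces.

(** [is_lie_bracket] gives linearity on the left and [br x x = 0] only; with antisymmetry the
    bracket becomes bilinear, the setting of the classical half of the proof. *)
Definition anticomm_lie (K : fieldType) (V : lmodType K) (br : V -> V -> V) : Prop :=
  is_lie_bracket br /\ forall x y, br x y = - br y x.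

Section LieBasics.
Variables (K : fieldType) (V : lmodType K) (br : V -> V -> V).
Hypothesis Hbr : anticomm_lie br.

Lemma lieC x y : br x y = - br y x. Proof. exact: (proj2 Hbr). Qed.
Lemma lieDl x y z : br (x + y) z = br x z + br y z.
Proof. by have [[L _ _] _] := Hbr; have := L 1 x y z; rewrite !scale1r. Qed.
Lemma lie0l z : br 0 z = 0.
Proof. by apply: (addrI (br 0 z)); rewrite -lieDl !addr0. Qed.
Lemma lieZl a x z : br (a *: x) z = a *: br x z.
Proof. by have [[L _ _] _] := Hbr; have := L a x 0 z; rewrite lie0l !addr0. Qed.
Lemma lieNl x z : br (- x) z = - br x z.
Proof. by rewrite -scaleN1r lieZl scaleN1r. Qed.
Lemma liexx x : br x x = 0. Proof. by have [[_ ->] _] := Hbr. Qed.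
Lemma lieDr x y z : br x (y + z) = br x y + br x z.
Proof. by rewrite lieC lieDl opprD -!lieC. Qed.
Lemma lie0r z : br z 0 = 0. Proof. by rewrite lieC lie0l oppr0. Qed.
Lemma lieZr a x z : br x (a *: z) = a *: br x z.
Proof. by rewrite lieC lieZl -scalerN -lieC. Qed.
Lemma lieNr x z : br x (- z) = - br x z.
Proof. by rewrite -scaleN1r lieZr scaleN1r. Qed.
Lemma lieBr x y z : br x (y - z) = br x y - br x z.
Proof. by rewrite lieDr lieNr. Qed.
Lemma lie_preimage S x : subspace S -> subspace (fun z => S (br x z)).
Proof.
move=> HS; split=> [|a u v Hu Hv]; first by rewrite lie0r; exact: (sub0 HS).
by rewrite lieDr lieZr; exact: (proj2 HS).
Qed.
Lemma lie_suml I (r : seq I) (P : pred I) (F : I -> V) z :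
  br (\sum_(i <- r | P i) F i) z = \sum_(i <- r | P i) br (F i) z.
Proof. by apply: (big_morph (br^~ z)) => [x y|]; rewrite ?lieDl ?lie0l. Qed.
Lemma lie_sumr I (r : seq I) (P : pred I) (F : I -> V) z :
  br z (\sum_(i <- r | P i) F i) = \sum_(i <- r | P i) br z (F i).
Proof. by apply: (big_morph (br z)) => [x y|]; rewrite ?lieDr ?lie0r. Qed.
Lemma lieJ x y z : br x (br y z) = br (br x y) z + br y (br x z).
Proof.
have [[_ _ J] _] := Hbr; have /eqP := J x y z.
rewrite -addrA addr_eq0 => /eqP ->.
by rewrite opprD -lieNr -lieC -lieC addrC.
Qed.
Lemma lieJl x y z : br (br x y) z = br x (br y z) - br y (br x z).
Proof. by rewrite lieJ addrK. Qed.

Lemma lbracket_subspace L M : subspace (lbracket br L M).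
Proof. exact: span_subspace. Qed.
Lemma lbracket_in (L M : V -> Prop) x y : L x -> M y -> lbracket br L M (br x y).
Proof. by move=> Lx My; apply: span_in; exists x, y. Qed.
Lemma lbracket_min (L M S : V -> Prop) z : subspace S ->
  (forall x y, L x -> M y -> S (br x y)) -> lbracket br L M z -> S z.
Proof. by move=> HS H Hz; apply: (span_min HS _ Hz) => _ [x [y [Lx My ->]]]; apply: H. Qed.
Lemma lbracket_mono (L M L' M' : V -> Prop) z :
  (forall x, L x -> L' x) -> (forall x, M x -> M' x) ->
  lbracket br L M z -> lbracket br L' M' z.
Proof.
move=> HL HM Hz; apply: (lbracket_min (lbracket_subspace _ _) _ Hz) => x y Lx My.
by apply: lbracket_in; [apply: HL | apply: HM].
Qed.

(* The elements normalising a subspace form a subalgebra. *)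
Lemma gen_stable (P S : V -> Prop) x : subspace S ->
  (forall y z, P y -> S z -> S (br y z)) -> gen_subalgebra br P x ->
  forall z, S z -> S (br x z).
Proof.
move=> HS HP Hx; apply: (@gen_subalgebra_min _ _ br _ (fun x => forall z, S z -> S (br x z)) _ _ _ Hx).
  split; [split|].
  - by move=> z _; rewrite lie0l; apply: sub0.
  - move=> a u v Hu Hv z Sz; rewrite lieDl lieZl.
    by apply: subD => //; [apply: subZ => //; apply: Hu | apply: Hv].
  - move=> u v Hu Hv z Sz; rewrite lieJl; apply: subB => //.
      by apply: Hu; apply: Hv.
    by apply: Hv; apply: Hu.
by move=> y Py z Sz; apply: HP.
Qed.

Lemma lie_subalgebra_derived L k : lie_subalgebra br L -> lie_subalgebra br (derived br L k).
Proof.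
elim: k => [//|k IH] HL; have [HS Hc] := IH HL.
split; first exact: lbracket_subspace.
move=> x y Hx Hy /=; apply: lbracket_in.
  by apply: (lbracket_min HS _ Hx) => u v Lu Lv; apply: Hc.
by apply: (lbracket_min HS _ Hy) => u v Lu Lv; apply: Hc.
Qed.
Lemma derived_sub (L : V -> Prop) k x : lie_subalgebra br L -> derived br L k.+1 x -> derived br L k x.
Proof.
move=> HL; have [HS Hc] := lie_subalgebra_derived k HL.
by move=> Hx; apply: (lbracket_min HS _ Hx) => u v; apply: Hc.
Qed.
Lemma derived_sub0 (L : V -> Prop) k x : lie_subalgebra br L -> derived br L k x -> L x.
Proof. by move=> HL; elim: k x => [//|k IH] x /derived_sub H; apply/IH/H. Qed.
End LieBasics.

(** * Weights and the triangular decomposition *)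

Section WeightValues.
Variables (K : numClosedFieldType) (n m : nat) (R : 'M[K]_(n, m)).
Implicit Types k l : 'rV[int]_n.

(** The integer vector [k] stands for the functional sum of k_i alpha_i, with alpha_i given by row
    [i] of [R]; this is its value on the [j]-th basis vector of the Cartan subalgebra. *)
Definition wtv k (j : 'I_m) : K := \sum_i (k 0 i)%:~R * R i j.

Lemma wtv0 j : wtv 0 j = 0.
Proof. by rewrite /wtv big1 // => i _; rewrite mxE mul0r. Qed.
Lemma wtvD k l j : wtv (k + l) j = wtv k j + wtv l j.
Proof. by rewrite -big_split; apply: eq_bigr => i _; rewrite mxE rmorphD mulrDl. Qed.
Lemma wtvN k j : wtv (- k) j = - wtv k j.
Proof. by apply: (addrI (wtv k j)); rewrite -wtvD !subrr wtv0. Qed.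
Lemma wtvB k l j : wtv (k - l) j = wtv k j - wtv l j.
Proof. by rewrite wtvD wtvN. Qed.
Lemma wtv_delta i j : wtv (delta_mx 0 i) j = R i j.
Proof.
rewrite /wtv (bigD1 i) //= mxE !eqxx mul1r big1 ?addr0 // => i' ni.
by rewrite mxE (negPf ni) andbF mul0r.
Qed.
Lemma wtv_inj k l : \rank R = n -> (forall j, wtv k j = wtv l j) -> k = l.
Proof.
move=> rk Hj; have rf : row_free R by rewrite /row_free rk.
have E0 : map_mx (fun z : int => z%:~R : K) (k - l) *m R = 0 *m R.
  rewrite mul0mx.
  apply/rowP => j; rewrite !mxE; under eq_bigr => i _ do rewrite mxE.
  by rewrite -[LHS]/(wtv (k - l) j) wtvB Hj subrr.
have /rowP E := row_free_inj rf E0.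
apply/eqP; rewrite -subr_eq0; apply/eqP/rowP => i; have := E i; rewrite !mxE.
by move/eqP; rewrite intr_eq0 => /eqP.
Qed.
End WeightValues.

Definition wtsp (K : numClosedFieldType) (V : lmodType K) (br : V -> V -> V) (n m : nat)
  (b : 'I_m -> V) (R : 'M[K]_(n, m)) (k : 'rV[int]_n) (x : V) : Prop :=
  forall j, br (b j) x = wtv R k j *: x.

Section Weights.
Variables (K : numClosedFieldType) (V : lmodType K) (br : V -> V -> V) (n m : nat).
Variables (b : 'I_m -> V) (R : 'M[K]_(n, m)).
Hypotheses (Hbr : anticomm_lie br) (rk : \rank R = n).
Local Notation wt := 'rV[int]_n.
Local Notation g := (wtsp br b R).
Implicit Types (k l : wt) (x y : V).

Lemma wtsp_sub k : subspace (g k).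
Proof.
split=> [j | a x y Hx Hy j]; first by rewrite lie0r // scaler0.
by rewrite lieDr // lieZr // Hx Hy scalerDr !scalerA mulrC.
Qed.
Lemma wtsp_br k l x y : g k x -> g l y -> g (k + l) (br x y).
Proof.
move=> Hx Hy j; rewrite lieJ // Hx Hy lieZl // lieZr //.
by rewrite -scalerDl wtvD.
Qed.

(** Acting by [b j] minus its eigenvalue at the head weight [l] removes that term and rescales the
    others, by a nonzero factor at [k] for a suitable [j], which the rank of [R] provides. *)
Lemma wtsp_indep (s : seq wt) (u : wt -> V) : uniq s -> (forall k, g k (u k)) ->
  \sum_(k <- s) u k = 0 -> forall k, k \in s -> u k = 0.
Proof.
elim: s u => [//|l s IH] u /= /andP[ls us] Hu; rewrite big_cons => Hsum.
have rest k : k \in s -> u k = 0.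
  move=> ks; have kl : k != l by apply: contraNneq ls => <-.
  have [j Hj] : exists j, wtv R k j != wtv R l j.
    apply/not_existsP => Hall; case/negP: kl; apply/eqP/(wtv_inj rk) => j.
    by have /negP := Hall j; rewrite negbK => /eqP.
  suff /eqP : (wtv R k j - wtv R l j) *: u k = 0.
    by rewrite scaler_eq0 subr_eq0 (negPf Hj) => /eqP.
  apply: (IH (fun k => (wtv R k j - wtv R l j) *: u k)) => // [k'|].
    exact/(subZ _ (wtsp_sub _)).
  have : br (b j) (u l + \sum_(k <- s) u k) - wtv R l j *: (u l + \sum_(k <- s) u k) = 0.
    by rewrite Hsum lie0r // scaler0 subrr.
  rewrite lieDr // Hu lie_sumr // scalerDr opprD addrACA subrr add0r scaler_sumr -sumrB => E.
  by rewrite -[RHS]E; apply: eq_bigr => k' _; rewrite Hu scalerBl.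
move=> k; rewrite inE => /orP[/eqP->|]; last exact: rest.
by move: Hsum; rewrite big_seq big1 ?addr0.
Qed.

(** The support is only bounded by some list [s], and the sum may run over any duplicate-free list
    containing it, so that two decompositions can be added and compared over a common list. *)
Definition wt_decomp x (u : wt -> V) := (forall k, g k (u k)) /\
  exists s : seq wt, forall t, uniq t -> {subset s <= t} -> x = \sum_(k <- t) u k.

Lemma wt_decomp_lin a x y u v : wt_decomp x u -> wt_decomp y v ->
  wt_decomp (a *: x + y) (fun k => a *: u k + v k).
Proof.
move=> [Hu [s Hs]] [Hv [t Ht]]; split=> [k|].
  by apply: (proj2 (wtsp_sub k)).
exists (s ++ t) => r ur sub; rewrite big_split -scaler_sumr /=.
rewrite -(Hs r) // -?(Ht r) // => k Hk; apply: sub; rewrite mem_cat Hk ?orbT //.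
Qed.
Lemma wt_decomp_uniq x u v : wt_decomp x u -> wt_decomp x v -> u =1 v.
Proof.
move=> Du Dv k; have [Hw [s Hs]] := wt_decomp_lin (-1) Du Dv.
apply/eqP; rewrite eq_sym -subr_eq0 addrC -scaleN1r; apply/eqP.
apply: (@wtsp_indep (undup (k :: s)) (fun k => -1 *: u k + v k)); rewrite ?undup_uniq //.
  by rewrite -Hs ?undup_uniq ?scaleN1r ?addNr // => l Hl; rewrite mem_undup inE Hl orbT.
by rewrite mem_undup mem_head.
Qed.
Lemma wt_decomp_in k x : g k x -> wt_decomp x (fun l => if l == k then x else 0).
Proof.
move=> Hx; split=> [l|]; first by case: eqP => [->|_] //; apply: sub0; apply: wtsp_sub.
exists [:: k] => t ut sub; rewrite (bigD1_seq k) ?sub ?mem_head //= eqxx big1 ?addr0 // => l.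
by move/negPf->.
Qed.
Lemma wt_decomp_br k x y u : g k x -> wt_decomp y u ->
  wt_decomp (br x y) (fun l => br x (u (l - k))).
Proof.
move=> Hx [Hu [s Hs]]; split=> [l|]; first by rewrite -{1}[l](subrKC k); apply: wtsp_br.
exists (map (+%R k) s) => t ut sub.
rewrite (Hs (map (fun l => l - k) t)) ?big_map ?lie_sumr //.
  by rewrite map_inj_uniq //; apply: addIr.
move=> l ls; apply/mapP; exists (k + l); last by rewrite addrC addKr.
by apply: sub; apply: map_f.
Qed.

Hypothesis total : forall x, exists u, wt_decomp x u.

Definition proj k x : V := projT1 (cid (total x)) k.

Lemma projP x : wt_decomp x (proj^~ x).
Proof. by rewrite /proj; case: (cid _). Qed.
Lemma proj_eq x u k : wt_decomp x u -> proj k x = u k.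
Proof. by move=> Du; apply: (wt_decomp_uniq (projP x) Du). Qed.
Lemma proj_wt k x : g k (proj k x). Proof. by have [H _] := projP x. Qed.
Lemma proj_lin k a x y : proj k (a *: x + y) = a *: proj k x + proj k y.
Proof. by rewrite (proj_eq k (wt_decomp_lin a (projP x) (projP y))). Qed.
Lemma proj_id k x : g k x -> proj k x = x.
Proof. by move=> Hx; rewrite (proj_eq k (wt_decomp_in Hx)) eqxx. Qed.
Lemma proj_ne k l x : g k x -> l != k -> proj l x = 0.
Proof. by move=> Hx nk; rewrite (proj_eq l (wt_decomp_in Hx)) (negPf nk). Qed.
Lemma proj_br k l x y : g k x -> proj l (br x y) = br x (proj (l - k) y).
Proof. by move=> Hx; rewrite (proj_eq l (wt_decomp_br Hx (projP y))). Qed.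
Lemma proj_sum x : exists2 s, uniq s & x = \sum_(k <- s) proj k x.
Proof.
have [_ [s Hs]] := projP x; exists (undup s); first exact: undup_uniq.
by apply: Hs; rewrite ?undup_uniq // => k; rewrite mem_undup.
Qed.
Lemma proj0 k : proj k 0 = 0.
Proof. by rewrite proj_id //; apply: sub0; apply: wtsp_sub. Qed.
Lemma projZ k a x : proj k (a *: x) = a *: proj k x.
Proof. by have := proj_lin k a x 0; rewrite proj0 !addr0. Qed.

Hypothesis brbb : forall i j, br (b i) (b j) = 0.

Lemma hsp_b j : hsp b (b j).
Proof.
exists (fun i => (i == j)%:R); rewrite (bigD1 j) //= eqxx scale1r big1 ?addr0 // => i.
by move/negPf->; rewrite scale0r.
Qed.
Lemma wtsp_b j : g 0 (b j).
Proof. by move=> i; rewrite brbb wtv0 scale0r. Qed.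

(** Every nonzero weight component of [x] has the eigenvalues of [alpha], and distinct lattice
    weights have distinct eigenvalues, so only one component survives. This brings the arbitrary
    functionals of a grading back to the root lattice. *)
Lemma rootsp_wtsp (alpha : V -> K) x : rootsp br b alpha x -> exists k, g k x.
Proof.
move=> Hx.
have [->|nx] := eqVneq x 0; first by exists 0; apply: sub0; apply: wtsp_sub.
have ev k j : proj k x != 0 -> alpha (b j) = wtv R k j.
  move=> nk; have := congr1 (proj k) (Hx _ (hsp_b j)).
  rewrite projZ (proj_br _ _ (wtsp_b j)) subr0.
  rewrite (proj_wt k x j) => /eqP; rewrite -subr_eq0 -scalerBl scaler_eq0 (negPf nk) orbF.
  by rewrite subr_eq0 => /eqP ->.
have [s us Es] := proj_sum x.
have [k nk] : exists k, proj k x != 0.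
  apply/not_existsP => H; case/eqP: nx; rewrite Es big1 // => k _.
  by have /negP := H k; rewrite negbK => /eqP.
exists k; suff -> : x = proj k x by apply: proj_wt.
have other l : l != k -> proj l x = 0.
  apply: contraNeq => nl; apply/eqP/(wtv_inj rk) => j.
  by rewrite -(ev l) // -(ev k).
have ks : k \in s.
  apply: contraNT nx => ks; rewrite Es big1_seq // => l /= ls.
  by apply: other; apply: contraNneq ks => <-.
rewrite {1}Es (bigD1_seq k) //= big1 ?addr0 // => l; exact: other.
Qed.
End Weights.

Section Heights.
Variable n : nat.
Implicit Types k l : 'rV[int]_n.

Definition ht k : int := \sum_i k 0 i.
Definition kpos k := [forall i, 0 <= k 0 i] && (k != 0).

Lemma htD k l : ht (k + l) = ht k + ht l.
Proof. by rewrite /ht -big_split; apply: eq_bigr => i _; rewrite mxE. Qed.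
Lemma ht0 : ht 0 = 0. Proof. by rewrite /ht big1 // => i _; rewrite mxE. Qed.
Lemma htN k : ht (- k) = - ht k.
Proof. by apply: (addrI (ht k)); rewrite -htD !subrr ht0. Qed.
Lemma htB k l : ht (k - l) = ht k - ht l. Proof. by rewrite htD htN. Qed.
Lemma ht_delta i : ht (delta_mx 0 i) = 1.
Proof.
rewrite /ht (bigD1 i) //= mxE !eqxx big1 ?addr0 // => j nj.
by rewrite mxE (negPf nj) andbF.
Qed.
Lemma kposP k : reflect ((forall i, 0 <= k 0 i) /\ k <> 0) (kpos k).
Proof.
apply: (iffP andP) => [[/forallP H /eqP nk] | [H /eqP nk]]; split=> //.
exact/forallP.
Qed.
Lemma kpos_ht k : kpos k -> 0 < ht k.
Proof.
case/kposP => H nk; rewrite lt_def sumr_ge0 // andbT.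
apply: contra_notN nk => /eqP E; apply/rowP => i; rewrite mxE.
move/eqP: E; rewrite psumr_eq0 // => /allP /(_ i).
by rewrite mem_index_enum => /(_ isT) /eqP.
Qed.
Lemma kposN k : kpos k -> ~~ kpos (- k).
Proof. by move/kpos_ht => H; apply/negP => /kpos_ht; rewrite htN; lia. Qed.
Lemma kpos_neq0 k : kpos k -> k != 0. Proof. by case/andP. Qed.
Lemma kpos_delta i : kpos (delta_mx 0 i).
Proof.
apply/kposP; split=> [j|/rowP /(_ i)]; first by rewrite mxE; case: (_ && _).
by rewrite !mxE !eqxx.
Qed.
Lemma kposD k l : kpos k -> kpos l -> kpos (k + l).
Proof.
move=> Hk Hl; apply/kposP; split=> [i|E].
  by case/kposP: Hk => Hk _; case/kposP: Hl => Hl _; rewrite mxE addr_ge0.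
by have := kpos_ht Hk; have := kpos_ht Hl; have := congr1 ht E; rewrite htD ht0; lia.
Qed.
End Heights.

Section Words.
Variables (K : numClosedFieldType) (V : lmodType K) (br : V -> V -> V) (n : nat).
Variable (e : 'I_n -> V).

(* [words k]: the span of the iterated brackets of the [e i] of weight [k]. *)
Inductive words : 'rV[int]_n -> V -> Prop :=
| words0 k : words k 0
| words_gen i : words (delta_mx 0 i) (e i)
| words_lin k a x y : words k x -> words k y -> words k (a *: x + y)
| words_ad k j x : words k x -> words (delta_mx 0 j + k) (br (e j) x).

Lemma words_subspace k : subspace (words k).
Proof. by split; [exact: words0 | exact: words_lin]. Qed.
Lemma words_kpos k x : (forall y, br y 0 = 0) -> words k x -> x = 0 \/ kpos k.
Proof.
move=> br0; elim=> {k x} [k|i|k a x y _ [->|Hk] _ [->|Hk']|k j x _ [->|Hk]].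
- by left.
- by right; apply: kpos_delta.
- by left; rewrite scaler0 addr0.
- by right. 
- by right.
- by right.
- by left.
- by right; apply: kposD => //; apply: kpos_delta.
Qed.
Lemma words_delta i x k : (forall y, br y 0 = 0) -> words k x -> k = delta_mx 0 i ->
  exists a, x = a *: e i.
Proof.
move=> br0; elim=> {k x} [k|j|k a x y _ Hx _ Hy|k j x Wx Hx] E.
- by exists 0; rewrite scale0r.
- exists 1; rewrite scale1r; congr (e _).
  by have := congr1 (fun M : 'rV[int]_n => M 0 i) E; rewrite !mxE !eqxx /=; case: eqP => [->|].
- have [c ->] := Hx E; have [d ->] := Hy E.
  by exists (a * c + d); rewrite scalerA scalerDl.
- have [->|kk] := words_kpos br0 Wx.
    by exists 0; rewrite scale0r br0.
  by have := kpos_ht kk; have := congr1 (@ht n) E; rewrite htD !ht_delta; lia.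
Qed.
End Words.

(** Exchanging the [e i] with the [f i] and negating roots and coroots gives a model on the same
    algebra, so every result on the positive part also serves for the negative part. Antisymmetry is
    asked of the generators alone, so that a one-sided bracket qualifies too. *)
Lemma KM_mirror_of (K : numClosedFieldType) (n m : nat) (A : 'M[int]_n)
  (V : lmodType K) (br : V -> V -> V) (b : 'I_m -> V)
  (Aroot Acor : 'M[K]_(n, m)) (e f : 'I_n -> V) : (forall i j, br (f i) (e j) = - br (e j) (f i)) ->
  KacMoody_model A br b Aroot Acor e f -> KacMoody_model A br b (- Aroot) (- Acor) f e.
Proof.
move=> fe [[L1 L2 L3] [R1 R2 R3] [S1 S2 S3 S4] G J]; split=> //.
- split; rewrite ?mxrank_opp //.
  by rewrite linearN /= mulmxN mulNmx opprK.
- split=> //.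
  + move=> i j; rewrite fe S1 eq_sym; case: eqP => [->|_]; rewrite ?oppr0 //.
    by rewrite -sumrN; apply: eq_bigr => k _; rewrite mxE scaleNr.
  + by move=> k i; rewrite S4 mxE scaleNr.
  + by move=> k i; rewrite S3 mxE scaleNr opprK.
- move=> x S HS HP; apply: (gen_subalgebra_min HS _ (G x)) => y Hy.
  by refine (HP y _); case: Hy => [|[]]; auto.
Qed.

Lemma KM_mirror (K : numClosedFieldType) (n m : nat) (A : 'M[int]_n)
  (V : lmodType K) (br : V -> V -> V) (b : 'I_m -> V)
  (Aroot Acor : 'M[K]_(n, m)) (e f : 'I_n -> V) : (forall x y, br x y = - br y x) ->
  KacMoody_model A br b Aroot Acor e f -> KacMoody_model A br b (- Aroot) (- Acor) f e.
Proof. by move=> ac; apply: KM_mirror_of => i j; apply: ac. Qed.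

Lemma wtsp_mirror (K : numClosedFieldType) (n m : nat) (V : lmodType K)
    (br : V -> V -> V) (b : 'I_m -> V) (R : 'M[K]_(n, m)) k x :
  wtsp br b (- R) k x <-> wtsp br b R (- k) x.
Proof.
suff E j : wtv (- R) k j = wtv R (- k) j by split=> H j; rewrite H E.
by apply: eq_bigr => i _; rewrite !mxE rmorphN mulrN mulNr.
Qed.

Lemma hsp_subspace (K : fieldType) (V : lmodType K) m (b : 'I_m -> V) : subspace (hsp b).
Proof.
split=> [|a x y [c ->] [d ->]].
  by exists (fun=> 0); rewrite big1 // => i _; rewrite scale0r.
exists (fun k => a * c k + d k).
by rewrite scaler_sumr -big_split; apply: eq_bigr => i _; rewrite /= scalerA scalerDl.
Qed.

Section Model.
Variables (K : numClosedFieldType) (n m : nat) (A : 'M[int]_n).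
Variables (V : lmodType K) (br : V -> V -> V) (b : 'I_m -> V).
Variables (Aroot Acor : 'M[K]_(n, m)) (e f : 'I_n -> V).
Hypothesis ac : forall x y, br x y = - br y x.
Hypothesis KM : KacMoody_model A br b Aroot Acor e f.
Local Notation wt := 'rV[int]_n.
Local Notation g := (wtsp br b Aroot).
Local Notation dl i := (delta_mx 0 i : 'rV[int]_n).
Implicit Types (k l : wt) (x y : V).

Lemma KM_lie : anticomm_lie br. Proof. by case: KM => [[]]. Qed.
Lemma KM_rk : \rank Aroot = n. Proof. by case: KM => _ []. Qed.
Lemma KM_bb i j : br (b i) (b j) = 0. Proof. by case: KM => _ _ []. Qed.
Lemma KM_ge i : g (dl i) (e i).
Proof. by move=> j; case: KM => _ _ [_ _ -> _] _ _; rewrite wtv_delta. Qed.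
Lemma KM_gf i : g (- dl i) (f i).
Proof. by move=> j; case: KM => _ _ [_ _ _ ->] _ _; rewrite wtvN wtv_delta scaleNr. Qed.
Local Notation Hbr := KM_lie.
Local Notation gS := (wtsp_sub b Aroot Hbr).

Definition hv (c : 'rV[K]_m) : V := \sum_j c 0 j *: b j.
Definition evw k (c : 'rV[K]_m) : K := \sum_j c 0 j * wtv Aroot k j.
Definition cart k i : int := \sum_j k 0 j * A i j.

Lemma hspP x : hsp b x <-> exists c, x = hv c.
Proof.
split=> [[c ->]|[c ->]]; last by exists (fun j => c 0 j).
by exists (\row_j c j); apply: eq_bigr => j _; rewrite mxE.
Qed.
Lemma hv_br k c x : g k x -> br (hv c) x = evw k c *: x.
Proof.
move=> Hx; rewrite (lie_suml Hbr) scaler_suml; apply: eq_bigr => j _.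
by rewrite (lieZl Hbr) Hx scalerA.
Qed.
Lemma hsp_g0 x : hsp b x -> g 0 x.
Proof.
move=> [c ->]; apply: sub_sum => [|j _]; first exact: gS.
by apply: (subZ _ (gS _)); apply: (wtsp_b _ KM_bb).
Qed.
Lemma KM_ef i j : br (e i) (f j) = if i == j then hv (row i Acor) else 0.
Proof.
case: KM => _ _ [-> _ _ _] _ _; case: eqP => // _.
by apply: eq_bigr => k _; rewrite mxE.
Qed.
Lemma evw_cor k i : evw k (row i Acor) = (cart k i)%:~R.
Proof.
rewrite /evw /wtv; under eq_bigr => j _ do rewrite mulr_sumr.
rewrite exchange_big /= /cart rmorph_sum; apply: eq_bigr => l _.
rewrite rmorphM /=; have -> : (A i l)%:~R = \sum_j Acor i j * Aroot l j.
  have [_ [_ _ CR] _ _ _] := KM; have := congr1 (fun M : 'M_n => M i l) CR.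
  by rewrite !mxE => <-; apply: eq_bigr => j _; rewrite mxE.
by rewrite mulr_sumr; apply: eq_bigr => j _; rewrite mxE; ring.
Qed.
Lemma cor_br k i x : g k x -> br (hv (row i Acor)) x = (cart k i)%:~R *: x.
Proof. by move=> Hx; rewrite (hv_br _ Hx) evw_cor. Qed.
Lemma br_ef i j : br (e i) (f j) = (i == j)%:R *: hv (row i Acor).
Proof. by rewrite KM_ef; case: eqP; rewrite ?scale1r ?scale0r. Qed.
Lemma br_fe j i : br (f j) (e i) = - ((i == j)%:R *: hv (row i Acor)).
Proof. by rewrite ac br_ef. Qed.
Lemma hv_hsp c : hsp b (hv c). Proof. by apply/hspP; exists c. Qed.

Lemma words_g k x : words br e k x -> g k x.
Proof.
elim=> {k x} [k|i|k a x y _ Hx _ Hy|k j x _ Hx].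
- by apply: sub0; apply: gS.
- exact: KM_ge.
- by apply: (proj2 (gS k)).
- by apply: wtsp_br; [exact: Hbr | exact: KM_ge |].
Qed.
(** Moving [f j] past a letter [e i] costs a coroot, which acts on weight vectors by a scalar; hence
    no negative word ever appears. *)
Lemma words_f j k x : words br e k x ->
  span_of (fun y => hsp b y \/ exists l, words br e l y) (br (f j) x).
Proof.
have SS P := @span_subspace K V P.
elim=> {k x} [k|i|k a x y _ Hx _ Hy|k i x Wx Hx].
- by rewrite (lie0r Hbr); apply: (sub0 (SS _)).
- rewrite br_fe; apply: (subN (SS _)); apply: (subZ _ (SS _)).
  by apply: span_in; left; apply: hv_hsp.
- rewrite (lieDr Hbr) (lieZr Hbr); apply: (subD (SS _)) => //; exact: (subZ _ (SS _)).
rewrite (lieJ Hbr) br_fe (lieNl Hbr) (lieZl Hbr) (cor_br _ (words_g Wx)).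
apply: (subD (SS _)).
  apply: (subN (SS _)); apply: (subZ _ (SS _)); apply: (subZ _ (SS _)).
  by apply: span_in; right; exists k.
apply: (@span_min _ _ _ (fun z => span_of _ (br (e i) z)) _ _ _ Hx) => [|z].
  exact: (lie_preimage Hbr _ (SS _)).
case=> [/hspP[c ->]|[l Wl]]; apply: span_in; right; last first.
  by exists (dl i + l); apply: words_ad.
exists (dl i); rewrite ac (hv_br _ (KM_ge i)) -scaleNr.
by apply: (subZ _ (words_subspace _ _ _)); apply: words_gen.
Qed.

Lemma KM_total x : exists u, wt_decomp br b Aroot x u.
Proof.
have [_ _ _ G _] := KM.
pose S x := exists u, wt_decomp br b Aroot x u.
have SS : subspace S.
  split=> [|a x' y [u Hu] [v Hv]].
    by eexists; apply: (wt_decomp_in Hbr (k := 0)); apply: sub0; apply: gS.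
  by eexists; apply: (wt_decomp_lin Hbr _ Hu Hv).
have inS k y : g k y -> S y by move=> Hy; eexists; apply: (wt_decomp_in Hbr Hy).
apply: (@gen_subalgebra_min _ _ br _ S x _ _ (G x)) => [|y [[k ->]|[[i ->]|[i ->]]]].
- split=> // y z [u [Hu [s Hs]]] [v Hv].
  rewrite (Hs (undup s)) ?undup_uniq // => [|l]; last by rewrite mem_undup.
  rewrite (lie_suml Hbr); apply: sub_sum => // k _.
  by eexists; apply: (wt_decomp_br Hbr (Hu k) Hv).
- by apply: (inS 0); apply: wtsp_b KM_bb _.
- exact: inS (KM_ge i).
- exact: inS (KM_gf i).
Qed.
End Model.

Section Triangular.
Variables (K : numClosedFieldType) (n m : nat) (A : 'M[int]_n).
Variables (V : lmodType K) (br : V -> V -> V) (b : 'I_m -> V).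
Variables (Aroot Acor : 'M[K]_(n, m)) (e f : 'I_n -> V).
Hypothesis ac : forall x y, br x y = - br y x.
Hypothesis KM : KacMoody_model A br b Aroot Acor e f.
Local Notation wt := 'rV[int]_n.
Local Notation g := (wtsp br b Aroot).
Local Notation dl i := (delta_mx 0 i : 'rV[int]_n).
Implicit Types (k l : wt) (x y : V).
Local Notation Hbr := (KM_lie ac KM).
Local Notation KM' := (KM_mirror ac KM).
Local Notation tri y :=
  (hsp b y \/ (exists k, words br e k y) \/ (exists k, words br f k y)).

Lemma wordsf_g k x : words br f k x -> g (- k) x.
Proof. by move/(words_g ac KM')/wtsp_mirror. Qed.

Lemma KM_span x : span_of (fun y => tri y) x.
Proof.
pose S := span_of (fun y => tri y).
have SS : subspace S by apply: span_subspace.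
have [_ _ _ G _] := KM.
have ge i : g (dl i) (e i) := KM_ge KM i.
have gf i : g (- dl i) (f i) := KM_gf KM i.
have Se i y : words br e i y -> S y by move=> H; apply: span_in; right; left; exists i.
have Sf i y : words br f i y -> S y by move=> H; apply: span_in; right; right; exists i.
have Sh y : hsp b y -> S y by move=> H; apply: span_in; left.
have stab y z : (exists j, y = b j) \/ (exists i, y = e i) \/ (exists i, y = f i) ->
    S z -> S (br y z).
  move=> Hy Hz; have lin : subspace (fun z => S (br y z)).
    exact: (lie_preimage Hbr _ SS).
  apply: (span_min lin _ Hz) => {z Hz} z Hz.
  case: Hy => [[k ->]|[[i ->]|[i ->]]].
  - have [l ->] : exists l, br (b k) z = wtv Aroot l k *: z.
      case: Hz => [/(hsp_g0 ac KM) H|[[l /(words_g ac KM) H]|[l /wordsf_g H]]]; eexists; exact: H.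
    by apply: (subZ _ SS); apply: span_in.
  - case: Hz => [/hspP[c ->]|[[l Wl]|[l Wl]]].
    + rewrite ac (hv_br ac KM _ (ge i)) -scaleNr; apply: (subZ _ SS).
      exact: Se (words_gen _ _ _).
    + by apply: Se; apply: words_ad Wl.
    + by have := words_f ac KM' i Wl; apply: span_mono => v [|]; auto.
  - case: Hz => [/hspP[c ->]|[[l Wl]|[l Wl]]].
    + rewrite ac (hv_br ac KM _ (gf i)) -scaleNr; apply: (subZ _ SS).
      exact: Sf (words_gen _ _ _).
    + by have := words_f ac KM i Wl; apply: span_mono => v [|]; auto.
    + by apply: Sf; apply: words_ad Wl.
apply: (gen_subalgebra_min _ _ (G x)) => [|y [[k ->]|[[i ->]|[i ->]]]].
- split=> // u v _ Sv; exact: (gen_stable Hbr SS stab (G u) Sv).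
- exact: Sh (hsp_b _ _).
- exact: Se (words_gen _ _ _).
- exact: Sf (words_gen _ _ _).
Qed.

Local Notation pr := (proj (KM_total ac KM)).
Local Notation rk := (KM_rk KM).

(** The piece of weight [k] in the triangular decomposition. The last branch covers weights of mixed
    sign; identifying weight spaces with these pieces shows that no root is of mixed sign. *)
Definition homog k x : Prop :=
  if k == 0 then hsp b x else if kpos k then words br e k x
  else if kpos (- k) then words br f (- k) x else x = 0.

Lemma homog_subspace k : subspace (homog k).
Proof.
rewrite /homog; case: eqP => _; first exact: hsp_subspace.
case: (kpos k); first exact: words_subspace.
case: (kpos (- k)); first exact: words_subspace.
exact: subspace_zero.
Qed.

Lemma KM_homog k x : g k x -> homog k x.
Proof.
move=> Hx; rewrite -(proj_id Hbr rk (KM_total ac KM) Hx).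
pose S x := forall k, homog k (pr k x).
have SS : subspace S.
  split=> [l|a y z Hy Hz l].
    by rewrite (proj0 Hbr rk); apply: (sub0 (homog_subspace _)).
  by rewrite (proj_lin Hbr rk); apply: (proj2 (homog_subspace _)).
have ext l y : g l y -> homog l y -> S y.
  move=> gy hy l'; have [->|ne] := eqVneq l' l; first by rewrite (proj_id Hbr rk).
  by rewrite (proj_ne Hbr rk _ gy ne); apply: (sub0 (homog_subspace _)).
suff: S x by apply.
apply: (span_min SS _ (KM_span x)) => y [Hy|[[l Wl]|[l Wl]]].
- by apply: (ext 0); [exact: (hsp_g0 ac KM) | rewrite /homog eqxx].
- have [->|kl] := words_kpos (lie0r Hbr) Wl; first exact: sub0.
  apply: (ext l); first exact: (words_g ac KM).
  by rewrite /homog (negPf (kpos_neq0 kl)) kl.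
- have [->|kl] := words_kpos (lie0r Hbr) Wl; first exact: sub0.
  apply: (ext (- l)); first exact: wordsf_g.
  rewrite /homog oppr_eq0 (negPf (kpos_neq0 kl)) opprK kl.
  by rewrite (negPf (kposN kl)).
Qed.
Lemma g0_hsp x : g 0 x -> hsp b x.
Proof. by move/KM_homog; rewrite /homog eqxx. Qed.
Lemma gpos_words k x : kpos k -> g k x -> words br e k x.
Proof. by move=> kk /KM_homog; rewrite /homog (negPf (kpos_neq0 kk)) kk. Qed.
Lemma g_sign k x : g k x -> x != 0 -> k != 0 -> kpos k \/ kpos (- k).
Proof.
move/KM_homog; rewrite /homog; case: eqP => //= _; case: ifP => [_ _ _ _|_]; first by left.
by case: ifP => [_ _ _ _|_ ->]; [right | rewrite eqxx].
Qed.
Lemma g_delta i x : g (dl i) x -> exists a, x = a *: e i.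
Proof. by move=> Hx; apply: (words_delta (lie0r Hbr) (gpos_words (kpos_delta i) Hx)). Qed.
Lemma words_mul_delta i x k : words br e k x ->
  forall r : int, 2 <= r -> k = r *: dl i -> x = 0.
Proof.
have dE (r : int) j : (r *: dl i) 0 j = if j == i then r else 0.
  by rewrite !mxE eqxx /=; case: eqP => _; rewrite ?mulr1 ?mulr0.
elim=> {k x} [//|j|k a x y _ Hx _ Hy|k j x Wx Hx] r r2 E.
- by have := congr1 (@ht n) E; rewrite ht_delta /ht (eq_bigr _ (fun j _ => dE r j));
    rewrite -big_mkcond big_pred1_eq; lia.
- by rewrite (Hx r) // (Hy r) // scaler0 addr0.
- have [->|kk] := words_kpos (lie0r Hbr) Wx; first by rewrite (lie0r Hbr).
  have ij : j = i.
    apply/eqP; apply: contraT => nj; have := congr1 (fun M : wt => M 0 j) E.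
    rewrite dE (negPf nj) !mxE !eqxx /=; case/kposP: kk => /(_ j); lia.
  have Ek : k = (r - 1) *: dl i.
    by apply: (addrI (dl j)); rewrite E ij scalerBl scale1r addrC subrK.
  have [r3|r2'] := leP 3 r; first by rewrite (Hx (r - 1)) ?(lie0r Hbr) //; lia.
  have [c ->] : exists c, x = c *: e i.
    by apply: (words_delta (lie0r Hbr) Wx); rewrite Ek (_ : r - 1 = 1) ?scale1r //; lia.
  by rewrite ij (lieZr Hbr) (liexx Hbr) scaler0.
Qed.


(* Generates an ideal inside the positive part, which is zero. *)
Lemma fkill_zero k x : kpos k -> g k x -> (forall i, br (f i) x = 0) -> x = 0.
Proof.
move=> kk gx fx.
(* [P] describes the weight vectors obtained from [x] by applying the [e i], encoded
   impredicatively: they lie in every subspace that contains [x] and is stable under all [e i]. *)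
pose P := fun y => exists l, [/\ kpos l, g l y &
  forall S, subspace S -> S x -> (forall i z, S z -> S (br (e i) z)) -> S y].
pose S0 := fun y => forall S, subspace S -> S x -> (forall i z, S z -> S (br (e i) z)) -> S y.
pose J := span_of P.
have JS : subspace J by apply: span_subspace.
have Px : P x by exists k; split.
have S0S : subspace S0.
  split=> [S HS _ _|a u v Hu Hv S HS Sx Se]; first exact: sub0.
  by apply: (proj2 HS); [apply: Hu | apply: Hv].
have Je i y : J y -> J (br (e i) y).
  apply: (@span_min _ _ _ (fun y => J (br (e i) y))) => [|z [l [kl gl Hl]]].
    exact: (lie_preimage Hbr _ JS).
  apply: span_in; exists (dl i + l); split; first by apply: kposD => //; apply: kpos_delta.
    by apply: (wtsp_br Hbr (KM_ge KM i) gl).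
  by move=> S HS Sx Se; exact: (Se _ _ (Hl S HS Sx Se)).
have Jh c y : J y -> J (br (hv b c) y).
  apply: (@span_min _ _ _ (fun y => J (br (hv b c) y))) => [|z [l [kl gl Hl]]].
    exact: (lie_preimage Hbr _ JS).
  rewrite (hv_br ac KM _ gl); apply: (subZ _ JS); apply: span_in; exists l; split=> //.
have Jf j y : J y -> J (br (f j) y).
  apply: (@span_min _ _ _ (fun y => J (br (f j) y))) => [|z [l [kl gl Hl]]].
    exact: (lie_preimage Hbr _ JS).
  (* The induction carries [J z] along, since commuting [f j] past [e i] produces a coroot acting on
     [z]. *)
  suff [] : J z /\ J (br (f j) z) by [].
  apply: (Hl (fun z => J z /\ J (br (f j) z))).
  - split=> [|a u v [Hu Hu'] [Hv Hv']]; first by rewrite (lie0r Hbr); split; exact: (sub0 JS).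
    by rewrite (lieDr Hbr) (lieZr Hbr); split; apply: (proj2 JS).
  - by rewrite fx; split; [apply: span_in | exact: (sub0 JS)].
  - move=> i u [Ju Jfu]; split; first exact: Je.
    rewrite (lieJ Hbr) (br_fe ac KM) (lieNl Hbr) (lieZl Hbr).
    apply: (subD JS); last exact: Je.
    by apply: (subN JS); apply: (subZ _ JS); apply: Jh.
have [_ _ _ G NI] := KM.
apply: (NI J) => [|y Jy hy|]; last by apply: span_in.
  split=> // y z Jz.
  apply: (gen_stable Hbr JS _ (G y) Jz) => u v [[j ->]|[[i ->]|[i ->]]].
  - by have /hspP[c ->] := hsp_b b j; apply: Jh.
  - exact: Je.
  - exact: Jf.
have p0 : pr 0 y = 0.
  apply: (@span_min _ _ _ (fun y => pr 0 y = 0) _ _ _ Jy) => [|z [l [kl gl _]]].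
    split=> [|a u v Hu Hv]; first exact: proj0 Hbr rk _ _.
    by rewrite (proj_lin Hbr rk) Hu Hv scaler0 addr0.
  by rewrite (proj_ne Hbr rk _ gl) // eq_sym kpos_neq0.
by rewrite -p0 (proj_id Hbr rk) //; apply: (hsp_g0 ac KM).
Qed.
End Triangular.

(** * The bilinear form on the root lattice *)

Section CartanForm.
Variables (n : nat) (A : 'M[int]_n) (c : 'I_n -> nat).
Hypothesis csym : forall i j, (c i)%:Z * A i j = (c j)%:Z * A j i.
Implicit Types k l : 'rV[int]_n.

Definition bf k l : int := \sum_i \sum_j k 0 i * l 0 j * ((c i)%:Z * A i j).

Lemma bfC k l : bf k l = bf l k.
Proof.
rewrite /bf exchange_big; apply: eq_bigr => j _; apply: eq_bigr => i _.
by rewrite csym (mulrC (k 0 i)).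
Qed.
Lemma bfDl k l h : bf (k + l) h = bf k h + bf l h.
Proof.
rewrite /bf -big_split; apply: eq_bigr => i _; rewrite -big_split; apply: eq_bigr => j _.
by rewrite !mxE !mulrDl.
Qed.
Lemma bfNl k h : bf (- k) h = - bf k h.
Proof.
rewrite /bf -sumrN; apply: eq_bigr => i _; rewrite -sumrN; apply: eq_bigr => j _.
by rewrite !mxE !mulNr.
Qed.
Lemma bf0l h : bf 0 h = 0.
Proof. by apply: (addrI (bf 0 h)); rewrite -bfDl !addr0. Qed.
Lemma bfZl a k h : bf (a *: k) h = a * bf k h.
Proof.
rewrite /bf mulr_sumr; apply: eq_bigr => i _; rewrite mulr_sumr; apply: eq_bigr => j _.
by rewrite !mxE !mulrA.
Qed.
Lemma bfDr k l h : bf h (k + l) = bf h k + bf h l.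
Proof. by rewrite bfC bfDl !(bfC h). Qed.
Lemma bfNr k h : bf h (- k) = - bf h k.
Proof. by rewrite bfC bfNl bfC. Qed.
Lemma bf0r h : bf h 0 = 0. Proof. by rewrite bfC bf0l. Qed.
Lemma bfZr a k h : bf h (a *: k) = a * bf h k.
Proof. by rewrite bfC bfZl bfC. Qed.
Lemma bfBl k l h : bf (k - l) h = bf k h - bf l h.
Proof. by rewrite bfDl bfNl. Qed.
Lemma bfBr k l h : bf h (k - l) = bf h k - bf h l.
Proof. by rewrite bfDr bfNr. Qed.
Lemma bf_delta i k : bf (delta_mx 0 i) k = (c i)%:Z * cart A k i.
Proof.
rewrite /bf (bigD1 i) //= [X in _ + X]big1 ?addr0 => [|i' ni].
  by rewrite /cart mulr_sumr; apply: eq_bigr => j _; rewrite mxE !eqxx mul1r mulrCA.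
by apply: big1 => j _; rewrite mxE (negPf ni) andbF !mul0r.
Qed.
Lemma cart_delta i j : cart A (delta_mx 0 j) i = A i j.
Proof.
rewrite /cart (bigD1 j) //= mxE !eqxx mul1r big1 ?addr0 // => l nl.
by rewrite mxE (negPf nl) andbF mul0r.
Qed.
Lemma cartD k l i : cart A (k + l) i = cart A k i + cart A l i.
Proof. by rewrite /cart -big_split; apply: eq_bigr => j _; rewrite mxE mulrDl. Qed.
Lemma cartN k i : cart A (- k) i = - cart A k i.
Proof. by rewrite /cart -sumrN; apply: eq_bigr => j _; rewrite mxE mulNr. Qed.
Lemma cartZ a k i : cart A (a *: k) i = a * cart A k i.
Proof. by rewrite /cart mulr_sumr; apply: eq_bigr => j _; rewrite mxE mulrA. Qed.
Lemma bf_sum k l : bf k l = \sum_i k 0 i * bf (delta_mx 0 i) l.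
Proof.
rewrite {1}/bf; apply: eq_bigr => i _; rewrite bf_delta /cart !mulr_sumr.
by apply: eq_bigr => j _; ring.
Qed.

(** This is 2(rho|k) for a Weyl vector rho: the linear form equal to (alpha_i|alpha_i) on
    alpha_i. *)
Definition rho2 k : int := \sum_i k 0 i * bf (delta_mx 0 i) (delta_mx 0 i).
Lemma rho2D k l : rho2 (k + l) = rho2 k + rho2 l.
Proof. by rewrite /rho2 -big_split; apply: eq_bigr => j _; rewrite mxE mulrDl. Qed.
Lemma rho2Z a k : rho2 (a *: k) = a * rho2 k.
Proof. by rewrite /rho2 mulr_sumr; apply: eq_bigr => j _; rewrite mxE mulrA. Qed.
Lemma rho2_delta i : rho2 (delta_mx 0 i) = bf (delta_mx 0 i) (delta_mx 0 i).
Proof.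
rewrite /rho2 (bigD1 i) //= mxE !eqxx mul1r big1 ?addr0 // => l nl.
by rewrite mxE (negPf nl) andbF mul0r.
Qed.
End CartanForm.

(** * Strings of sl_2 and reflections of roots *)

Section SL2.
Variables (K : numClosedFieldType) (n m : nat) (A : 'M[int]_n).
Variables (V : lmodType K) (br : V -> V -> V) (b : 'I_m -> V).
Variables (Aroot Acor : 'M[K]_(n, m)) (e f : 'I_n -> V).
Hypothesis ac : forall x y, br x y = - br y x.
Hypothesis KM : KacMoody_model A br b Aroot Acor e f.
Hypothesis gcm : is_GCM A.
Local Notation wt := 'rV[int]_n.
Local Notation g := (wtsp br b Aroot).
Local Notation dl i := (delta_mx 0 i : 'rV[int]_n).
Implicit Types (k l : wt) (x y : V).
Local Notation Hbr := (KM_lie ac KM).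
Local Notation E i := (br (e i)).
Local Notation F i := (br (f i)).

Lemma cart_ii i : cart A (dl i) i = 2.
Proof. by have [H _ _] := gcm; rewrite cart_delta H. Qed.
Lemma iter_f_wt i a k x : g k x -> g (k - a%:Z *: dl i) (iter a (F i) x).
Proof.
move=> Hx; elim: a => [|a IH] /=; first by rewrite scale0r subr0.
have -> : k - a.+1%:Z *: dl i = - dl i + (k - a%:Z *: dl i).
  by rewrite -[a.+1]addn1 PoszD scalerDl scale1r opprD addrA addrC.
exact: (wtsp_br Hbr (KM_gf KM i) IH).
Qed.
Lemma iter_e_wt i a k x : g k x -> g (k + a%:Z *: dl i) (iter a (E i) x).
Proof.
move=> Hx; elim: a => [|a IH] /=; first by rewrite scale0r addr0.
have -> : k + a.+1%:Z *: dl i = dl i + (k + a%:Z *: dl i).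
  by rewrite -[a.+1]addn1 PoszD scalerDl scale1r addrA addrC.
exact: (wtsp_br Hbr (KM_ge KM i) IH).
Qed.
Lemma iter_lin i a s x y : iter a (F i) (s *: x + y) = s *: iter a (F i) x + iter a (F i) y.
Proof.
by elim: a => [|a IH] //=; rewrite IH (lieDr Hbr) (lieZr Hbr).
Qed.
Lemma iter0 h a : iter a (br h) 0 = 0.
Proof. by elim: a => [|a IH] //=; rewrite IH (lie0r Hbr). Qed.

Lemma comm_ef i a k x : g k x ->
  E i (iter a.+1 (F i) x) = iter a.+1 (F i) (E i x)
    + (a.+1%:Z * (cart A k i - a%:Z))%:~R *: iter a (F i) x.
Proof.
move=> Hx; elim: a => [|a IH].
  rewrite /= (lieJ Hbr) (KM_ef KM) eqxx (cor_br ac KM _ Hx) addrC.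
  by congr (_ + _ *: _); rewrite subr0 mul1r.
rewrite [in LHS]iterS (lieJ Hbr) (KM_ef KM) eqxx (cor_br ac KM _ (iter_f_wt _ a.+1 Hx)).
rewrite IH (lieDr Hbr) (lieZr Hbr) -!iterS addrCA; congr (_ + _).
rewrite -scalerDl -rmorphD; congr (_%:~R *: _).
rewrite cartD cartN cartZ cart_ii; lia.
Qed.
End SL2.

Section Integrability.
Variables (K : numClosedFieldType) (n m : nat) (A : 'M[int]_n).
Variables (V : lmodType K) (br : V -> V -> V) (b : 'I_m -> V).
Variables (Aroot Acor : 'M[K]_(n, m)) (e f : 'I_n -> V).
Hypothesis ac : forall x y, br x y = - br y x.
Hypothesis KM : KacMoody_model A br b Aroot Acor e f.
Hypothesis gcm : is_GCM A.
Local Notation wt := 'rV[int]_n.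
Local Notation g := (wtsp br b Aroot).
Local Notation dl i := (delta_mx 0 i : 'rV[int]_n).
Implicit Types (k l : wt) (x y : V).
Local Notation Hbr := (KM_lie ac KM).
Local Notation E i := (br (e i)).
Local Notation F i := (br (f i)).

Lemma comm_fe i a k x : g k x ->
  F i (iter a.+1 (E i) x) = iter a.+1 (E i) (F i x)
    - (a.+1%:Z * (cart A k i + a%:Z))%:~R *: iter a (E i) x.
Proof.
move=> Hx; have Hx' : wtsp br b (- Aroot) (- k) x by apply/wtsp_mirror; rewrite opprK.
rewrite (comm_ef ac (KM_mirror ac KM) gcm _ _ Hx') -scaleNr -rmorphN; congr (_ + _%:~R *: _).
by rewrite cartN; lia.
Qed.

(** The sl_2 fact that [F i] cannot kill a vector too early, proved by descending on the order [d]
    of nilpotency of [E i] and, inside, on [a], without a decomposition into irreducible modules. *)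
Lemma reflection_zero i (d : nat) (a : nat) k x : g k x -> a%:Z <= cart A k i ->
  iter d (E i) x = 0 -> iter a (F i) x = 0 -> x = 0.
Proof.
elim: d a k x => [//|d IHd] a k x Hx.
elim: a => [//|a IHa] Ha Ed Fa; apply: IHa => //; first by lia.
(* Since [x] is killed by the power [d.+1] of [E i], the power [d] takes the same value on
   [F i (E i x)] and on [cc *: x]; the outer induction then applies to their difference. *)
pose mu := cart A k i; pose cc : K := (d%:Z * (mu + d.+1%:Z))%:~R.
have Hex : g (dl i + k) (E i x) := wtsp_br Hbr (KM_ge KM i) Hx.
have gz : g k (F i (E i x) - cc *: x).
  apply: (subB (wtsp_sub b Aroot Hbr _)); last exact: (subZ _ (wtsp_sub b Aroot Hbr _)).
  by have := wtsp_br Hbr (KM_gf KM i) Hex; rewrite addKr.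
have FEx : F i (E i x) = cc *: x.
  apply/eqP; rewrite -subr_eq0; apply/eqP; apply: (IHd a.+1 k) => //.
  - rewrite -scaleNr addrC (iter_lin ac (KM_mirror ac KM)) .
    have [d0|[d' dE]] : d = 0%N \/ exists d', d = d'.+1.
      by case: (d) => [|d']; [left | right; exists d'].
      move: Ed; rewrite /cc d0 /= => ->.
      by rewrite (lie0r Hbr) mul0r oppr0 scale0r addr0.
    have := comm_fe i d' Hex; rewrite -iterSr -dE Ed (lie0r Hbr) => /eqP.
    rewrite eq_sym subr_eq0 => /eqP ->; rewrite -iterSr -dE -scalerDl.
    suff -> : - cc + (d%:Z * (cart A (dl i + k) i + d'%:Z))%:~R = 0.
      by rewrite scale0r.
    rewrite /cc -rmorphN -rmorphD cartD (cart_ii gcm) /mu; apply/eqP.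
    rewrite intr_eq0; lia.
  - rewrite -scaleNr addrC (iter_lin ac KM) Fa scaler0 add0r -iterSr.
    have := comm_ef ac KM gcm i a.+1 Hx; rewrite [iter a.+2 _ x]iterS Fa.
    by rewrite !(lie0r Hbr) scaler0 addr0.
(* What remains is that the power [a] of [F i] applied to [x], times cc + (a+1)(mu - a), is zero;
   this factor is positive. *)
have := comm_ef ac KM gcm i a Hx; rewrite Fa (lie0r Hbr) iterSr FEx.
rewrite -[cc *: x]addr0 (iter_lin ac KM) (iter0 ac KM) addr0 -scalerDl -rmorphD => /esym/eqP.
rewrite scaler_eq0 intr_eq0 => /orP[/eqP|/eqP//].
rewrite -/mu in Ha *; nia.
Qed.

Lemma iter_bracket_zero h s p q x y : iter p (br h) x = 0 -> iter q (br h) y = 0 ->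
  (p + q <= s.+1)%N -> iter s (br h) (br x y) = 0.
Proof.
elim: s p q x y => [|s IH] p q x y.
  case: p => [/= ->|p]; first by rewrite (lie0l Hbr).
  case: q => [_ /= -> _|q]; first by rewrite (lie0r Hbr).
  lia.
move=> Hp Hq Hs; rewrite iterSr (lieJ Hbr).
have it a u v : iter a (br h) (u + v) = iter a (br h) u + iter a (br h) v.
  by elim: a => [//|a' IHa] /=; rewrite IHa (lieDr Hbr).
rewrite it; case: p Hp Hs => [/= ->|p Hp Hs].
  by rewrite (lie0r Hbr) !(lie0l Hbr) (iter0 ac KM) addr0.
case: q Hq Hs => [/= ->|q Hq Hs].
  by rewrite (lie0r Hbr) !(lie0r Hbr) (iter0 ac KM) addr0.
rewrite (IH p q.+1) ?(IH p.+1 q) ?addr0 -?iterSr //; lia.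
Qed.

(** The vector is killed by every [f p], so [fkill_zero] applies. For [p = i] the exponent N makes
    the sl_2 coefficient N(a_ij + N - 1) vanish; for [p = j] there remains [e_i, e_i], or a multiple
    a_ji of [e i] when a_ji = 0. *)
Lemma serre i j : i != j -> iter `|1 - A i j|%N (E i) (e j) = 0.
Proof.
move=> nij; have [_ Aneg Azero] := gcm.
set N := `|1 - A i j|%N; set z := iter N (E i) (e j).
have aij : A i j <= 0 by apply: Aneg.
have NE : N%:Z = 1 - A i j by rewrite /N; lia.
have [N' NN] : exists N', N = N'.+1 by exists N.-1; lia.
have gz : g (dl j + N%:Z *: dl i) z by apply: (iter_e_wt ac KM); exact: (KM_ge KM).
have br_other p : p != i -> p != j -> forall a, br (f p) (iter a (E i) (e j)) = 0.
  move=> pi pj; elim=> [|a IH] /=.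
    by rewrite (br_fe ac KM) eq_sym (negPf pj) scale0r oppr0.
  by rewrite (lieJ Hbr) IH (br_fe ac KM) eq_sym (negPf pi) scale0r oppr0 (lie0l Hbr) (lie0r Hbr) addr0.
apply: (fkill_zero ac KM (k := dl j + N%:Z *: dl i)) => //.
  apply/kposP; split=> [p|/(congr1 (@ht n))].
    by rewrite !mxE; do 2 case: (_ && _); lia.
  rewrite htD ht0 ht_delta /ht; under eq_bigr => p _ do rewrite mxE.
  by rewrite -mulr_sumr -/(ht (dl i)) ht_delta; lia.
move=> p; have [->|pi] := eqVneq p i.
  rewrite /z NN (comm_fe i _ (KM_ge KM j)) (br_fe ac KM) eq_sym (negPf nij).
  rewrite scale0r oppr0 (iter0 ac KM) sub0r cart_delta.
  by rewrite (_ : _ * _ = 0) ?scale0r ?oppr0 //; lia.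
have [->|pj] := eqVneq p j; last exact: br_other.
have comm a : br (f j) (iter a (E i) (e j)) = iter a (E i) (br (f j) (e j)).
  elim: a => [//|a IH] /=.
  by rewrite (lieJ Hbr) IH (br_fe ac KM) (negPf nij) scale0r oppr0 (lie0l Hbr) add0r.
rewrite /z comm (br_fe ac KM) eqxx scale1r NN iterSr (lieNr Hbr) ac opprK.
rewrite (cor_br ac KM j (KM_ge KM i)) cart_delta.
case: (N') NN => [|N''] NN.
  have /eqP : A i j = 0 by lia.
  by rewrite Azero => /eqP ->; rewrite scale0r.
by rewrite iterSr (lieZr Hbr) (liexx Hbr) scaler0 (iter0 ac KM).
Qed.

(** By the Leibniz rule the vectors killed by a power of [E i] form a subalgebra; it contains the
    generators, the [e j] by the Serre relations. *)
Lemma locally_nilpotent i x : exists N, iter N (E i) x = 0.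
Proof.
have [_ _ _ G _] := KM.
have itl a s u v : iter a (E i) (s *: u + v) = s *: iter a (E i) u + iter a (E i) v.
  by elim: a => [|a IH] //=; rewrite IH (lieDr Hbr) (lieZr Hbr).
have more a a' u : iter a (E i) u = 0 -> (a <= a')%N -> iter a' (E i) u = 0.
  by move=> Hu le; rewrite -(subnK le) iterD Hu (iter0 ac KM).
apply: (@gen_subalgebra_min _ _ br _ (fun x => exists N, iter N (E i) x = 0) _ _ _ (G x)).
  split; [split|].
  - by exists 0%N.
  - move=> a u v [p Hp] [q Hq]; exists (p + q)%N.
    by rewrite itl (more _ _ _ Hp) ?(more _ _ _ Hq) ?scaler0 ?addr0 // ?leq_addr ?leq_addl.
  - by move=> u v [p Hp] [q Hq]; exists (p + q)%N; apply: iter_bracket_zero Hp Hq _.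
move=> y [[k ->]|[[j ->]|[j ->]]].
- exists 2; rewrite /= [br (e i) (b k)]ac (KM_ge KM i).
  by rewrite (lieNr Hbr) (lieZr Hbr) (liexx Hbr) scaler0 oppr0.
- have [->|nij] := eqVneq i j; first by exists 1%N; rewrite /= (liexx Hbr).
  by eexists; apply: serre nij.
- exists 3%N => /=; rewrite (br_ef KM) !(lieZr Hbr) [br (e i) (hv _ _)]ac.
  rewrite (cor_br ac KM i (KM_ge KM i)) (lieNr Hbr) (lieZr Hbr) (liexx Hbr).
  by rewrite scaler0 oppr0 scaler0.
Qed.

Lemma reflection i k x : g k x -> x != 0 -> 0 <= cart A k i ->
  exists2 y, y != 0 & g (k - cart A k i *: dl i) y.
Proof.
move=> Hx nx Hc; exists (iter `|cart A k i|%N (F i) x).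
  apply: contraNneq nx => Fx; have [N HN] := locally_nilpotent i x.
  by apply/eqP; apply: (reflection_zero Hx _ HN Fx); lia.
have := iter_f_wt ac KM i `|cart A k i|%N Hx.
by have -> : `|cart A k i|%:Z = cart A k i by lia.
Qed.

Variable c : 'I_n -> nat.
Hypothesis csym : forall i j, (c i)%:Z * A i j = (c j)%:Z * A j i.
Hypothesis cpos : forall i, (0 < c i)%N.
Local Notation bf := (bf A c).
Local Notation rho2 := (rho2 A c).

Lemma bf_dd i : bf (dl i) (dl i) = (c i)%:Z * 2.
Proof. by rewrite bf_delta (cart_ii gcm). Qed.

(* Reflecting a root of positive norm lowers its height until it becomes simple. *)
Lemma pos_root_bounds (M : int) k x : (forall i, bf (dl i) (dl i) <= M) ->
  kpos k -> g k x -> x != 0 ->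
  ((exists i, k = dl i) \/ bf k k < rho2 k) /\ (bf k k <= M \/ bf k k <= 0).
Proof.
move=> HM; have [N] := ubnP `|ht k|%N; elim: N k x => [//|N IH] k x HN kk Hx nx.
have hk := kpos_ht kk.
have [[i Ei]|ns] := pselect (exists i, k = dl i).
  by split; [left; exists i | left; rewrite Ei].
have [q0|q0] := leP (bf k k) 0.
  split; [right | by right].
  apply: le_lt_trans q0 _; rewrite lt_def; apply/andP; split; last first.
    by apply: sumr_ge0 => i _; case/kposP: kk => H _; rewrite mulr_ge0 // bf_dd.
  apply/eqP => r0; case/kposP: (kk) => Hk; apply; apply/rowP => i; rewrite mxE.
  move/eqP: r0; rewrite psumr_eq0 => [/allP /(_ i)|j _]; last by rewrite mulr_ge0 // bf_dd.
  rewrite mem_index_enum bf_dd => /(_ isT); rewrite /= mulf_eq0 => /orP[/eqP//|].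
  by have := cpos i; lia.
(* (k|k) is the sum of the k_i (alpha_i|k), so some term of it is positive. *)
have [i [ki bi]] : exists i, 0 < k 0 i /\ 0 < bf (dl i) k.
  apply/not_existsP => H; move: q0; rewrite ltNge => /negP; apply.
  rewrite (bf_sum A c); apply: sumr_le0 => i _.
  case/kposP: (kk) => /(_ i) Hi _; have [k0|k0] := ltP 0 (k 0 i); last first.
    by rewrite (_ : k 0 i = 0) ?mul0r //; lia.
  by rewrite mulr_ge0_le0 // leNgt; apply/negP => bpos; apply: (H i).
set a := cart A k i; have bia : bf (dl i) k = (c i)%:Z * a by rewrite bf_delta.
have a0 : 0 < a by have := cpos i; nia.
have [y ny Hy] := reflection Hx nx (ltW a0).
set k' := k - a *: dl i; rewrite -/a -/k' in Hy.
have k'0 : k' != 0.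
  apply/eqP => /eqP; rewrite subr_eq0 => /eqP E.
  by have : a = a * 2; [rewrite {1}/a E cartZ (cart_ii gcm) | lia].
have qk' : bf k' k' = bf k k.
  have bia' : bf k (dl i) = (c i)%:Z * a by rewrite (bfC csym).
  rewrite bfBl !(bfBr csym) !bfZl !(bfZr csym) bia bia' bf_dd; ring.
have hk' : ht k' = ht k - a.
  by rewrite htB /ht (eq_bigr _ (fun j _ => mxE _ _ _ _)) -mulr_sumr -/(ht (dl i)) ht_delta mulr1.
have rk' : rho2 k' = rho2 k - a * (c i)%:Z * 2.
  rewrite rho2D -scaleNr rho2Z rho2_delta bf_dd; ring.
(* The reflection changes coordinate [i] only, so a negative [k'] would make [k] a multiple of
   alpha_i, hence alpha_i itself. *)
have pk' : kpos k'.
  have [//|mk'] := g_sign ac KM Hy ny k'0.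
  have only j : j != i -> k 0 j = 0.
    move=> nj; case/kposP: kk => /(_ j) H1 _; case/kposP: mk' => /(_ j) H2 _; move: H2.
    rewrite /k' !mxE (negPf nj) andbF mulr0 subr0 oppr_ge0 => H3.
    by apply: le_anti; rewrite H3 H1.
  have kE : k = k 0 i *: dl i.
    apply/rowP => j; rewrite mxE mxE /=; have [->|nj] := eqVneq j i; first by rewrite mulr1.
    by rewrite only // mulr0.
  case/eqP: nx; apply: (words_mul_delta ac KM (gpos_words ac KM kk Hx) _ kE).
  have : k 0 i <> 1 by move=> k1; apply: ns; exists i; rewrite kE k1 scale1r.
  by move: ki; lia.
have [|IH1 IH2] := IH k' y _ pk' Hy ny.
  by have := kpos_ht pk'; lia.
rewrite qk' in IH1 IH2; have ci := cpos i.
split; last by left; case: IH2 => //; lia.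
right.
(* The norm is unchanged while [rho2] drops by 2 a c_i; the equality at a simple root thus becomes a
   strict inequality above it. *)
have H : bf k k <= rho2 k'.
  case: IH1 => [[j Ej]|]; last exact: ltW.
  by rewrite -qk' Ej rho2_delta.
by move: H; rewrite rk'; nia.
Qed.
End Integrability.

(* The entries of [d] in one connected component of the Dynkin diagram have
   positive rational ratios, so the symmetriser may be taken integral. *)
Lemma integral_symmetriser (K : numClosedFieldType) (n : nat) (A : 'M[int]_n) :
  is_GCM A -> symmetrisable K A ->
  exists c : 'I_n -> nat, (forall i, (0 < c i)%N) /\
    forall i j, (c i)%:Z * A i j = (c j)%:Z * A j i.
Proof.
move=> [Ad Aneg Az] [d [dn dA]].
pose r := [rel i j | A i j != 0].
have rsym : symmetric r by move=> i j; rewrite /= Az.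
pose Q i j := exists p : nat * nat, [/\ (0 < p.1)%N, (0 < p.2)%N &
  d i * p.2%:R = d j * p.1%:R].
have Qr i j : r i j -> Q i j.
  move=> /= nA; have [->|nij] := eqVneq i j; first by exists (1%N, 1%N).
  have nA' : A j i != 0 by rewrite Az.
  have nji : j != i by rewrite eq_sym.
  exists (`|A i j|%N, `|A j i|%N); split=> /=; rewrite ?absz_gt0 //.
  have H1 := Aneg _ _ nij; have H2 := Aneg _ _ nji.
  have E1 : A i j = - (`|A i j|%N : int) by lia.
  have E2 : A j i = - (`|A j i|%N : int) by lia.
  have := dA i j; rewrite {1}E1 {1}E2 !rmorphN !mulNr => /oppr_inj H.
  by rewrite mulrC [RHS]mulrC; symmetry.
have Qc i j : connect r i j -> Q i j.
  case/connectP => p; elim: p i => [|k p IH] i /=.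
    by move=> _ ->; exists (1%N, 1%N).
  case/andP => /Qr [[p1 q1] /= [p10 q10 E1]] /IH H /H [[p2 q2] /= [p20 q20 E2]].
  exists ((p1 * p2)%N, (q1 * q2)%N) => /=; rewrite !muln_gt0 p10 p20 q10 q20; split=> //.
  by rewrite !natrM mulrA E1 mulrAC E2; ring.
have csr : connect_sym r := sym_connect_sym rsym.
have /fin_all_exists [pq Hpq] : forall i, exists p : nat * nat, [/\ (0 < p.1)%N, (0 < p.2)%N &
    d i * p.2%:R = d (fingraph.root r i) * p.1%:R].
  by move=> i; apply: Qc; apply: connect_root.
(* With d_i q_i = d_root p_i, this choice makes d_i c_i equal to d_root times the product of all
   p_j, so [c] is proportional to 1/d on each component. *)
exists (fun i => ((pq i).2 * \prod_(j | j != i) (pq j).1)%N); split=> [i|i j].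
  rewrite muln_gt0; case: (Hpq i) => _ -> _ /=.
  by apply: prodn_gt0 => j; case: (Hpq j).
have [E|nA] := eqVneq (A i j) 0.
  by rewrite E; have /eqP := E; rewrite Az => /eqP ->; rewrite !mulr0.
have rt : fingraph.root r i = fingraph.root r j by apply/eqP; rewrite root_connect //; apply: connect1.
pose T := (\prod_j (pq j).1)%N.
have cE k : d k * ((pq k).2 * \prod_(j | j != k) (pq j).1)%N%:R = d (fingraph.root r k) * T%:R :> K.
  case: (Hpq k) => _ _ H; rewrite natrM mulrA H -mulrA -natrM; congr (_ * _%:R).
  by rewrite /T [RHS](bigD1 k).
suff : ((((pq i).2 * \prod_(j | j != i) (pq j).1)%N%:Z * A i j)%:~R
  = (((pq j).2 * \prod_(i | i != j) (pq i).1)%N%:Z * A j i)%:~R :> K) by apply: intr_inj.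
apply: (mulfI (dn i)); apply: (mulfI (dn j)).
have key u v w : d i * u = w -> d j * v = w ->
    d j * (d i * (u * (A i j)%:~R)) = d j * (d i * (v * (A j i)%:~R)).
  move=> Ei Ej.
  have -> : d j * (d i * (u * (A i j)%:~R)) = (d i * u) * ((A i j)%:~R * d j) by ring.
  have -> : d j * (d i * (v * (A j i)%:~R)) = (d j * v) * ((A j i)%:~R * d i) by ring.
  by rewrite Ei Ej dA.
rewrite !rmorphM /= -!natrM; apply: key (cE i) _.
by rewrite cE rt.
Qed.

(** * The contravariant Hermitian form *)

Section ConjForm.
Variable K : numClosedFieldType.
Local Notation cj M := (map_mx Num.conj M).

Lemma cjK p q (M : 'M[K]_(p, q)) : cj (cj M) = M.
Proof. by apply/matrixP => i j; rewrite !mxE conjCK. Qed.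

(** Serves to extend to the whole Cartan subalgebra a form that is prescribed as soon as one
    argument is a coroot. *)
Lemma hermitian_extension n m (C Y : 'M[K]_(n, m)) : \rank C = n ->
  (cj (Y *m C^T))^T = Y *m C^T ->
  exists2 S : 'M[K]_m, (cj S)^T = S & cj C *m S = Y.
Proof.
move=> rC hN; have /row_freeP[X CX] : row_free (cj C) by rewrite /row_free mxrank_map rC.
pose ad p q (M : 'M[K]_(p, q)) := (cj M)^T.
have adM p q r (M : 'M[K]_(p, q)) (N : 'M[K]_(q, r)) : ad _ _ (M *m N) = ad _ _ N *m ad _ _ M.
  by rewrite /ad map_mxM trmx_mul.
have adK p q (M : 'M[K]_(p, q)) : ad _ _ (ad _ _ M) = M.
  by rewrite /ad map_trmx trmxK cjK.
have adD p q (M N : 'M[K]_(p, q)) : ad _ _ (M + N) = ad _ _ M + ad _ _ N.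
  by rewrite /ad map_mxD linearD.
have adN p q (M : 'M[K]_(p, q)) : ad _ _ (- M) = - ad _ _ M.
  by rewrite /ad map_mxN linearN.
have CE : C^T = ad _ _ (cj C) by rewrite /ad cjK.
have {}hN : ad _ _ (Y *m C^T) = Y *m C^T by [].
have CYE : cj C *m ad _ _ Y = Y *m C^T by rewrite -[LHS]adK adM adK -CE hN.
move: (Y *m C^T) hN CYE => N hN CYE.
(* [X *m Y] solves the equation but need not be Hermitian; adding its adjoint and subtracting what
   is then counted twice repairs this. *)
exists (X *m Y + ad _ _ Y *m ad _ _ X - X *m N *m ad _ _ X).
  rewrite -/(ad _ _ _) adD adN adD !adM !adK hN mulmxA.
  by congr (_ - _); rewrite addrC.
by rewrite mulmxBr mulmxDr !mulmxA CX !mul1mx CYE addrK.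
Qed.
End ConjForm.

Section HalfForm.
Variables (K : numClosedFieldType) (n m : nat) (A : 'M[int]_n).
Variables (V : lmodType K) (br : V -> V -> V) (b : 'I_m -> V).
Variables (Aroot Acor : 'M[K]_(n, m)) (e f : 'I_n -> V).
Hypothesis ac : forall x y, br x y = - br y x.
Hypothesis KM : KacMoody_model A br b Aroot Acor e f.
Hypothesis gcm : is_GCM A.
Variable c : 'I_n -> nat.
Local Notation wt := 'rV[int]_n.
Local Notation g := (wtsp br b Aroot).
Local Notation dl i := (delta_mx 0 i : 'rV[int]_n).
Implicit Types (k l : wt) (x y : V).
Local Notation Hbr := (KM_lie ac KM).

Variables (co : V -> 'rV[K]_m) (h0 : 'rV[K]_m -> 'rV[K]_m -> K).
Hypothesis co_lin : forall a x y, co (a *: x + y) = a *: co x + co y.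
Hypothesis co_hv : forall d, co (hv b d) = d.
Hypothesis co_g : forall k x, g k x -> k != 0 -> co x = 0.
Hypothesis h0_herm : forall d d', h0 d d' = (h0 d' d)^*.
Hypothesis h0_lin : forall a d d1 d2, h0 d (a *: d1 + d2) = a * h0 d d1 + h0 d d2.
Hypothesis h0_cor : forall i d, h0 (row i Acor) d = (c i)%:R^-1 * evw Aroot (dl i) d.

(* [half_form k x xi]: [xi] is the functional (x | .) of the Hermitian form, for
   [x] of weight [k >= 0]; it is forced by [(e_j . x | v) = (x | f_j . v)]. *)
Inductive half_form : wt -> V -> (V -> K) -> Prop :=
| hf_zero k : half_form k 0 (fun=> 0)
| hf_cartan d : half_form 0 (hv b d) (fun v => h0 d (co v))
| hf_lin k a x y xi eta : half_form k x xi -> half_form k y eta ->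
    half_form k (a *: x + y) (fun v => a^* * xi v + eta v)
| hf_ad k j x xi : half_form k x xi ->
    half_form (dl j + k) (br (e j) x) (fun v => xi (br (f j) v)).

Lemma hf_g k x xi : half_form k x xi -> g k x.
Proof.
elim=> {k x xi} [k|d|k a x y xi eta _ Hx _ Hy|k j x xi _ Hx].
- exact: (sub0 (wtsp_sub _ _ Hbr _)).
- by apply: (hsp_g0 ac KM); apply: hv_hsp.
- by apply: (proj2 (wtsp_sub _ _ Hbr _)).
- exact: (wtsp_br Hbr (KM_ge KM j) Hx).
Qed.
Lemma hf_linr k x xi : half_form k x xi -> forall a u v, xi (a *: u + v) = a * xi u + xi v.
Proof.
elim=> {k x xi} [k|d|k s x y xi eta _ Hx _ Hy|k j x xi _ Hx] a u v.
- by rewrite mulr0 addr0.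
- by rewrite co_lin h0_lin.
- by rewrite Hx Hy; ring.
- by rewrite (lieDr Hbr) (lieZr Hbr) Hx.
Qed.
Lemma hf_0r k x xi : half_form k x xi -> xi 0 = 0.
Proof.
by move=> Hx; have := hf_linr Hx (-1) 0 0; rewrite scaler0 addr0 mulN1r addNr.
Qed.
Lemma hf_Zr k x xi a u : half_form k x xi -> xi (a *: u) = a * xi u.
Proof.
by move=> Hx; have := hf_linr Hx a u 0; rewrite (hf_0r Hx) !addr0.
Qed.
Lemma hf_Dr k x xi u v : half_form k x xi -> xi (u + v) = xi u + xi v.
Proof. by move=> Hx; have := hf_linr Hx 1 u v; rewrite scale1r mul1r. Qed.
Lemma h0_0 d : h0 d 0 = 0.
Proof. by have := h0_lin (-1) d 0 0; rewrite scaler0 addr0 mulN1r addNr. Qed.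
Lemma hf_supp k x xi l v : half_form k x xi -> g l v -> l != k -> xi v = 0.
Proof.
move=> Hx; elim: Hx l v => {k x xi} [//|d|k s x y xi eta _ Hx _ Hy|k j x xi _ Hx] l v gv nl.
- by rewrite (co_g gv nl) h0_0.
- by rewrite (Hx _ _ gv nl) (Hy _ _ gv nl) mulr0 addr0.
- apply: (Hx (- dl j + l)); first exact: (wtsp_br Hbr (KM_gf KM j) gv).
  by apply: contraNneq nl => <-; rewrite addrA addrN add0r.
Qed.
Lemma hf_pos k x xi : half_form k x xi ->
  (x = 0 /\ forall v, xi v = 0) \/ (k = 0 \/ kpos k).
Proof.
elim=> {k x xi} [k|d|k s x y xi eta _ [[-> Hx]|Hx] _ [[-> Hy]|Hy]|k j x xi _ [[-> Hx]|Hx]].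
- by left.
- by right; left.
- by left; rewrite scaler0 addr0; split=> // v; rewrite Hx Hy mulr0 addr0.
- by right.
- by right.
- by right.
- by left; rewrite (lie0r Hbr); split=> // v; rewrite Hx.
- right; right; case: Hx => [->|kk]; first by rewrite addr0; apply: kpos_delta.
  by apply: kposD => //; apply: kpos_delta.
Qed.
Lemma hf_weight0 k x xi : half_form k x xi -> k = 0 ->
  exists d, x = hv b d /\ forall v, xi v = h0 d (co v).
Proof.
have hv_lin a d d' : hv b (a *: d + d') = a *: hv b d + hv b d'.
  rewrite /hv scaler_sumr -big_split; apply: eq_bigr => i _.
  by rewrite /= !mxE scalerDl scalerA.
have hv0 : hv b 0 = 0 by rewrite /hv big1 // => i _; rewrite mxE scale0r.
have h00 d : h0 0 d = 0 by rewrite h0_herm h0_0 rmorph0.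
elim=> {k x xi} [k|d|k s x y xi eta _ Hx _ Hy|k j x xi Hf Hx] E.
- by exists 0; split=> // v; rewrite h00.
- by exists d.
- have [d [-> Hd]] := Hx E; have [d' [-> Hd']] := Hy E.
  exists (s *: d + d'); split; first by rewrite hv_lin.
  move=> v; rewrite Hd Hd' (h0_herm d) (h0_herm d') [RHS]h0_herm h0_lin.
  by rewrite rmorphD rmorphM.
- have [[-> H0]|Hk] := hf_pos Hf; last first.
    have := congr1 (@ht n) E; rewrite htD ht_delta ht0.
    case: Hk => [->|/kpos_ht]; first by rewrite ht0; lia.
    lia.
  exists 0; rewrite (lie0r Hbr); split=> // v.
  by rewrite H0 h00.
Qed.
Lemma hf_exists k x : g k x -> 0 <= ht k -> exists xi, half_form k x xi.
Proof.
move=> Hx hk; have [->|nx] := eqVneq x 0; first by eexists; apply: hf_zero.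
have [k0|k0] := eqVneq k 0.
  subst k; have /hspP[d ->] := g0_hsp ac KM Hx.
  by eexists; apply: hf_cartan.
have kk : kpos k.
  by have [//|/kpos_ht] := g_sign ac KM Hx nx k0; rewrite htN; lia.
elim: (gpos_words ac KM kk Hx) => {k x Hx hk nx k0 kk}
    [k|i|k a x y _ [xi Hxi] _ [eta Heta]|k j x _ [xi Hxi]].
- by eexists; apply: hf_zero.
(* [e i] is reached from weight 0: its bracket with its own coroot is -2 [e i]. *)
- have := hf_ad i (hf_cartan (row i Acor)); rewrite addr0.
  rewrite ac (cor_br ac KM i (KM_ge KM i)) (cart_ii gcm) => H.
  have := hf_lin (- 2^-1) H (hf_zero (dl i)).
  rewrite addr0 scaleNr scalerN opprK scalerA mulVf ?scale1r ?pnatr_eq0 // => H'.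
  by eexists; apply: H'.
- by eexists; apply: hf_lin Hxi Heta.
- by eexists; apply: hf_ad Hxi.
Qed.

(** A vector can be written as a combination of words in many ways, each carrying its own
    functional; this symmetry makes the values independent of the writing. Induction on the height,
    then on both words. *)
Lemma hf_sym k x y xi eta : half_form k x xi -> half_form k y eta -> xi y = (eta x)^*.
Proof.
have [N HN] : exists N : nat, ht k <= N%:Z by exists `|ht k|%N; lia.
elim: N k HN x y xi eta => [|N IH] k HN x y xi eta Hx Hy.
  have [[-> H0]|Hk] := hf_pos Hx; first by rewrite H0 (hf_0r Hy) rmorph0.
  have k0 : k = 0 by case: Hk => // /kpos_ht; lia.
  have [d [-> Hd]] := hf_weight0 Hx k0; have [d' [-> Hd']] := hf_weight0 Hy k0.
  by rewrite Hd Hd' !co_hv.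
elim: Hx HN y eta Hy => {k x xi} [k|d|k a x x1 xi xi1 _ Hx _ Hx1|k j x' xi' Hx' _] HN y eta Hy.
- by rewrite (hf_0r Hy) rmorph0.
- have h0N : ht (0 : wt) <= N%:Z by rewrite ht0.
  exact: (IH 0 h0N _ _ _ _ (hf_cartan d) Hy).
- by rewrite (Hx HN _ _ Hy) (Hx1 HN _ _ Hy) (hf_linr Hy) rmorphD rmorphM.
have [[-> H0]|Hk] := hf_pos Hx'; first by rewrite H0 (lie0r Hbr) (hf_0r Hy) rmorph0.
have {}HN : ht k <= N%:Z by move: HN; rewrite htD ht_delta; lia.
have k0 : 0 <= ht k by case: Hk => [->|/kpos_ht]; [rewrite ht0 | lia].
move E : (dl j + k) Hy => l Hy.
elim: Hy E => {l y eta} [l|d|l a y y1 eta eta1 _ Hy _ Hy1|l p y' eta' Hy' _] E.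
- by rewrite (lie0r Hbr) (hf_0r Hx') rmorph0.
- by have := congr1 (@ht n) E; rewrite htD ht_delta ht0; lia.
- by rewrite (lieDr Hbr) (lieZr Hbr) (hf_linr Hx') (Hy E) (Hy1 E) rmorphD rmorphM /= conjCK.
have [[-> H0]|Hl] := hf_pos Hy'.
  by rewrite H0 !(lie0r Hbr) (hf_0r Hx') rmorph0.
have hkl : ht k = ht l by have := congr1 (@ht n) E; rewrite !htD !ht_delta; lia.
have gx' := hf_g Hx'; have gy' := hf_g Hy'.
(* Simple weights are computed by hand: lowering [x'] and [y'] once more would leave the nonnegative
   heights on which [half_form] exists. *)
have [hk0|hk1] := eqVneq (ht k) 0.
  have k00 : k = 0 by case: Hk => // /kpos_ht; lia.
  have l00 : l = 0 by case: Hl => // /kpos_ht; lia.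
  have jp : j = p.
    move: E; rewrite k00 l00 !addr0 => /(congr1 (fun M : wt => M 0 j)).
    by rewrite !mxE !eqxx /=; case: eqP.
  subst p; have [d [-> Hd]] := hf_weight0 Hx' k00; have [d' [-> Hd']] := hf_weight0 Hy' l00.
  have step u : br (f j) (br (e j) (hv b u)) = evw Aroot (dl j) u *: hv b (row j Acor).
    rewrite [br (e j) _]ac (hv_br ac KM _ (KM_ge KM j)) (lieNr Hbr) (lieZr Hbr).
    by rewrite (br_fe ac KM) eqxx scale1r scalerN opprK.
  have coZ s u : co (s *: u) = s *: co u.
    have co0 : co 0 = 0.
      by have := co_lin (-1) 0 0; rewrite scaler0 addr0 scaleN1r addNr.
    by rewrite -[s *: u]addr0 co_lin co0 addr0.
  have h0Z s u v : h0 u (s *: v) = s * h0 u v.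
    by rewrite -[s *: v]addr0 h0_lin h0_0 addr0.
  rewrite Hd Hd' !step !coZ !co_hv !h0Z rmorphM.
  by rewrite (h0_herm d) (h0_herm d') !h0_cor !rmorphM !fmorphV !rmorph_nat /= ?conjCK; ring.
have gy'' : g (- dl j + l) (br (f j) y') := wtsp_br Hbr (KM_gf KM j) gy'.
have gx'' : g (- dl p + k) (br (f p) x') := wtsp_br Hbr (KM_gf KM p) gx'.
have [eta2 Hy2] : exists eta2, half_form (- dl j + l) (br (f j) y') eta2.
  by apply: hf_exists => //; rewrite htD htN ht_delta; lia.
have [xi2 Hx2] : exists xi2, half_form (- dl p + k) (br (f p) x') xi2.
  by apply: hf_exists => //; rewrite htD htN ht_delta; lia.
have E1 : dl p + (- dl j + l) = k by rewrite addrCA -E addrA addNr add0r.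
have E2 : dl j + (- dl p + k) = l by rewrite addrCA E addrA addNr add0r.
have E3 : - dl p + k = - dl j + l by rewrite -E1 addrA addNr add0r.
have := hf_ad p Hy2; rewrite E1 => Hy3; have := hf_ad j Hx2; rewrite E2 => Hx3.
have I1 := IH _ HN _ _ _ _ Hx' Hy3.
have HNl : ht l <= N%:Z by rewrite -hkl.
have I2 := IH _ HNl _ _ _ _ Hy' Hx3.
have HN3 : ht (- dl j + l) <= N%:Z by rewrite htD htN ht_delta; lia.
rewrite E3 in Hx2; have I3 := IH _ HN3 _ _ _ _ Hx2 Hy2.
(* Both sides expand into a pairing of [f p] x' with [f j] y', equal by induction, and a term in
   [f_j, e_p], which is zero or a coroot acting by an integer. *)
rewrite (lieJ Hbr) (hf_Dr _ _ Hx') I1 [br (f p) (br (e j) x')](lieJ Hbr) (hf_Dr _ _ Hy') I2.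
rewrite rmorphD /= conjCK -I3; congr (_ + _).
rewrite !(br_fe ac KM) [p == j]eq_sym; have [jp|_] := eqVneq j p; last first.
  by rewrite !scale0r oppr0 !(lie0l Hbr) (hf_0r Hx') (hf_0r Hy') rmorph0.
subst p; have kl : k = l by apply: (addrI (dl j)).
rewrite -kl in Hy' gy'; rewrite !scale1r !(lieNl Hbr) (cor_br ac KM _ gx') (cor_br ac KM _ gy').
rewrite -!scaleNr (hf_Zr _ _ Hx') (hf_Zr _ _ Hy') rmorphM rmorphN rmorph_int.
by rewrite (IH _ HN _ _ _ _ Hx' Hy').
Qed.
End HalfForm.

Section FullForm.
Variables (K : numClosedFieldType) (n m : nat) (A : 'M[int]_n).
Variables (V : lmodType K) (br : V -> V -> V) (b : 'I_m -> V).
Variables (Aroot Acor : 'M[K]_(n, m)) (e f : 'I_n -> V).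
Hypothesis ac : forall x y, br x y = - br y x.
Hypothesis KM : KacMoody_model A br b Aroot Acor e f.
Hypothesis gcm : is_GCM A.
Variable c : 'I_n -> nat.
Hypothesis csym : forall i j, (c i)%:Z * A i j = (c j)%:Z * A j i.
Hypothesis cpos : forall i, (0 < c i)%N.
Local Notation wt := 'rV[int]_n.
Local Notation g := (wtsp br b Aroot).
Local Notation dl i := (delta_mx 0 i : 'rV[int]_n).
Implicit Types (k l : wt) (x y : V).
Local Notation Hbr := (KM_lie ac KM).
Local Notation KM' := (KM_mirror ac KM).
Local Notation pr := (proj (KM_total ac KM)).
Local Notation rk := (KM_rk KM).

Lemma hv_lin a d d' : hv b (a *: d + d') = a *: hv b d + hv b d'.
Proof.
rewrite /hv scaler_sumr -big_split; apply: eq_bigr => i _.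
by rewrite /= !mxE scalerDl scalerA.
Qed.
Lemma hv_inj : injective (hv b).
Proof.
move=> d d' E; apply/rowP => j; apply/eqP; rewrite -subr_eq0; apply/eqP.
have [[_ _ free] _ _ _ _] := KM.
have E0 : hv b ((-1) *: d' + d) = 0 by rewrite hv_lin E scaleN1r addNr.
by have := free (fun j => ((-1) *: d' + d) 0 j) E0 j; rewrite !mxE mulN1r addrC.
Qed.

Lemma coord_exists x : exists d, pr 0 x = hv b d.
Proof. by apply/hspP; apply: (g0_hsp ac KM); apply: proj_wt. Qed.
Definition coord x : 'rV[K]_m := projT1 (cid (coord_exists x)).
Lemma coordP x : pr 0 x = hv b (coord x).
Proof. by rewrite /coord; case: (cid _). Qed.
Lemma coord_lin a x y : coord (a *: x + y) = a *: coord x + coord y.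
Proof. by apply: hv_inj; rewrite hv_lin -!coordP (proj_lin Hbr rk). Qed.
Lemma coord_hv d : coord (hv b d) = d.
Proof.
apply: hv_inj; rewrite -coordP (proj_id Hbr rk) //.
exact: (hsp_g0 ac KM (hv_hsp _ _)).
Qed.
Lemma coord_g k x : g k x -> k != 0 -> coord x = 0.
Proof.
move=> gx nk; apply: hv_inj; rewrite -coordP (proj_ne Hbr rk _ gx) 1?eq_sym //.
by rewrite /hv big1 // => j _; rewrite mxE scale0r.
Qed.

(** The condition of [hermitian_extension] is here that c_i^-1 a_ji is symmetric in i and j, which
    is [csym]. *)
Lemma cartan_form_exists : exists h0 : 'rV[K]_m -> 'rV[K]_m -> K,
  [/\ forall d d', h0 d d' = (h0 d' d)^*,
      forall a d d1 d2, h0 d (a *: d1 + d2) = a * h0 d d1 + h0 d d2 &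
      forall i d, h0 (row i Acor) d = (c i)%:R^-1 * evw Aroot (dl i) d].
Proof.
have [_ [_ rC CR] _ _ _] := KM.
pose D : 'M[K]_n := diag_mx (\row_i (c i)%:R^-1).
have CRe i j : \sum_k Acor i k * Aroot j k = (A i j)%:~R.
  have := congr1 (fun M : 'M_n => M i j) CR; rewrite !mxE => <-.
  by apply: eq_bigr => k _; rewrite mxE.
have cK i : (c i)%:R != 0 :> K by rewrite pnatr_eq0 -lt0n.
have YCe i j : (D *m Aroot *m Acor^T) i j = (c i)%:R^-1 * (A j i)%:~R.
  rewrite -mulmxA mul_diag_mx mxE mxE; congr (_ * _).
  by rewrite mxE -CRe; apply: eq_bigr => k _; rewrite mxE mulrC.
have [|S SH CS] := @hermitian_extension K n m Acor (D *m Aroot) rC.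
  apply/matrixP => i j; rewrite mxE mxE !YCe rmorphM fmorphV rmorph_nat rmorph_int.
  apply: (mulfI (cK i)); apply: (mulfI (cK j)).
  have := congr1 (fun z : int => z%:~R : K) (csym i j); rewrite /= !rmorphM /= -!pmulrn => E.
  have -> : (c j)%:R * ((c i)%:R * ((c j)%:R^-1 * (A i j)%:~R)) = (c i)%:R * (A i j)%:~R :> K.
    by rewrite mulrCA mulVKf.
  have -> : (c j)%:R * ((c i)%:R * ((c i)%:R^-1 * (A j i)%:~R)) = (c j)%:R * (A j i)%:~R :> K.
    by rewrite mulVKf.
  exact: E.
exists (fun d d' => (map_mx Num.conj d *m S *m d'^T) 0 0); split.
- move=> d d'; have -> : (map_mx Num.conj d *m S *m d'^T) =
      (map_mx Num.conj (map_mx Num.conj d' *m S *m d^T))^T.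
    by rewrite !map_mxM cjK !trmx_mul SH map_trmx trmxK mulmxA.
  by rewrite !mxE.
- move=> a d d1 d2; rewrite linearD linearZ /= mulmxDr mxE; congr (_ + _).
  by rewrite -scalemxAr mxE.
- move=> i d; have -> : map_mx Num.conj (row i Acor) = row i (map_mx Num.conj Acor).
    by apply/rowP => j; rewrite !mxE.
  rewrite -row_mul CS mul_diag_mx mxE /evw mulr_sumr; apply: eq_bigr => j _.
  by rewrite !mxE wtv_delta; ring.
Qed.

Inductive lin_closure (G : V -> (V -> K) -> Prop) : V -> (V -> K) -> Prop :=
| lc_in x xi : G x xi -> lin_closure G x xi
| lc_lin a x y xi eta : lin_closure G x xi -> lin_closure G y eta ->
    lin_closure G (a *: x + y) (fun v => a^* * xi v + eta v).

(** Symmetry on the generating pairs passes to the closure and shows that the functional attached to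
    a vector is determined by it, so an arbitrary choice defines the form. *)
Lemma lin_closure_form (G : V -> (V -> K) -> Prop) :
  (forall x xi, G x xi -> forall a u v, xi (a *: u + v) = a * xi u + xi v) ->
  (forall x y xi eta, G x xi -> G y eta -> xi y = (eta x)^*) ->
  (forall x, exists xi, lin_closure G x xi) ->
  exists H : V -> V -> K, [/\ forall x y, H x y = (H y x)^*,
      forall x a u v, H x (a *: u + v) = a * H x u + H x v &
      forall x xi, G x xi -> H x =1 xi].
Proof.
move=> Glin Gsym Gex.
have lin x xi : lin_closure G x xi -> forall a u v, xi (a *: u + v) = a * xi u + xi v.
  elim=> {x xi} [x xi /Glin//|s x y xi eta _ Hx _ Hy] a u v.
  by rewrite Hx Hy; ring.
have sym x y xi eta : lin_closure G x xi -> lin_closure G y eta -> xi y = (eta x)^*.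
  move=> Hx; elim: Hx y eta => {x xi} [x xi Gx|s x x' xi xi' _ Hx _ Hx'] y eta Hy; last first.
    by rewrite (Hx _ _ Hy) (Hx' _ _ Hy) (lin _ _ Hy) rmorphD rmorphM.
  elim: Hy => {y eta} [y eta Gy|s y y' eta eta' _ Hy _ Hy']; first exact: Gsym.
  by rewrite (Glin _ _ Gx) Hy Hy' rmorphD rmorphM /= conjCK.
pose H x := projT1 (cid (Gex x)).
have HP x : lin_closure G x (H x) by rewrite /H; case: (cid _).
exists H; split=> [x y|x|x xi Gx y]; first exact: sym.
  exact: lin (HP x).
by rewrite (sym _ _ _ _ (HP x) (HP y)) -(sym _ _ _ _ (lc_in Gx) (HP y)).
Qed.

(** Glues the form built from the [e i] with the one built from the [f i] in the mirrored model;
    they overlap only in weight 0, where both are [h0]. *)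
Lemma invariant_form : exists H : V -> V -> K,
  [/\ forall x y, H x y = (H y x)^*,
      forall x a u v, H x (a *: u + v) = a * H x u + H x v,
      forall k l x y, g k x -> g l y -> k != l -> H x y = 0,
      forall j x y, H (br (e j) x) y = H x (br (f j) y) &
      forall i d, H (hv b (row i Acor)) (hv b d) = (c i)%:R^-1 * evw Aroot (dl i) d].
Proof.
have [h0 [h0_herm h0_lin h0_cor]] := cartan_form_exists.
pose hfE := half_form br b e f coord h0.
pose hfF := half_form br b f e coord h0.
have coord_g' k x : wtsp br b (- Aroot) k x -> k != 0 -> coord x = 0.
  by move/wtsp_mirror => H nk; apply: (coord_g H); rewrite oppr_eq0.
have h0_cor' i d : h0 (row i (- Acor)) d = (c i)%:R^-1 * evw (- Aroot) (dl i) d.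
  have -> : row i (- Acor) = (-1) *: row i Acor + 0.
    by apply/rowP => j; rewrite !mxE mulN1r addr0.
  have z : h0 d 0 = 0 by have := h0_lin (-1) d 0 0; rewrite scaler0 addr0 mulN1r addNr.
  rewrite h0_herm h0_lin z addr0 mulN1r rmorphN /= -h0_herm h0_cor -mulrN; congr (_ * _).
  rewrite /evw -sumrN; apply: eq_bigr => j _.
  by rewrite !wtv_delta mxE mulrN.
have symE := hf_sym ac KM gcm coord_lin coord_hv h0_herm h0_lin h0_cor.
have symF := hf_sym ac KM' gcm coord_lin coord_hv h0_herm h0_lin h0_cor'.
have gE k x xi : hfE k x xi -> g k x := @hf_g _ _ _ _ _ _ _ _ _ _ _ ac KM coord h0 k x xi.
have gF k x xi : hfF k x xi -> g (- k) x.
  by move/(hf_g ac KM')/wtsp_mirror.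
have suE := hf_supp ac KM coord_g h0_lin.
have suF := hf_supp ac KM' coord_g' h0_lin.
have posE := @hf_pos _ _ _ _ _ _ _ _ _ _ _ ac KM coord h0.
have posF := @hf_pos _ _ _ _ _ _ _ _ _ _ _ ac KM' coord h0.
pose G x xi := exists k, hfE k x xi \/ hfF k x xi.
have Glin x xi : G x xi -> forall a u v, xi (a *: u + v) = a * xi u + xi v.
  by case=> k [Hx|Hx]; [apply: (hf_linr ac KM coord_lin h0_lin Hx)
                       | apply: (hf_linr ac KM' coord_lin h0_lin Hx)].
have h0l d : h0 d 0 = 0 by have := h0_lin (-1) d 0 0; rewrite scaler0 addr0 mulN1r addNr.
have symEF k l x y xi eta : hfE k x xi -> hfF l y eta -> xi y = (eta x)^*.
  move=> Hx Hy; have [E|nk] := eqVneq k (- l); last first.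
    rewrite (suE _ _ _ _ _ Hx (gF _ _ _ Hy)) 1?eq_sym //.
    have gx : wtsp br b (- Aroot) (- k) x by apply/wtsp_mirror; rewrite opprK; apply: gE Hx.
    rewrite (suF _ _ _ _ _ Hy gx) ?rmorph0 //.
    by apply: contraNneq nk => <-; rewrite opprK.
  have linx := Glin _ _ (ex_intro _ k (or_introl Hx)).
  have liny := Glin _ _ (ex_intro _ l (or_intror Hy)).
  have xi0 : xi 0 = 0 by have := linx (-1) 0 0; rewrite scaler0 addr0 mulN1r addNr.
  have eta0 : eta 0 = 0 by have := liny (-1) 0 0; rewrite scaler0 addr0 mulN1r addNr.
  have [[-> Z]|pk] := posE _ _ _ Hx; first by rewrite Z eta0 rmorph0.
  have [[-> Z]|pl] := posF _ _ _ Hy; first by rewrite Z xi0 rmorph0.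
  have [k0 l0] : k = 0 /\ l = 0.
    case: pl => [l0|kl]; first by split=> //; rewrite E l0 oppr0.
    case: pk => [k0|kk]; first by split=> //; apply: oppr_inj; rewrite -E k0 oppr0.
    by have := kposN kl; rewrite -E kk.
  have [d [-> Hd]] := hf_weight0 ac KM h0_herm h0_lin Hx k0; have [d' [-> Hd']] := hf_weight0 ac KM' h0_herm h0_lin Hy l0.
  by rewrite Hd Hd' !coord_hv.
have Gsym x y xi eta : G x xi -> G y eta -> xi y = (eta x)^*.
  case=> k [Hx|Hx] [l [Hy|Hy]].
  - have [E|nk] := eqVneq k l; first by rewrite E in Hx; apply: symE Hx Hy.
    rewrite (suE _ _ _ _ _ Hx (gE _ _ _ Hy)) 1?eq_sym //.
    by rewrite (suE _ _ _ _ _ Hy (gE _ _ _ Hx)) ?rmorph0.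
  - exact: symEF Hx Hy.
  - by rewrite -[LHS]conjCK -(symEF _ _ _ _ _ _ Hy Hx).
  - have [E|nk] := eqVneq k l; first by rewrite E in Hx; apply: symF Hx Hy.
    have gx := hf_g ac KM' Hx; have gy := hf_g ac KM' Hy.
    rewrite (suF _ _ _ _ _ Hx gy) 1?eq_sym //.
    by rewrite (suF _ _ _ _ _ Hy gx) ?rmorph0.
have Gwt k x : g k x -> exists xi, G x xi.
  move=> gx; have [hk|hk] := leP 0 (ht k).
    by have [xi Hx] := hf_exists ac KM gcm coord h0 gx hk; exists xi, k; left.
  have gx' : wtsp br b (- Aroot) (- k) x by apply/wtsp_mirror; rewrite opprK.
  have hk' : 0 <= ht (- k) by rewrite htN; lia.
  by have [xi Hx] := hf_exists ac KM' gcm coord h0 gx' hk'; exists xi, (- k); right.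
have Gex x : exists xi, lin_closure G x xi.
  have [s _ ->] := proj_sum (KM_total ac KM) x.
  elim: s => [|k s [xi IH]].
    have [xi Hxi] := Gwt 0 0 (sub0 (wtsp_sub _ _ Hbr _)).
    by exists xi; rewrite big_nil; apply: lc_in.
  have [eta Heta] := Gwt _ _ (proj_wt (KM_total ac KM) k x).
  have := lc_lin 1 (lc_in Heta) IH; rewrite scale1r big_cons => H.
  by eexists; apply: H.
have [H [Hh Hl HG]] := lin_closure_form Glin Gsym Gex.
have H0 x : H x 0 = 0 by have := Hl x (-1) 0 0; rewrite scaler0 addr0 mulN1r addNr.
have Hwt k l x y : g k x -> g l y -> k != l -> H x y = 0.
  move=> gx gy nk; have [hk|hk] := leP 0 (ht k).
    have [xi Hx] := hf_exists ac KM gcm coord h0 gx hk.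
    rewrite (HG x xi); last by exists k; left.
    by rewrite (suE _ _ _ _ _ Hx gy) 1?eq_sym.
  have gx' : wtsp br b (- Aroot) (- k) x by apply/wtsp_mirror; rewrite opprK.
  have gy' : wtsp br b (- Aroot) (- l) y by apply/wtsp_mirror; rewrite opprK.
  have hk' : 0 <= ht (- k) by rewrite htN; lia.
  have [xi Hx] := hf_exists ac KM' gcm coord h0 gx' hk'.
  rewrite (HG x xi); last by exists (- k); right.
  by rewrite (suF _ _ _ _ _ Hx gy') //; apply: contraNneq nk => /oppr_inj->.
have invE k j x y : g k x -> 0 <= ht k -> H (br (e j) x) y = H x (br (f j) y).
  move=> gx hk; have [xi Hx] := hf_exists ac KM gcm coord h0 gx hk.
  rewrite (HG x xi); last by exists k; left.
  by rewrite (HG _ _ (ex_intro _ _ (or_introl (hf_ad j Hx)))).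
have invF k j x y : g k x -> ht k <= 0 -> H (br (f j) x) y = H x (br (e j) y).
  move=> gx hk.
  have gx' : wtsp br b (- Aroot) (- k) x by apply/wtsp_mirror; rewrite opprK.
  have hk' : 0 <= ht (- k) by rewrite htN; lia.
  have [xi Hx] := hf_exists ac KM' gcm coord h0 gx' hk'.
  rewrite (HG x xi); last by exists (- k); right.
  by rewrite (HG _ _ (ex_intro _ _ (or_intror (hf_ad j Hx)))).
(* If neither construction applies, then ht k < 0 < ht l, and both sides vanish because the two
   arguments of the form have different weights. *)
have inv k l j x y : g k x -> g l y -> H (br (e j) x) y = H x (br (f j) y).
  move=> gx gy; have [hk|hk] := leP 0 (ht k); first exact: invE gx hk.
  have [hl|hl] := leP (ht l) 0.
    by rewrite [LHS]Hh -(invF _ _ _ _ gy hl) -Hh.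
  rewrite (Hwt (dl j + k) l) ?(Hwt k (- dl j + l)) //.
  - exact: (wtsp_br Hbr (KM_gf KM j) gy).
  - by apply/eqP => /(congr1 (@ht n)); rewrite htD htN ht_delta; lia.
  - exact: (wtsp_br Hbr (KM_ge KM j) gx).
  - by apply/eqP => /(congr1 (@ht n)); rewrite htD ht_delta; lia.
exists H; split=> //.
- move=> j x y.
  have [s _ ->] := proj_sum (KM_total ac KM) x; have [t _ ->] := proj_sum (KM_total ac KM) y.
  have Hr u : {morph H u : v w / v + w} by move=> v w; have := Hl u 1 v w; rewrite scale1r mul1r.
  have Hll v : {morph H^~ v : u w / u + w}.
    by move=> u w /=; rewrite Hh Hr rmorphD /= -!Hh.
  have H0l v : H 0 v = 0 by rewrite Hh H0 rmorph0.
  rewrite (lie_sumr Hbr) (big_morph (H^~ _) (Hll _) (H0l _)) [RHS](big_morph (H^~ _) (Hll _) (H0l _)).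
  apply: eq_bigr => k _; rewrite (lie_sumr Hbr) !(big_morph (H _) (Hr _) (H0 _)).
  by apply: eq_bigr => l _; apply: inv (proj_wt _ _ _) (proj_wt _ _ _).
- move=> i d; rewrite (HG _ _ (ex_intro _ 0 (or_introl (hf_cartan _ _ _ _ _ _ _)))).
  by rewrite coord_hv h0_cor.
Qed.
End FullForm.

(** * Positivity *)

Section Sesquilinear.
Variables (K : numClosedFieldType) (V : lmodType K) (H : V -> V -> K).
Hypothesis Hh : forall x y, H x y = (H y x)^*.
Hypothesis Hl : forall x a u v, H x (a *: u + v) = a * H x u + H x v.

Lemma sform0r x : H x 0 = 0.
Proof. by have := Hl x (-1) 0 0; rewrite scaler0 addr0 mulN1r addNr. Qed.
Lemma sformDr x u v : H x (u + v) = H x u + H x v.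
Proof. by have := Hl x 1 u v; rewrite scale1r mul1r. Qed.
Lemma sformZr x a u : H x (a *: u) = a * H x u.
Proof. by rewrite -[a *: u]addr0 Hl sform0r addr0. Qed.
Lemma sformNr x u : H x (- u) = - H x u.
Proof. by rewrite -scaleN1r sformZr mulN1r. Qed.
Lemma sformBr x u v : H x (u - v) = H x u - H x v.
Proof. by rewrite sformDr sformNr. Qed.
Lemma sform0l x : H 0 x = 0. Proof. by rewrite Hh sform0r rmorph0. Qed.
Lemma sformDl u v x : H (u + v) x = H u x + H v x.
Proof. by rewrite Hh sformDr rmorphD /= -!Hh. Qed.
Lemma sformZl a u x : H (a *: u) x = a^* * H u x.
Proof. by rewrite Hh sformZr rmorphM /= -Hh. Qed.
Lemma sformNl u x : H (- u) x = - H u x.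
Proof. by rewrite -scaleN1r sformZl rmorphN1 mulN1r. Qed.
Lemma sformBl u v x : H (u - v) x = H u x - H v x.
Proof. by rewrite sformDl sformNl. Qed.
Lemma sform_sumr (I : Type) (r : seq I) (F : I -> V) x :
  H x (\sum_(i <- r) F i) = \sum_(i <- r) H x (F i).
Proof. by rewrite (big_morph (H x) (sformDr x) (sform0r x)). Qed.
Lemma sform_suml (I : Type) (r : seq I) (F : I -> V) x :
  H (\sum_(i <- r) F i) x = \sum_(i <- r) H (F i) x.
Proof. by rewrite (big_morph (H^~ x) (fun u v => sformDl u v x) (sform0l x)). Qed.

Lemma psd_isotropic (S : V -> Prop) x y : subspace S -> (forall z, S z -> 0 <= H z z) ->
  S x -> S y -> H x x = 0 -> H x y = 0.
Proof.
move=> SS pos Sx Sy xx; apply/eqP; apply: contraT => nh.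
have N0 : 0 < H x y * (H x y)^* by rewrite -normCK exprn_gt0 // normr_gt0.
(* This [s] gives y - s H(x,y) x the norm H(y,y) - 2(H(y,y) + 1), which is negative. *)
have yy := pos _ Sy; set s := (H y y + 1) / (H x y * (H x y)^*).
have s0 : s^* = s.
  apply/conj_Creal/rpredM; last by rewrite rpredV ger0_real // ltW.
  by rewrite rpredD ?rpred1 // ger0_real.
have := pos _ (proj2 SS (- (s * H x y)) x y Sx Sy).
rewrite sformDr sformZr !sformDl !sformZl xx mulr0 add0r rmorphN rmorphM /= s0.
rewrite [H y x]Hh.
have -> : - (s * H x y) * (H x y)^* + (- (s * (H x y)^* ) * H x y + H y y)
  = H y y - 2 * (s * (H x y * (H x y)^* )) by ring.
rewrite /s divfK ?gt_eqF // => C; exfalso.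
have : H y y - 2 * (H y y + 1) < 0.
  have -> : H y y - 2 * (H y y + 1) = - (H y y + 2) by ring.
  by rewrite oppr_lt0 ltr_wpDl.
by move/lt_geF; rewrite C.
Qed.

(* Schur product: the Gram form of [sum_t a_t (x) b_t], evaluated by
   orthogonalising the [a_t]. *)
Lemma schur_ge0 (I : Type) (S T : I -> V -> Prop) (s : seq (I * V * V)) :
  (forall i, subspace (S i)) -> (forall i, subspace (T i)) ->
  (forall i j x y, S i x -> S j y -> H x y <> 0 -> S i = S j /\ T i = T j) ->
  List.Forall (fun t => [/\ S t.1.1 t.1.2, T t.1.1 t.2,
     forall z, S t.1.1 z -> z <> 0 -> 0 < H z z & forall z, T t.1.1 z -> 0 <= H z z]) s ->
  0 <= \sum_(p <- s) \sum_(q <- s) H q.1.2 p.1.2 * H q.2 p.2.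
Proof.
move=> SS TS ortho.
have [N HN] := ubnP (size s); elim: N s HN => [//|N IH] [|t s] HN; first by rewrite big_nil.
move=> Hs; move: (List.Forall_inv Hs) (List.Forall_inv_tail Hs) => {Hs}.
case: t HN => [[i a0] b0] HN /= [Sa Tb pos psd] Hs.
have [a00|na0] := pselect (a0 = 0).
  rewrite big_cons big_cons /= a00 sform0l mul0r add0r.
  rewrite [X in X + _]big1 => [|q _]; last by rewrite sform0r mul0r.
  rewrite add0r; under eq_bigr => p _ do rewrite big_cons /= sform0l mul0r add0r.
  exact: IH.
have M0 := pos _ Sa na0; set M := H a0 a0 in M0.
have nM : M != 0 by rewrite gt_eqF.
have MR : M^* = M by apply/conj_Creal; rewrite ger0_real // ltW.
pose c (t : I * V * V) := H a0 t.1.2 / M.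
(* The tensor is rewritten as a_0 (x) b' plus the terms of [s'], whose first factors are orthogonal
   to a_0; the Gram form then splits into two sums. *)
pose b' := b0 + \sum_(t <- s) c t *: t.2.
pose s' := [seq (t.1.1, t.1.2 - c t *: a0, t.2) | t <- s].
have cM t : H a0 t.1.2 = c t * M by rewrite /c divfK.
have cM' t : H t.1.2 a0 = (c t)^* * M by rewrite Hh cM rmorphM /= MR.
have same t : S t.1.1 t.1.2 -> c t <> 0 -> S i = S t.1.1 /\ T i = T t.1.1.
  move=> St nc; apply: (ortho _ _ a0 t.1.2) => // E; apply: nc.
  by rewrite /c E mul0r.
have Tb' : T i b'.
  rewrite /b'; apply: (subD (TS i)) => //.
  elim: s Hs {HN b' s'} => [|t s IHs] Hs; first by rewrite big_nil; apply: (sub0 (TS i)).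
  rewrite big_cons; apply: (subD (TS i)); last exact: (IHs (List.Forall_inv_tail Hs)).
  have [St Tt _ _] := List.Forall_inv Hs.
  have [->|nc] := pselect (c t = 0); first by rewrite scale0r; apply: (sub0 (TS i)).
  by apply: (subZ _ (TS i)); have [_ ->] := same _ St nc.
have Hs' : List.Forall (fun t => [/\ S t.1.1 t.1.2, T t.1.1 t.2,
     forall z, S t.1.1 z -> z <> 0 -> 0 < H z z & forall z, T t.1.1 z -> 0 <= H z z]) s'.
  rewrite /s'; elim: s Hs {HN b' s' Tb'} => [|t s IHs] Hs /=; first exact: List.Forall_nil.
  apply: List.Forall_cons; last exact: (IHs (List.Forall_inv_tail Hs)).
  have [St Tt p1 p2] := List.Forall_inv Hs; split=> //=.
  have [->|nc] := pselect (c t = 0); first by rewrite scale0r subr0.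
  apply: (subB (SS _)) => //; apply: (subZ _ (SS _)).
  by have [<- _] := same _ St nc.
have -> : \sum_(p <- (i, a0, b0) :: s) \sum_(q <- (i, a0, b0) :: s) H q.1.2 p.1.2 * H q.2 p.2
    = M * H b' b' + \sum_(p <- s') \sum_(q <- s') H q.1.2 p.1.2 * H q.2 p.2.
  have Ebb : H b' b' = H b0 b0 + \sum_(t <- s) H (c t *: t.2) b0 +
      (\sum_(t <- s) H b0 (c t *: t.2) + \sum_(p <- s) \sum_(q <- s) c p * ((c q)^* * H q.2 p.2)).
    rewrite /b' sformDr !sformDl sform_suml !sform_sumr; congr (_ + (_ + _)).
    apply: eq_bigr => p _; rewrite sform_suml; apply: eq_bigr => q _.
    by rewrite sformZr sformZl.
  have ED : \sum_(p <- s) \sum_(q <- s) H q.1.2 p.1.2 * H q.2 p.2 =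
      M * (\sum_(p <- s) \sum_(q <- s) c p * ((c q)^* * H q.2 p.2)) +
      \sum_(p <- s') \sum_(q <- s') H q.1.2 p.1.2 * H q.2 p.2.
    rewrite mulr_sumr [X in _ = _ + X]big_map -big_split; apply: eq_bigr => p _.
    rewrite mulr_sumr big_map -big_split; apply: eq_bigr => q _ /=.
    rewrite sformBr !sformBl !sformZr !sformZl cM cM' -/M; ring.
  have EA : \sum_(q <- s) H q.1.2 a0 * H q.2 b0 = M * \sum_(t <- s) H (c t *: t.2) b0.
    by rewrite mulr_sumr; apply: eq_bigr => q _; rewrite cM' sformZl; ring.
  have EB : \sum_(p <- s) H a0 p.1.2 * H b0 p.2 = M * \sum_(t <- s) H b0 (c t *: t.2).
    by rewrite mulr_sumr; apply: eq_bigr => q _; rewrite cM sformZr; ring.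
  rewrite big_cons big_cons /= -/M; under [X in _ + X]eq_bigr => p _ do rewrite big_cons /=.
  rewrite big_split /= EA EB ED Ebb; ring.
apply: addr_ge0; first by rewrite mulr_ge0 ?(ltW M0) ?psd.
by apply: IH; rewrite // size_map.
Qed.
End Sesquilinear.

Section Positivity.
Variables (K : numClosedFieldType) (n m : nat) (A : 'M[int]_n).
Variables (V : lmodType K) (br : V -> V -> V) (b : 'I_m -> V).
Variables (Aroot Acor : 'M[K]_(n, m)) (e f : 'I_n -> V).
Hypothesis ac : forall x y, br x y = - br y x.
Hypothesis KM : KacMoody_model A br b Aroot Acor e f.
Hypothesis gcm : is_GCM A.
Variable c : 'I_n -> nat.
Hypothesis csym : forall i j, (c i)%:Z * A i j = (c j)%:Z * A j i.
Hypothesis cpos : forall i, (0 < c i)%N.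
Local Notation wt := 'rV[int]_n.
Local Notation g := (wtsp br b Aroot).
Local Notation dl i := (delta_mx 0 i : 'rV[int]_n).
Implicit Types (k l : wt) (x y : V).
Local Notation Hbr := (KM_lie ac KM).
Local Notation bf := (bf A c).
Local Notation rho2 := (rho2 A c).

Variable H : V -> V -> K.
Hypothesis Hh : forall x y, H x y = (H y x)^*.
Hypothesis Hl : forall x a u v, H x (a *: u + v) = a * H x u + H x v.
Hypothesis Hwt : forall k l x y, g k x -> g l y -> k != l -> H x y = 0.
Hypothesis Hinv : forall j x y, H (br (e j) x) y = H x (br (f j) y).
Hypothesis He : forall i, H (e i) (e i) = (c i)%:R^-1.

Let gS k := wtsp_sub b Aroot Hbr k.

(* A decomposition [sum_t a_t (x) b_t] of the cobracket of [x]: it is adjoint to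
   the bracket, and the bracket maps it to the Casimir multiple
   [2 (rho | k) - (k | k)] of [x]. *)
Definition cobracket k x (s : seq (wt * V * V)) :=
  [/\ List.Forall (fun t => [/\ kpos t.1.1, kpos (k - t.1.1), g t.1.1 t.1.2 & g (k - t.1.1) t.2]) s,
      forall l1 l2 u v, kpos l1 -> kpos l2 -> l1 + l2 = k -> g l1 u -> g l2 v ->
        H x (br u v) = \sum_(t <- s) H t.1.2 u * H t.2 v &
      \sum_(t <- s) br t.1.2 t.2 = (rho2 k - bf k k)%:~R *: x].

(** The cobracket of [e_j, y] is [e j] acting on that of [y], plus a correction with coefficient z =
    (alpha_j|k). The bracket of the correction is -2z [e_j, y], exactly the change of the Casimir
    scalar from k to alpha_j + k. *)
Lemma cobracket_ad j k y s : kpos k -> g k y -> cobracket k y s ->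
  exists s', cobracket (dl j + k) (br (e j) y) s'.
Proof.
move=> kk gy [sg adj cas].
have cK : (c j)%:R != 0 :> K by rewrite pnatr_eq0 -lt0n.
pose z : K := (bf (dl j) k)%:~R.
have zR : z^* = z by rewrite /z rmorph_int.
have zE : z = (c j)%:R * (cart A k j)%:~R by rewrite /z bf_delta rmorphM /= -pmulrn.
exists ([seq (dl j + t.1.1, br (e j) t.1.2, t.2) | t <- s]
  ++ [seq (t.1.1, t.1.2, br (e j) t.2) | t <- s]
  ++ [:: (dl j, - z *: e j, y); (k, z *: y, e j)]); split.
- have kd := kpos_delta j; have ge := KM_ge KM j.
  apply/List.Forall_app; split; last (apply/List.Forall_app; split).
  + elim: s sg {adj cas} => [|t s IH] sg /=; first exact: List.Forall_nil.
    apply: List.Forall_cons; last exact: (IH (List.Forall_inv_tail sg)).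
    have [p1 p2 g1 g2] := List.Forall_inv sg; rewrite /= opprD addrACA subrr add0r.
    by split=> //; [apply: kposD | apply: (wtsp_br Hbr)].
  + elim: s sg {adj cas} => [|t s IH] sg /=; first exact: List.Forall_nil.
    apply: List.Forall_cons; last exact: (IH (List.Forall_inv_tail sg)).
    have [p1 p2 g1 g2] := List.Forall_inv sg; rewrite /= -addrA.
    by split=> //; [apply: kposD | apply: (wtsp_br Hbr)].
  + have E1 : dl j + k - dl j = k by rewrite addrC addKr.
    have E2 : dl j + k - k = dl j by rewrite addrK.
    apply: List.Forall_cons; first by rewrite /= E1; split=> //; apply: (subZ _ (gS _)).
    apply: List.Forall_cons; last exact: List.Forall_nil.
    by rewrite /= E2; split=> //; apply: (subZ _ (gS _)).
- move=> l1 l2 u v p1 p2 El gu gv.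
  have sh l l' : l + l' = dl j + k -> - dl j + l + l' = k.
    by move=> E; rewrite -addrA E addKr.
  have lower l w : kpos l -> g l w -> l != dl j ->
      br (f j) w = 0 \/ kpos (- dl j + l).
    move=> kl gw nl; have [->|nz] := eqVneq (br (f j) w) 0; first by left.
    right; have gfw := wtsp_br Hbr (KM_gf KM j) gw.
    have nz' : - dl j + l != 0.
      by apply: contraNneq nl => E; rewrite -[l](addKr (dl j)) addrCA E addr0.
    have [//|/kpos_ht] := g_sign ac KM gfw nz nz'.
    by rewrite htN htD htN ht_delta; have := kpos_ht kl; lia.
  have fe w : exists a, g (dl j) w -> w = a *: e j /\ br (f j) w = - (a *: hv b (row j Acor)).
    have [gw|?] := pselect (g (dl j) w); last by exists 0.
    have [a ->] := g_delta ac KM gw; exists a => _; split=> //.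
    by rewrite (lieZr Hbr) (br_fe ac KM) eqxx scale1r scalerN.
  have U : H y (br (br (f j) u) v) = \sum_(t <- s) H (br (e j) t.1.2) u * H t.2 v
      - z * (H (e j) u * H y v).
    have [E|nl] := eqVneq l1 (dl j).
      have El2 : l2 = k by apply: (addrI (dl j)); rewrite -El E.
      have [a] := fe u; rewrite -E => /(_ gu) [-> ->].
      rewrite (lieNl Hbr) (lieZl Hbr) (cor_br ac KM j gv) El2.
      have -> : \sum_(t <- s) H (br (e j) t.1.2) (a *: e j) * H t.2 v = 0.
        elim: s sg {adj cas} => [|t s IH] sg; first by rewrite big_nil.
        have [q1 q2 g1 g2] := List.Forall_inv sg.
        rewrite big_cons (IH (List.Forall_inv_tail sg)) addr0 (sformZr Hl).
        rewrite (Hwt (wtsp_br Hbr (KM_ge KM j) g1) (KM_ge KM j)) ?mulr0 ?mul0r //.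
        by apply: contraTneq q1 => /(congr1 (+%R (- dl j))); rewrite addKr addNr => ->; rewrite /kpos eqxx andbF.
      rewrite (sformNr Hl) !(sformZr Hl) He zE sub0r; congr (- _).
      by rewrite (mulrA _ _ (H y v)) (mulrC a) -!mulrA (mulrCA _ a) !mulrA; field.
    rewrite (Hwt (KM_ge KM j) gu) 1?eq_sym // mul0r mulr0 subr0.
    under eq_bigr => t _ do rewrite Hinv.
    have [->|kl] := lower _ _ p1 gu nl.
      rewrite (lie0l Hbr) (sform0r Hl) big1 // => t _; by rewrite (sform0r Hl) mul0r.
    apply: (adj (- dl j + l1) l2) => //; first exact: sh.
    exact: (wtsp_br Hbr (KM_gf KM j) gu).
  have W : H y (br u (br (f j) v)) = \sum_(t <- s) H t.1.2 u * H (br (e j) t.2) v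
      + z * (H y u * H (e j) v).
    have [E|nl] := eqVneq l2 (dl j).
      have El2 : l1 = k by apply: (addIr (dl j)); rewrite -{1}E El addrC.
      have [a] := fe v; rewrite -E => /(_ gv) [-> ->].
      rewrite (lieNr Hbr) (lieZr Hbr) [br u _]ac (cor_br ac KM j gu) El2.
      have -> : \sum_(t <- s) H t.1.2 u * H (br (e j) t.2) (a *: e j) = 0.
        elim: s sg {adj cas U} => [|t s IH] sg; first by rewrite big_nil.
        have [q1 q2 g1 g2] := List.Forall_inv sg.
        rewrite big_cons (IH (List.Forall_inv_tail sg)) addr0 (sformZr Hl).
        rewrite (Hwt (wtsp_br Hbr (KM_ge KM j) g2) (KM_ge KM j)) ?mulr0 //.
        by apply: contraTneq q2 => /(congr1 (+%R (- dl j))); rewrite addKr addNr => ->; rewrite /kpos eqxx andbF.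
      rewrite scalerN opprK !(sformZr Hl) He zE add0r.
      by field.
    rewrite (Hwt (KM_ge KM j) gv) 1?eq_sym // !mulr0 addr0.
    under eq_bigr => t _ do rewrite Hinv.
    have [->|kl] := lower _ _ p2 gv nl.
      rewrite (lie0r Hbr) (sform0r Hl) big1 // => t _; by rewrite (sform0r Hl) mulr0.
    apply: (adj l1 (- dl j + l2)) => //; last exact: (wtsp_br Hbr (KM_gf KM j) gv).
    by rewrite addrCA addrA; apply: sh.
  rewrite Hinv (lieJ Hbr) (sformDr Hl) U W !big_cat !big_map !big_cons big_nil /=.
  by rewrite (sformZl Hh Hl) (sformZl Hh Hl) rmorphN /= zR; ring.
- rewrite !big_cat !big_map !big_cons big_nil /= addr0.
  have -> : \sum_(t <- s) br (br (e j) t.1.2) t.2 + (\sum_(t <- s) br t.1.2 (br (e j) t.2)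
     + (br (- z *: e j) y + br (z *: y) (e j))) =
     br (e j) (\sum_(t <- s) br t.1.2 t.2) - (2 * z) *: br (e j) y.
    rewrite (lie_sumr Hbr) addrA -big_split /=; congr (_ + _).
      by apply: eq_bigr => t _; rewrite [RHS](lieJ Hbr).
    rewrite !(lieZl Hbr) [br y _]ac scalerN scaleNr -opprD -scalerDl.
    by congr (- (_ *: _)); ring.
  rewrite cas (lieZr Hbr) -scalerBl; congr (_ *: _).
  rewrite /z rho2D rho2_delta bfDl !(bfDr csym) (bfC csym k (dl j)).
  have -> : (2 : K) = (2 : int)%:~R by [].
  by rewrite -rmorphM -rmorphB /=; congr (_%:~R); ring.
Qed.

Lemma cobracket_exists k x : kpos k -> g k x -> exists s, cobracket k x s.
Proof.
move=> kk gx; have W := gpos_words ac KM kk gx; move: kk {gx}; elim: W => {k x} [k|i|k a x y Wx Hx Wy Hy|k j y Wy Hy] kk.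
- exists [::]; split; first exact: List.Forall_nil.
    by move=> l1 l2 u v *; rewrite big_nil (sform0l Hh Hl).
  by rewrite big_nil scaler0.
- exists [::]; split; first exact: List.Forall_nil.
    move=> l1 l2 u v /kpos_ht h1 /kpos_ht h2 /(congr1 (@ht n)); rewrite htD ht_delta; lia.
  by rewrite big_nil rho2_delta subrr scale0r.
- have [s [s1 s2 s3]] := Hx kk; have [t [t1 t2 t3]] := Hy kk.
  exists ([seq (p.1.1, a *: p.1.2, p.2) | p <- s] ++ t); split.
  + apply/List.Forall_app; split=> //.
    elim: s s1 {s2 s3} => [|p s IH] sg /=; first exact: List.Forall_nil.
    apply: List.Forall_cons; last exact: (IH (List.Forall_inv_tail sg)).
    have [p1 p2 g1 g2] := List.Forall_inv sg; split=> //=.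
    exact: (subZ _ (gS _)).
  + move=> l1 l2 u v p1 p2 El gu gv; rewrite big_cat big_map /= (sformDl Hh Hl) (sformZl Hh Hl).
    rewrite (s2 _ _ _ _ p1 p2 El gu gv) (t2 _ _ _ _ p1 p2 El gu gv) mulr_sumr; congr (_ + _).
    by apply: eq_bigr => p _; rewrite (sformZl Hh Hl) mulrA.
  + rewrite big_cat big_map /= t3 scalerDr; congr (_ + _).
    rewrite scalerA mulrC -scalerA -s3 scaler_sumr; apply: eq_bigr => p _.
    by rewrite (lieZl Hbr).
- have [->|ky] := words_kpos (lie0r Hbr) Wy.
    exists [::]; split; first exact: List.Forall_nil.
      by move=> l1 l2 u v *; rewrite big_nil (lie0r Hbr) (sform0l Hh Hl).
    by rewrite big_nil (lie0r Hbr) scaler0.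
  by have [s Hs] := Hy ky; apply: cobracket_ad Hs => //; apply: (words_g ac KM).
Qed.

(** The Casimir scalar times H(z,z) is the Gram sum of the cobracket, nonnegative by induction and
    [schur_ge0], and the scalar is positive by [pos_root_bounds]. A null vector [x] is orthogonal to
    its weight space, so each [f j] x has norm zero and vanishes by induction, whence x = 0 by
    [fkill_zero]. *)
Lemma form_pos k x : kpos k -> g k x -> x != 0 -> 0 < H x x.
Proof.
have [N] := ubnP `|ht k|%N; elim: N k x => [//|N IH] k x HN kk gx nx.
have hk := kpos_ht kk.
have [[i Ei]|ns] := pselect (exists i, k = dl i).
  rewrite Ei in gx; have [a Ea] := g_delta ac KM gx; move: nx; rewrite Ea scaler_eq0.
  case/norP => na _; rewrite (sformZl Hh Hl) (sformZr Hl) He mulrA mulr_gt0 //.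
    by rewrite mulrC -normCK exprn_gt0 // normr_gt0.
  by rewrite invr_gt0 ltr0n.
have psd z : g k z -> 0 <= H z z.
  move=> gz; have [->|nz] := eqVneq z 0; first by rewrite (sform0r Hl).
  have [s [s1 s2 s3]] := cobracket_exists kk gz.
  have HM i : bf (dl i) (dl i) <= \sum_j bf (dl j) (dl j).
    rewrite (bigD1 i) //= lerDl; apply: sumr_ge0 => j _.
    by rewrite (bf_dd gcm) mulr_ge0.
  have [[//|ineq] _] := pos_root_bounds ac KM gcm csym cpos HM kk gz nz.
  have p0 : 0 < (rho2 k - bf k k)%:~R :> K by rewrite ltr0z subr_gt0.
  rewrite -(pmulr_rge0 _ p0) -(sformZr Hl) -s3 (sform_sumr Hl).
  have -> : \sum_(t <- s) H z (br t.1.2 t.2) =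
      \sum_(p <- s) \sum_(q <- s) H q.1.2 p.1.2 * H q.2 p.2.
    have : List.Forall (fun p : wt * V * V => H z (br p.1.2 p.2) =
        \sum_(q <- s) H q.1.2 p.1.2 * H q.2 p.2) s.
      apply: List.Forall_impl s1 => p [p1 p2 g1 g2].
      by apply: (s2 p.1.1 (k - p.1.1)) => //; rewrite addrC subrK.
    move: {2 3 4}s => r; elim: r => [|p r IHr] Hr; first by rewrite !big_nil.
    by rewrite !big_cons (List.Forall_inv Hr) (IHr (List.Forall_inv_tail Hr)).
  apply: (@schur_ge0 K V H Hh Hl wt (fun w => g w) (fun w => g (k - w))) => //.
  + move=> i j u v gu gv nH; suff -> : i = j by [].
    by apply/eqP; apply: contraT => nij; case: nH; apply: Hwt gu gv nij.
  apply: List.Forall_impl s1 => p [p1 p2 g1 g2].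
  split=> /=; [exact: g1 | exact: g2 | move=> v gv /eqP nv | move=> v gv].
    apply: (IH p.1.1) => //; have := kpos_ht p1; have := kpos_ht p2; rewrite htB; lia.
  have [->|nv] := eqVneq v 0; first by rewrite (sform0r Hl).
  apply/ltW/(IH (k - p.1.1)) => //; have := kpos_ht p1; have := kpos_ht p2; rewrite htB; lia.
rewrite lt_def psd // andbT; apply: contraNneq nx => xx; apply/eqP.
apply: (fkill_zero ac KM kk gx) => j; apply/eqP; apply: contraT => nf.
have gf := wtsp_br Hbr (KM_gf KM j) gx.
have nz : - dl j + k != 0.
  by apply/eqP => E; apply: ns; exists j; rewrite -[k](addKr (dl j)) addrCA E addr0.
have kf : kpos (- dl j + k).
  by have [//|/kpos_ht] := g_sign ac KM gf nf nz; rewrite htN htD htN ht_delta; lia.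
have : 0 < H (br (f j) x) (br (f j) x).
  by apply: (IH (- dl j + k)) => //; have := kpos_ht kf; rewrite htD htN ht_delta; lia.
rewrite -Hinv Hh (psd_isotropic Hh Hl (gS k) psd) ?rmorph0 ?ltxx //.
by have := wtsp_br Hbr (KM_ge KM j) gf; rewrite addrA addrN add0r.
Qed.
End Positivity.

(** * Unitary form: positivity, adjoints and action of the coroots *)

Definition adjoint (K : numClosedFieldType) (V : lmodType K) (br : V -> V -> V)
  (H : V -> V -> K) (x x' : V) : Prop := forall u v, H (br x u) v = H u (br x' v).

(** All that the study of solvable subalgebras takes from the construction of the form. Positivity
    is claimed at nonzero weights only; [uf_act] says that [x, y] acts like H(x', y) times the
    Cartan element representing [k]. *)
Record unitary_form (K : numClosedFieldType) (n m : nat) (A : 'M[int]_n) (c : 'I_n -> nat)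
    (V : lmodType K) (br : V -> V -> V) (b : 'I_m -> V) (R : 'M[K]_(n, m))
    (H : V -> V -> K) (M : int) : Prop := UnitaryForm {
  uf_herm : forall x y, H x y = (H y x)^*;
  uf_lin : forall x a u v, H x (a *: u + v) = a * H x u + H x v;
  uf_pos : forall k x, k != 0 -> wtsp br b R k x -> x != 0 -> 0 < H x x;
  uf_adj : forall k x, k != 0 -> wtsp br b R k x ->
    exists2 x', wtsp br b R (- k) x' & adjoint br H x x';
  uf_act : forall k l x x' y z, wtsp br b R k x -> wtsp br b R (- k) x' ->
    adjoint br H x x' -> wtsp br b R (- k) y -> wtsp br b R l z ->
    br (br x y) z = ((bf A c k l)%:~R * H x' y) *: z;
  uf_adj_norm : forall k x x', k != 0 -> wtsp br b R k x -> wtsp br b R (- k) x' ->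
    adjoint br H x x' -> H x' x' = H x x;
  uf_bound : forall k x, k != 0 -> wtsp br b R k x -> x != 0 -> bf A c k k <= M
}.

Section Unitarity.
Variables (K : numClosedFieldType) (n m : nat) (A : 'M[int]_n).
Variables (V : lmodType K) (br : V -> V -> V) (b : 'I_m -> V).
Variables (Aroot Acor : 'M[K]_(n, m)) (e f : 'I_n -> V).
Hypothesis ac : forall x y, br x y = - br y x.
Hypothesis KM : KacMoody_model A br b Aroot Acor e f.
Hypothesis gcm : is_GCM A.
Variable c : 'I_n -> nat.
Hypothesis csym : forall i j, (c i)%:Z * A i j = (c j)%:Z * A j i.
Hypothesis cpos : forall i, (0 < c i)%N.
Local Notation wt := 'rV[int]_n.
Local Notation g := (wtsp br b Aroot).
Local Notation dl i := (delta_mx 0 i : 'rV[int]_n).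
Implicit Types (k l : wt) (x y : V).
Local Notation Hbr := (KM_lie ac KM).
Local Notation KM' := (KM_mirror ac KM).
Local Notation bf := (bf A c).

Variable H : V -> V -> K.
Hypothesis Hh : forall x y, H x y = (H y x)^*.
Hypothesis Hl : forall x a u v, H x (a *: u + v) = a * H x u + H x v.
Hypothesis Hwt : forall k l x y, g k x -> g l y -> k != l -> H x y = 0.
Hypothesis Hinv : forall j x y, H (br (e j) x) y = H x (br (f j) y).
Hypothesis Hcor : forall i d,
  H (hv b (row i Acor)) (hv b d) = (c i)%:R^-1 * evw Aroot (dl i) d.
Local Notation adj := (adjoint br H).

Lemma Hinv' j x y : H (br (f j) x) y = H x (br (e j) y).
Proof. by rewrite Hh -Hinv -Hh. Qed.
Lemma Hcor2 i : H (hv b (row i Acor)) (hv b (row i Acor)) = (c i)%:R^-1 * 2.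
Proof. by rewrite Hcor (evw_cor KM) (cart_ii gcm). Qed.
Lemma norm_e i : H (e i) (e i) = (c i)%:R^-1.
Proof.
have := Hinv i (hv b (row i Acor)) (e i).
rewrite ac (cor_br ac KM i (KM_ge KM i)) (cart_ii gcm) (br_fe ac KM) eqxx scale1r.
rewrite (sformNl Hh Hl) (sformZl Hh Hl) (sformNr Hl) Hcor2 rmorph_int => /oppr_inj.
by rewrite mulrC => /mulIf -> //; rewrite pnatr_eq0.
Qed.
Lemma norm_f i : H (f i) (f i) = (c i)%:R^-1.
Proof.
have := Hinv' i (hv b (row i Acor)) (f i).
rewrite ac (cor_br ac KM i (KM_gf KM i)) cartN (cart_ii gcm) (br_ef KM) eqxx scale1r.
rewrite (sformNl Hh Hl) (sformZl Hh Hl) Hcor2 rmorph_int rmorphN mulNr opprK.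
by rewrite mulrC => /mulIf -> //; rewrite pnatr_eq0.
Qed.

Lemma root_pos k x : k != 0 -> g k x -> x != 0 -> 0 < H x x.
Proof.
move=> nk gx nx; have [kk|kk] := g_sign ac KM gx nx nk.
  exact: (form_pos ac KM gcm csym cpos Hh Hl Hwt Hinv norm_e kk gx nx).
have gx' : wtsp br b (- Aroot) (- k) x by apply/wtsp_mirror; rewrite opprK.
have Hwt' k' l u v : wtsp br b (- Aroot) k' u -> wtsp br b (- Aroot) l v -> k' != l -> H u v = 0.
  move=> /wtsp_mirror gu /wtsp_mirror gv nkl; apply: Hwt gu gv _.
  by apply: contraNneq nkl => /oppr_inj ->.
exact: (form_pos ac KM' gcm csym cpos Hh Hl Hwt' Hinv' norm_f kk gx' nx).
Qed.

Lemma adj_lin a x x' y y' : adj x x' -> adj y y' -> adj (a *: x + y) (a^* *: x' + y').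
Proof.
move=> Hx Hy u v; rewrite (lieDl Hbr) (lieZl Hbr) (sformDl Hh Hl) (sformZl Hh Hl) Hx Hy.
by rewrite (lieDl Hbr) (lieZl Hbr) Hl.
Qed.
Lemma adj_br x x' y y' : adj x x' -> adj y y' -> adj (br x y) (br y' x').
Proof.
move=> Hx Hy u v; rewrite !(lieJl Hbr) (sformBl Hh Hl) (sformBr Hl).
by rewrite !(Hx, Hy).
Qed.
Lemma adj_sym x x' : adj x x' -> adj x' x.
Proof. by move=> Hx u v; rewrite Hh -Hx -Hh. Qed.

Lemma words_adj (e' f' : 'I_n -> V) k x : (forall i, adj (e' i) (f' i)) ->
  words br e' k x -> exists2 x', words br f' k x' & adj x x'.
Proof.
move=> ef; elim=> {k x} [k|i|k a x y _ [x' Hx Ax] _ [y' Hy Ay]|k j x _ [x' Hx Ax]].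
- exists 0; first exact: words0.
  by move=> u v; rewrite !(lie0l Hbr) (sform0l Hh Hl) (sform0r Hl).
- by exists (f' i) => //; apply: words_gen.
- by exists (a^* *: x' + y'); [apply: words_lin | apply: adj_lin].
- exists (br x' (f' j)); last exact: adj_br.
  rewrite ac -scaleN1r; apply: (subZ _ (words_subspace _ _ _)).
  exact: words_ad.
Qed.
Lemma adj_exists k x : k != 0 -> g k x -> exists2 x', g (- k) x' & adj x x'.
Proof.
move=> nk gx; have [->|nx] := eqVneq x 0.
  exists 0; first exact: (sub0 (wtsp_sub _ _ Hbr _)).
  by move=> u v; rewrite !(lie0l Hbr) (sform0l Hh Hl) (sform0r Hl).
have [kk|kk] := g_sign ac KM gx nx nk.
  have [x' Wx' Ax] := words_adj Hinv (gpos_words ac KM kk gx).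
  by exists x' => //; apply: (wordsf_g ac KM).
have gx' : wtsp br b (- Aroot) (- k) x by apply/wtsp_mirror; rewrite opprK.
have [x' Wx' Ax] := words_adj Hinv' (gpos_words ac KM' kk gx').
by exists x' => //; apply: (words_g ac KM).
Qed.

(* The element of the Cartan subalgebra representing the weight [l]. *)
Let hl l := \sum_i ((l 0 i * (c i)%:Z)%:~R : K) *: hv b (row i Acor).

Lemma hl_br l k x : g k x -> br (hl l) x = (bf l k)%:~R *: x.
Proof.
move=> gx; rewrite (lie_suml Hbr) (bf_sum A c) rmorph_sum scaler_suml; apply: eq_bigr => i _.
rewrite (lieZl Hbr) (cor_br ac KM i gx) scalerA -rmorphM /=; congr (_%:~R *: _).
by rewrite bf_delta mulrA.
Qed.
Lemma hl_form l t : hsp b t -> forall z, g l z -> br t z = H (hl l) t *: z.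
Proof.
move=> /hspP[d ->] z gz; rewrite (hv_br ac KM d gz); congr (_ *: _).
rewrite (sform_suml Hh Hl) /evw; under [RHS]eq_bigr => i _.
  rewrite (sformZl Hh Hl) rmorph_int Hcor; over.
have cK i : (c i)%:R != 0 :> K by rewrite pnatr_eq0 -lt0n.
rewrite /evw; under [RHS]eq_bigr => i _.
  rewrite rmorphM /= -pmulrn -mulrA mulVKf // mulr_sumr; over.
rewrite exchange_big /=; apply: eq_bigr => j _; rewrite mulr_sumr; apply: eq_bigr => i _.
by rewrite wtv_delta; ring.
Qed.
Lemma coroot_act k l x x' y z : g k x -> g (- k) x' -> adj x x' -> g (- k) y -> g l z ->
  br (br x y) z = ((bf k l)%:~R * H x' y) *: z.
Proof.
move=> gx gx' Ax gy gz.
have ht : hsp b (br x y).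
  by apply: (g0_hsp ac KM); have := wtsp_br Hbr gx gy; rewrite addrN.
rewrite (hl_form ht gz); congr (_ *: _).
rewrite Hh Ax ac (hl_br l gx') (bfNr csym) mulrNz scaleNr opprK (sformZr Hl) rmorphM rmorph_int /=.
by rewrite -Hh (bfC csym).
Qed.
(** Pairing [x, x'] with [b j] and moving either factor across the form gives the two norms, each
    times the eigenvalue of [b j] at [k], which is nonzero for some [j]. *)
Lemma adj_norm k x x' : k != 0 -> g k x -> g (- k) x' -> adj x x' -> H x' x' = H x x.
Proof.
move=> nk gx gx' Ax.
have [j nj] : exists j, wtv Aroot k j != 0.
  apply/not_existsP => Hall; case/negP: nk; apply/eqP/(wtv_inj (KM_rk KM)) => j.
  by rewrite wtv0; have /negP := Hall j; rewrite negbK => /eqP.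
apply: (mulfI nj).
have E1 : H (br x x') (b j) = wtv Aroot k j * H x' x'.
  by rewrite Ax ac gx' wtvN scaleNr opprK (sformZr Hl).
have E2 : H (br x x') (b j) = wtv Aroot k j * H x x.
  rewrite ac (sformNl Hh Hl) (adj_sym Ax) [br x (b j)]ac gx.
  by rewrite (sformNr Hl) (sformZr Hl) opprK.
by rewrite -E1 E2.
Qed.
End Unitarity.

Lemma unitary_form_exists (K : numClosedFieldType) (n m : nat) (A : 'M[int]_n)
    (V : lmodType K) (br : V -> V -> V) (b : 'I_m -> V)
    (Aroot Acor : 'M[K]_(n, m)) (e f : 'I_n -> V) (c : 'I_n -> nat) :
  (forall x y, br x y = - br y x) ->
  KacMoody_model A br b Aroot Acor e f -> is_GCM A ->
  (forall i j, (c i)%:Z * A i j = (c j)%:Z * A j i) -> (forall i, (0 < c i)%N) ->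
  exists H M, unitary_form A c br b Aroot H M.
Proof.
move=> ac KM gcm csym cpos.
have [H [Hh Hl Hwt Hinv Hcor]] := invariant_form ac KM gcm csym cpos.
set dl := fun i => (delta_mx 0 i : 'rV[int]_n).
(* The sum bounds each simple norm and is nonnegative, so it also bounds the roots of nonpositive
   norm. *)
exists H, (\sum_i bf A c (dl i) (dl i)).
have dpos i : 0 <= bf A c (dl i) (dl i) by rewrite (bf_dd gcm) mulr_ge0.
have HM i : bf A c (dl i) (dl i) <= \sum_j bf A c (dl j) (dl j).
  by rewrite (bigD1 i) //= lerDl; apply: sumr_ge0.
split=> //.
- exact: (root_pos ac KM gcm csym cpos Hh Hl Hwt Hinv Hcor).
- exact: (adj_exists ac KM Hh Hl Hinv).
- exact: (coroot_act ac KM csym cpos Hh Hl Hcor).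
- exact: (adj_norm ac KM Hh Hl).
move=> k x nk gx nx.
have pos_case k' y : kpos k' -> wtsp br b Aroot k' y -> y != 0 ->
    bf A c k' k' <= \sum_j bf A c (dl j) (dl j).
  move=> kk gy ny; have [_ [//|q0]] := pos_root_bounds ac KM gcm csym cpos HM kk gy ny.
  by apply: le_trans q0 _; apply: sumr_ge0.
have [kk|kk] := g_sign ac KM gx nx nk; first exact: (pos_case k x).
have [x' gx' Ax] := adj_exists ac KM Hh Hl Hinv nk gx.
have -> : bf A c k k = bf A c (- k) (- k) by rewrite bfNl (bfNr csym) opprK.
apply: (pos_case _ x') => //; apply: contraTneq (root_pos ac KM gcm csym cpos Hh Hl Hwt Hinv Hcor nk gx nx) => x0.
by rewrite -(adj_norm ac KM Hh Hl nk gx gx' Ax) x0 (sform0r Hl) ltxx.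
Qed.

(** * Weights of a graded solvable subalgebra *)

Section RootGeometry.
Variables (K : numClosedFieldType) (n m : nat) (A : 'M[int]_n).
Variables (V : lmodType K) (br : V -> V -> V) (b : 'I_m -> V).
Variables (Aroot Acor : 'M[K]_(n, m)) (e f : 'I_n -> V).
Hypothesis ac : forall x y, br x y = - br y x.
Hypothesis KM : KacMoody_model A br b Aroot Acor e f.
Variable c : 'I_n -> nat.
Hypothesis csym : forall i j, (c i)%:Z * A i j = (c j)%:Z * A j i.
Local Notation wt := 'rV[int]_n.
Local Notation g := (wtsp br b Aroot).
Implicit Types (k l : wt) (x y : V).
Local Notation Hbr := (KM_lie ac KM).
Local Notation bf := (bf A c).
Variables (H : V -> V -> K) (M : int).
Hypothesis U : unitary_form A c br b Aroot H M.
Local Notation adj := (adjoint br H).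
Let Hh := uf_herm U.
Let Hl := uf_lin U.

Lemma nneg k x : k != 0 -> g k x -> 0 <= H x x.
Proof.
move=> nk gx; have [->|nx] := eqVneq x 0; first by rewrite (sform0r Hl).
exact/ltW/(uf_pos U nk gx nx).
Qed.
Lemma norm_identity k l x x' y : k != 0 -> g k x -> g l y -> g (- k) x' -> adj x x' ->
  H (br x y) (br x y) = H (br x' y) (br x' y) - (bf k l)%:~R * H x x * H y y.
Proof.
move=> nk gx gy gx' Ax.
rewrite Ax (lieJ Hbr) (sformDr Hl) [br x' x]ac (lieNl Hbr).
rewrite (uf_act U gx gx' Ax gx' gy) (sformNr Hl) (sformZr Hl) (uf_adj_norm U nk gx gx' Ax).
by rewrite addrC [in RHS](adj_sym Hh Ax).
Qed.
Lemma adj_neq0 k x x' : k != 0 -> g k x -> g (- k) x' -> adj x x' -> x != 0 -> x' != 0.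
Proof.
move=> nk gx gx' Ax nx; apply: contraTneq (uf_pos U nk gx nx) => x0.
by rewrite -(uf_adj_norm U nk gx gx' Ax) x0 (sform0r Hl) ltxx.
Qed.

(** If [x, y] = 0, the norm identity makes the norm of [x', y] negative; [k != l] keeps the weight
    of [x', y] nonzero, where the form is positive. *)
Lemma bracket_neq0 k l x y : k != 0 -> l != 0 -> k != l -> g k x -> g l y ->
  x != 0 -> y != 0 -> bf k l < 0 -> br x y != 0.
Proof.
move=> nk nl kl gx gy nx ny neg; apply/eqP => E.
have [x' gx' Ax] := uf_adj U nk gx.
have := norm_identity nk gx gy gx' Ax; rewrite E (sform0r Hl) => /esym/eqP.
have p1 : 0 <= H (br x' y) (br x' y).
  apply: (nneg (k := - k + l)); last exact: (wtsp_br Hbr gx' gy).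
  by apply: contraNneq kl => H0; rewrite -[l](addKr (- k)) H0 addr0 opprK.
have p2 : 0 < - ((bf k l)%:~R * H x x * H y y).
  rewrite -!mulNr -mulrNz; apply: mulr_gt0; last exact: (uf_pos U nl gy ny).
  by apply: mulr_gt0; [rewrite ltr0z oppr_gt0 | exact: (uf_pos U nk gx nx)].
by rewrite gt_eqF // ltr_wpDl.
Qed.
Lemma adj_bracket_neq0 k l x x' y : k != 0 -> l != 0 -> k + l != 0 -> g k x -> g l y ->
  g (- k) x' -> adj x x' -> x != 0 -> y != 0 -> 0 < bf k l -> br x' y != 0.
Proof.
move=> nk nl kl gx gy gx' Ax nx ny pos; apply/eqP => E.
have := norm_identity nk gx gy gx' Ax; rewrite E (sform0r Hl) sub0r => E2.
have := nneg kl (wtsp_br Hbr gx gy); rewrite E2 oppr_ge0.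
have : 0 < (bf k l)%:~R * H x x * H y y.
  apply: mulr_gt0; last exact: (uf_pos U nl gy ny).
  by apply: mulr_gt0; [rewrite ltr0z | exact: (uf_pos U nk gx nx)].
by move=> p /le_gtF; rewrite p.
Qed.
(** Here [x', y] lies in the Cartan subalgebra, where positivity fails to be available; its
    contribution is evaluated through the scalar by which [y, x'] acts on [x]. *)
Lemma norm_same_weight k x y : k != 0 -> g k x -> g k y -> bf k k = 0 \/ H y x = 0 ->
  H (br x y) (br x y) = - ((bf k k)%:~R * H x x * H y y).
Proof.
move=> nk gx gy cond.
have [x' gx' Ax] := uf_adj U nk gx; have [y' gy' Ay] := uf_adj U nk gy.
rewrite (norm_identity nk gx gy gx' Ax) (adj_sym Hh Ax).
have -> : br x (br x' y) = br (br y x') x by rewrite ac [br x' y]ac (lieNl Hbr) opprK.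
rewrite (uf_act U gy gy' Ay gx' gx) (sformZr Hl).
by case: cond => ->; rewrite ?mul0r ?mulr0 sub0r ?mul0r.
Qed.

Definition rootP k := k != 0 /\ exists2 x, g k x & x != 0.
Lemma root_ht k : rootP k -> ht k != 0.
Proof.
by case=> nk [x gx nx]; case: (g_sign ac KM gx nx nk) => /kpos_ht; rewrite ?htN; lia.
Qed.
Lemma rootN k : rootP k -> rootP (- k).
Proof.
case=> nk [x gx nx]; split; first by rewrite oppr_eq0.
by have [x' gx' Ax] := uf_adj U nk gx; exists x' => //; apply: adj_neq0 gx gx' Ax nx.
Qed.

(** Descent: if (k|l) > 0 then l - k is again a root of nonpositive norm and, [k] being the lower of
    the two, of the same sign; by induction (k|l) <= (k|k) <= 0, a contradiction. *)
Lemma same_sign_bf_le0 k l : rootP k -> rootP l -> 0 < ht k * ht l ->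
  bf k k <= 0 -> bf l l <= 0 -> bf k l <= 0.
Proof.
have [N] := ubnP (`|ht k| + `|ht l|)%N; elim: N k l => [//|N IH] k l HN rk_ rl s qk ql.
wlog le : k l HN rk_ rl s qk ql / (`|ht k| <= `|ht l|)%N.
  move=> W; have [le|/ltnW le] := leqP `|ht k| `|ht l|; first exact: W.
  by rewrite (bfC csym); apply: W; rewrite 1?addnC 1?mulrC.
rewrite leNgt; apply/negP => pos.
have [nk [x gx nx]] := rk_; have [nl [y gy ny]] := rl.
have [x' gx' Ax] := uf_adj U nk gx.
have kl : k + l != 0 by apply/eqP => /(congr1 (@ht n)); rewrite htD ht0; nia.
have nz := adj_bracket_neq0 nk nl kl gx gy gx' Ax nx ny pos.
have lk : l != k by apply: contraTneq pos => ->; rewrite -leNgt.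
have rlk : rootP (- k + l).
  split; last by exists (br x' y) => //; apply: (wtsp_br Hbr).
  by apply: contraNneq lk => E; rewrite -[l](addKr (- k)) E addr0 opprK.
have h := root_ht rlk; have hk := root_ht rk_; rewrite htD htN in h.
have qlk : bf (- k + l) (- k + l) <= 0.
  by rewrite bfDl !(bfDr csym) !bfNl !(bfNr csym) (bfC csym l k); lia.
have := IH k (- k + l) _ rk_ rlk _ qk qlk; rewrite (bfDr csym) (bfNr csym) htD htN.
have hsign : 0 < ht k * (- ht k + ht l) by nia.
move=> /(_ _ hsign) W; have : - bf k k + bf k l <= 0 by apply: W; nia.
lia.
Qed.

(** The same descent: [x, y] and [x', y] have equal norms, [same_sign_bf_le0] yields (k|l-k) = 0, so
    by induction [x] commutes with [x', y], and moving [x'] across the form gives norm zero. *)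
Lemma orthogonal_commute k l x y : rootP k -> rootP l -> 0 < ht k * ht l ->
  bf k k <= 0 -> bf l l <= 0 -> bf k l = 0 -> g k x -> g l y -> br x y = 0.
Proof.
have [N] := ubnP (`|ht k| + `|ht l|)%N; elim: N k l x y => [//|N IH] k l x y HN rk_ rl s qk ql kl0.
wlog le : k l x y HN rk_ rl s qk ql kl0 / (`|ht k| <= `|ht l|)%N.
  move=> W; have [le|/ltnW le] := leqP `|ht k| `|ht l|; first exact: W.
  move=> gx gy; apply/eqP; rewrite ac oppr_eq0; apply/eqP; move: gy gx.
  by apply: W; rewrite 1?addnC 1?mulrC // (bfC csym).
move=> gx gy; have [nk _] := rk_; have [nl _] := rl.
have kl : k + l != 0 by apply/eqP => /(congr1 (@ht n)); rewrite htD ht0; nia.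
apply/eqP; apply: contraT => nz.
have P := uf_pos U kl (wtsp_br Hbr gx gy) nz.
have [lk|lk] := eqVneq l k.
  rewrite lk in kl0 gy; rewrite (norm_same_weight nk gx gy (or_introl kl0)) in P.
  by rewrite kl0 !mul0r oppr0 ltxx in P.
have [x' gx' Ax] := uf_adj U nk gx.
have E := norm_identity nk gx gy gx' Ax; rewrite kl0 !mul0r subr0 in E.
have nz' : br x' y != 0 by apply: contraTneq P => Z; rewrite E Z (sform0r Hl) ltxx.
have rlk : rootP (- k + l).
  split; last by exists (br x' y) => //; apply: (wtsp_br Hbr).
  by apply: contraNneq lk => Z; rewrite -[l](addKr (- k)) Z addr0 opprK.
have h := root_ht rlk; have hk := root_ht rk_; rewrite htD htN in h.
have hsign : 0 < ht k * ht (- k + l) by rewrite htD htN; nia.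
have qlk : bf (- k + l) (- k + l) <= 0.
  by rewrite bfDl !(bfDr csym) !bfNl !(bfNr csym) (bfC csym l k); lia.
have kk0 := same_sign_bf_le0 rk_ rlk hsign qk qlk.
have kl0' : bf k (- k + l) = 0 by move: kk0; rewrite (bfDr csym) (bfNr csym) kl0; lia.
have Z : br x (br x' y) = 0.
  apply: (IH k (- k + l)) => //; last exact: (wtsp_br Hbr gx' gy).
  by rewrite htD htN; nia.
by rewrite E (adj_sym Hh Ax) Z (sform0r Hl) ltxx in P.
Qed.

Section Solvable.
Variable L : V -> Prop.
Hypothesis Lsub : lie_subalgebra br L.
Hypothesis Lsol : solvable_lie br L.
Local Notation D d := (derived br L d).

Definition meets (S : V -> Prop) k := exists x, [/\ S x, g k x & x != 0].

Lemma not_all_derived x : (forall d, D d x) -> x = 0.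
Proof. by have [d Hd] := Lsol => H'; apply: Hd. Qed.
Lemma meets_root S k : k != 0 -> meets S k -> rootP k.
Proof. by move=> nk [x [_ gx nx]]; split=> //; exists x. Qed.

Lemma imaginary_bf_ge0 k l : k != 0 -> l != 0 -> k != l -> meets L k -> meets L l ->
  bf k k <= 0 -> 0 <= bf k l.
Proof.
move=> nk nl kl [x [Lx gx nx]] [y [Ly gy ny]] qk; rewrite leNgt; apply/negP => neg.
(* Target: the [d]-th derived algebra of [L] meets the weight space of 2^d l + j k for all large
   [j], against solvability. *)
pose w d (j : nat) : wt := (2 ^ d)%N%:Z *: l + j%:Z *: k.
have bfw d i j : bf (w d i) (w d j) =
    (2 ^ d)%N%:Z * (2 ^ d)%N%:Z * bf l l + (i%:Z + j%:Z) * (2 ^ d)%N%:Z * bf k l + i%:Z * j%:Z * bf k k.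
  by rewrite /w bfDl !(bfDr csym) !bfZl !(bfZr csym) (bfC csym l k); ring.
suff claim d : exists N, forall j, (N <= j)%N -> exists z, [/\ D d z, g (w d j) z & z != 0].
  have [d Hd] := Lsol; have [N HN] := claim d.
  by have [z [Dz _ /eqP nz]] := HN N (leqnn N); apply: nz; apply: Hd.
elim: d => [|d [N HN]].
  exists 0%N => j _; elim: j => [|j [z [Lz gz nz]]].
    by exists y; split=> //; rewrite /w expn0 scale1r scale0r addr0.
  have bk : bf k (w 0%N j) < 0.
    by rewrite /w (bfDr csym) !(bfZr csym) expn0 mul1r; nia.
  exists (br x z); split; first exact: (proj2 Lsub).
    have -> : w 0%N j.+1 = k + w 0%N j.
      by rewrite /w expn0 -[j.+1]addn1 PoszD scalerDl !scale1r addrA addrC.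
    exact: (wtsp_br Hbr).
  apply: (bracket_neq0 nk _ _ gx gz nx nz bk).
    by apply: contraTneq bk => ->; rewrite (bf0r csym) ltxx.
  apply: contraNneq kl => E.
  have Ek : l = (1 - j%:Z) *: k.
    apply: (addIr (j%:Z *: k)); rewrite -scalerDl subrK scale1r {2}E.
    by rewrite /w expn0 scale1r.
  have := neg; rewrite Ek (bfZr csym) => neg'.
  have j0 : j = 0%N by nia.
  by rewrite j0 subr0 scale1r.
(* For j > 2J the splitting j = J + (j - J) uses two distinct weights, and j (k|l) outweighs 2^d
   (l|l), so that their inner product is negative. *)
pose J := (N + (2 ^ d * `|bf l l|).+1)%N.
exists (2 * J + 1)%N => j Hj.
have [z1 [D1 g1 n1]] := HN J (leq_addr _ _).
have [|z2 [D2 g2 n2]] := HN (j - J)%N; first by lia.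
have neg2 : bf (w d J) (w d (j - J)%N) < 0.
  rewrite bfw; set T := (2 ^ d)%N; have T0 : (0 < T)%N by rewrite expn_gt0.
  have -> : J%:Z + (j - J)%N%:Z = j%:Z by lia.
  have H1 : 0 <= J%:Z * (j - J)%N%:Z by [].
  have H2 : J%:Z * (j - J)%N%:Z * bf k k <= 0 by rewrite mulr_ge0_le0.
  have H3 : T%:Z * T%:Z * bf l l + j%:Z * T%:Z * bf k l < 0.
    have -> : T%:Z * T%:Z * bf l l + j%:Z * T%:Z * bf k l = T%:Z * (T%:Z * bf l l + j%:Z * bf k l) by ring.
    rewrite pmulr_rlt0 //.
    have H4 : T%:Z * bf l l <= (T * `|bf l l|)%N%:Z by rewrite PoszM ler_wpM2l // lez_abs.
    have H5 : (T * `|bf l l|)%N%:Z < j%:Z by rewrite ltz_nat; lia.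
    nia.
  lia.
have nw i j' : bf (w d i) (w d j') < 0 -> w d i != 0.
  by move=> Hn; apply: contraTneq Hn => ->; rewrite bf0l ltxx.
exists (br z1 z2); split.
- exact: lbracket_in.
- have -> : w d.+1 j = w d J + w d (j - J)%N.
    rewrite /w addrACA -!scalerDl expnS mul2n -addnn; congr (_ + _ *: _).
    by rewrite -PoszD; congr Posz; lia.
  exact: (wtsp_br Hbr).
- apply: (bracket_neq0 _ _ _ g1 g2 n1 n2 neg2).
  + exact: nw neg2.
  + by move: neg2; rewrite (bfC csym) => /nw.
  + rewrite /w (inj_eq (addrI _)); apply: contraNneq nk => Ek; apply/eqP/rowP => i.
    have := congr1 (fun M : wt => M 0 i) Ek; rewrite !mxE.
    move/eqP; rewrite -subr_eq0 -mulrBl mulf_eq0 subr_eq0 eqz_nat => /orP[|/eqP//].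
    by move=> /eqP; lia.
Qed.

Lemma imaginary_commute k l x y : k != 0 -> l != 0 -> k + l != 0 -> L x -> L y ->
  g k x -> g l y -> bf k k <= 0 -> bf l l <= 0 -> bf (k + l) (k + l) <= 0 -> br x y = 0.
Proof.
move=> nk nl nkl Lx Ly gx gy qk ql qkl.
have [->|nx] := eqVneq x 0; first by rewrite (lie0l Hbr).
have [->|ny] := eqVneq y 0; first by rewrite (lie0r Hbr).
apply/eqP; apply: contraT => nz.
have mk : meets L k by exists x. have ml : meets L l by exists y.
have rtk := meets_root nk mk; have rtl := meets_root nl ml.
have hk := root_ht rtk; have hl := root_ht rtl.
have mkl : meets L (k + l).
  by exists (br x y); split=> //; [apply: (proj2 Lsub) | apply: (wtsp_br Hbr)].
have hkl := root_ht (meets_root nkl mkl).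
have [same|opp] := ltP 0 (ht k * ht l).
  have bkl := same_sign_bf_le0 rtk rtl same qk ql.
  have [E|ne] := eqVneq k l; last first.
    have := imaginary_bf_ge0 nk nl ne mk ml qk => bge.
    have b0 : bf k l = 0 by lia.
    by rewrite (orthogonal_commute rtk rtl same qk ql b0 gx gy) eqxx in nz.
  subst l; have [q0|q0] := eqVneq (bf k k) 0.
    by rewrite (orthogonal_commute rtk rtl same qk ql q0 gx gy) eqxx in nz.
  (* For [k = l] of negative norm the bracket has weight 2k, and (k|2k) < 0 contradicts
     [imaginary_bf_ge0]. *)
  exfalso; have : 0 <= bf k (k + k).
    apply: imaginary_bf_ge0 => //.
    by apply/eqP => E; move: nk; rewrite -(inj_eq (addrI k)) addr0 -E eqxx.
  by rewrite (bfDr csym); lia.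
(* Opposite signs: exchanging [x] and [y] if necessary, k + l has the sign of [k]. *)
wlog W : k l x y nk nl nkl Lx Ly gx gy qk ql qkl nx ny nz mk ml rtk rtl hk hl mkl hkl opp /
    0 < ht (k + l) * ht k.
  move=> W; have [pos|neg] := ltP 0 (ht (k + l) * ht k); first exact: (W k l x y).
  apply: (W l k y x); rewrite // 1?[l + k]addrC // 1?mulrC //.
    by rewrite ac oppr_eq0.
  by move: neg opp hkl hl; rewrite htD; nia.
exfalso; set mm := k + l in W nkl mkl hkl qkl.
have rtm := meets_root nkl mkl.
have mk0 : bf mm k = 0.
  have H1 := same_sign_bf_le0 rtm rtk W qkl qk.
  have H2 := imaginary_bf_ge0 nkl nk _ mkl mk qkl.
  apply: le_anti; rewrite H1 H2 //; apply: contraNneq nl => E.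
  by rewrite -[l](addKr k) -/mm E addNr.
have ml0 : bf mm (- l) <= 0.
  apply: same_sign_bf_le0 => //; first exact: rootN.
    by rewrite htN; move: W opp hl hkl; nia.
  by rewrite bfNl (bfNr csym) opprK.
have mm0 : bf mm mm = bf mm k + bf mm l by rewrite /mm (bfDr csym).
have ml1 : bf mm (- l) = 0 by move: ml0; rewrite (bfNr csym); lia.
have [y' gy' Ay] := uf_adj U nl gy.
have gz := wtsp_br Hbr gx gy; rewrite -/mm in gz.
(* The weight k + l is now orthogonal to -l and of the same sign, so [x, y] commutes with [y'];
   moving [y] across the form then gives norm zero. *)
have C : br (br x y) y' = 0.
  apply: (orthogonal_commute rtm (rootN rtl) _ qkl _ ml1 gz gy').
    by rewrite htN; move: W opp hl hkl; nia.
  by rewrite bfNl (bfNr csym) opprK.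
have := uf_pos U nkl gz nz.
have -> : H (br x y) (br x y) = - H (br y x) (br x y) by rewrite {1}ac (sformNl Hh Hl).
by rewrite Ay [br y' _]ac C oppr0 (sform0r Hl) oppr0 ltxx.
Qed.

(** If the bracket were nonzero, m = k + l would satisfy (m|k) >= 0 and (m|l) >= 0 with sum (m|m) <=
    0, hence (m|k) = 0; but (k|l) >= 0 gives (m|k) > 0. *)
Lemma real_imaginary_commute k l x y : k != 0 -> l != 0 -> k + l != 0 -> L x -> L y ->
  g k x -> g l y -> 0 < bf k k -> bf l l <= 0 -> bf (k + l) (k + l) <= 0 -> br x y = 0.
Proof.
move=> nk nl nkl Lx Ly gx gy qk ql qkl.
have [->|nx] := eqVneq x 0; first by rewrite (lie0l Hbr).
have [->|ny] := eqVneq y 0; first by rewrite (lie0r Hbr).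
apply/eqP; apply: contraT => nz; exfalso.
have mk : meets L k by exists x. have ml : meets L l by exists y.
have mkl : meets L (k + l).
  by exists (br x y); split=> //; [apply: (proj2 Lsub) | apply: (wtsp_br Hbr)].
have n1 : k + l != k by apply: contraNneq nl => E; rewrite -[l](addKr k) E addNr.
have n2 : k + l != l by apply: contraNneq nk => E; rewrite -[k](addrK l) E addrN.
have n3 : l != k by apply: contraTneq qk => <-; rewrite -leNgt.
have H1 := imaginary_bf_ge0 nkl nk n1 mkl mk qkl.
have H2 := imaginary_bf_ge0 nkl nl n2 mkl ml qkl.
have H3 := imaginary_bf_ge0 nl nk n3 ml mk ql.
by move: qkl H1 H2 H3 qk; rewrite !bfDl !(bfDr csym) (bfC csym l k); clear; lia.
Qed.

Lemma real_real_commute k l x y : k != 0 -> l != 0 -> k + l != 0 -> L x -> L y ->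
  g k x -> g l y -> 0 < bf k k -> 0 < bf l l -> bf (k + l) (k + l) <= 0 -> br x y = 0.
Proof.
move=> nk nl nkl Lx Ly gx gy qk ql qkl.
have [->|nx] := eqVneq x 0; first by rewrite (lie0l Hbr).
have [->|ny] := eqVneq y 0; first by rewrite (lie0r Hbr).
apply/eqP; apply: contraT => nz; exfalso.
have mk : meets L k by exists x. have ml : meets L l by exists y.
have mkl : meets L (k + l).
  by exists (br x y); split=> //; [apply: (proj2 Lsub) | apply: (wtsp_br Hbr)].
have n1 : k + l != k by apply: contraNneq nl => E; rewrite -[l](addKr k) E addNr.
have n2 : k + l != l by apply: contraNneq nk => E; rewrite -[k](addrK l) E addrN.
have H1 := imaginary_bf_ge0 nkl nk n1 mkl mk qkl.
have H2 := imaginary_bf_ge0 nkl nl n2 mkl ml qkl.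
set a := bf k k in qk.
(* The weights [k] and [l] are now placed like the simple roots of the affine algebra of type
   A_1^(1). *)
have Ekl : bf k l = - a /\ bf l l = a.
  by move: qkl H1 H2; rewrite !bfDl !(bfDr csym) (bfC csym l k) /a; clear; lia.
suff claim d : exists k l x y, [/\ D d x, D d y, g k x & g l y] /\
    [/\ x != 0, y != 0, bf k k = a, bf l l = a & bf k l = - a] /\ k + l != 0.
  have [d Hd] := Lsol; have [? [? [z [? [[Dz _ _ _] [[/eqP nz' _ _ _ _] _]]]]]] := claim d.
  by apply: nz'; apply: Hd.
elim: d => [|d [k1 [l1 [x1 [y1 [[D1 D2 g1 g2] [[nx1 ny1 e1 e2 e3] nkl1]]]]]]].
  by exists k, l, x, y; case: Ekl.
have nk1 : k1 != 0 by apply: contraTneq qk => E; rewrite -e1 E bf0l ltxx.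
have nl1 : l1 != 0 by apply: contraTneq qk => E; rewrite -e2 E bf0l ltxx.
have kl1 : k1 != l1.
  apply: contraTneq qk => E; move: e3; rewrite E e2 => /eqP.
  by rewrite -addr_eq0 -mulr2n mulrn_eq0 /= => /eqP ->; rewrite ltxx.
have neg : bf k1 l1 < 0 by rewrite e3 oppr_lt0.
have nz1 := bracket_neq0 nk1 nl1 kl1 g1 g2 nx1 ny1 neg.
have Dz : D d (br x1 y1).
  by have [_ cl] := lie_subalgebra_derived d Lsub; apply: cl.
(* k + l is orthogonal to k, so the norm identity equates the norm of [x, [x, y]] with that of [x',
   [x, y]], which is nonzero because its pairing with [y] is the norm of [x, y]. *)
have step k2 l2 x2 y2 : k2 != 0 -> l2 != 0 -> k2 + l2 != 0 -> g k2 x2 -> g l2 y2 -> bf k2 k2 = a ->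
    bf k2 l2 = - a -> br x2 y2 != 0 -> br x2 (br x2 y2) != 0.
  move=> nk2 nl2 k20 gx2 gy2 E1 E2 nz2.
  have [x' gx' Ax] := uf_adj U nk2 gx2.
  have gz := wtsp_br Hbr gx2 gy2.
  have E := norm_identity nk2 gx2 gz gx' Ax.
  have b0 : bf k2 (k2 + l2) = 0 by rewrite (bfDr csym) E1 E2 subrr.
  rewrite b0 !mul0r subr0 in E.
  have nz' : br x' (br x2 y2) != 0.
    apply/eqP => Z; have : H (br x2 y2) (br x2 y2) = 0 by rewrite Ax Z (sform0r Hl).
    by move=> E0; have := uf_pos U k20 gz nz2; rewrite E0 ltxx.
  have gx'z := wtsp_br Hbr gx' gz; rewrite addKr in gx'z.
  apply: contraTneq (uf_pos U nl2 gx'z nz') => Z.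
  by rewrite -E Z (sform0r Hl) ltxx.
(* Adding the isotropic weight k + l, orthogonal to both, changes none of the inner products, and
   the new weights sum to 3(k + l). *)
exists (k1 + (k1 + l1)), (l1 + (l1 + k1)), (br x1 (br x1 y1)), (br y1 (br y1 x1)).
have e3' : bf l1 k1 = - a by rewrite (bfC csym).
have nlk1 : l1 + k1 != 0 by rewrite addrC.
split; split; [..|split|].
- exact: lbracket_in.
- by apply: lbracket_in => //; have [_ cl] := lie_subalgebra_derived d Lsub; apply: cl.
- by do 2 apply: (wtsp_br Hbr) => //.
- by do 2 apply: (wtsp_br Hbr) => //.
- exact: (step k1 l1).
- by apply: (step l1 k1) => //; rewrite ac oppr_eq0.
- by rewrite !bfDl !(bfDr csym) e1 e2 e3 e3'; ring.
- by rewrite !bfDl !(bfDr csym) e1 e2 e3 e3'; ring.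
- by rewrite !bfDl !(bfDr csym) e1 e2 e3 e3'; ring.
- apply: contraNneq nkl1 => E; apply/eqP/rowP => i.
  by have := congr1 (fun M : wt => M 0 i) E; rewrite !mxE; clear; lia.
Qed.

(** Otherwise [x], [y] and [x, y] span a copy of sl_2, which is its own derived algebra and so lies
    in every derived algebra of [L]. *)
Lemma sl2_not_solvable k x x' y : k != 0 -> L x -> L y -> g k x -> g (- k) y ->
  g (- k) x' -> adj x x' -> x != 0 -> bf k k = 0 \/ H x' y = 0.
Proof.
move=> nk Lx Ly gx gy gx' Ax nx.
have [q0|nq] := eqVneq (bf k k) 0; [by left | right].
apply/eqP; apply: contraT => nh; exfalso.
set s := (bf k k)%:~R * H x' y.
have ns : s != 0 by rewrite mulf_neq0 ?intr_eq0.
have tx : br (br x y) x = s *: x := uf_act U gx gx' Ax gy gx.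
have ty : br (br x y) y = - s *: y.
  by rewrite (uf_act U gx gx' Ax gy gy) (bfNr csym) mulrNz mulNr.
suff /not_all_derived E : forall d, D d x by rewrite E eqxx in nx.
suff all d : [/\ D d x, D d y & D d (br x y)] by move=> d; case: (all d).
elim: d => [|d [Dx Dy Dt]]; first by split=> //; apply: (proj2 Lsub).
have S1 := lbracket_subspace br (D d) (D d).
split.
- have -> : x = s^-1 *: br (br x y) x by rewrite tx scalerA mulVf ?scale1r.
  by apply: (subZ _ S1); apply: lbracket_in.
- have -> : y = (- s)^-1 *: br (br x y) y by rewrite ty scalerA mulVf ?scale1r ?oppr_eq0.
  by apply: (subZ _ S1); apply: lbracket_in.
- exact: lbracket_in.
Qed.

(** Either H(x', y) = 0 and [x, y] acts by zero, or (k|k) = 0, and then [imaginary_bf_ge0] for both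
    k and -k forces (k|l) = 0 at every weight [l] of [L]. *)
Lemma opposite_central k l x y z : k != 0 -> L x -> L y -> g k x -> g (- k) y ->
  L z -> g l z -> br (br x y) z = 0.
Proof.
move=> nk Lx Ly gx gy Lz gz.
have [->|nx] := eqVneq x 0; first by rewrite !(lie0l Hbr).
have [->|ny] := eqVneq y 0; first by rewrite (lie0r Hbr) (lie0l Hbr).
have [->|nz] := eqVneq z 0; first by rewrite (lie0r Hbr).
have [x' gx' Ax] := uf_adj U nk gx.
rewrite (uf_act U gx gx' Ax gy gz).
have [q0|->] := sl2_not_solvable nk Lx Ly gx gy gx' Ax nx; last by rewrite mulr0 scale0r.
suff -> : bf k l = 0 by rewrite mul0r scale0r.
have [->|nl] := eqVneq l 0; first by rewrite (bf0r csym).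
have mk : meets L k by exists x. have mk' : meets L (- k) by exists y.
have ml : meets L l by exists z.
have [<-//|ne] := eqVneq k l.
have nk' : - k != 0 by rewrite oppr_eq0.
have [<-|ne'] := eqVneq (- k) l; first by rewrite (bfNr csym) q0 oppr0.
have q0' : bf (- k) (- k) <= 0 by rewrite bfNl (bfNr csym) q0 oppr0.
have q00 : bf k k <= 0 by rewrite q0.
have H1 := imaginary_bf_ge0 nk nl ne mk ml q00.
have H2 := imaginary_bf_ge0 nk' nl ne' mk' ml q0'.
by apply: le_anti; rewrite H1 -oppr_ge0 -bfNl H2.
Qed.

End Solvable.
End RootGeometry.

(** * Chains of brackets and nilpotency *)

Lemma pigeonhole (T : finType) (X : Type) (r : X -> T) (s : seq X) t :
  (#|T| * t < size s)%N -> exists u, (t < count (fun x => r x == u) s)%N.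
Proof.
move=> Hs; apply/not_existsP => H; move: Hs; apply/negP; rewrite -leqNgt.
have -> : size s = (\sum_u count (fun x => r x == u) s)%N.
  elim: s {H} => [|x s IH] /=; first by rewrite big1.
  by rewrite big_split /= -IH (bigD1 (r x)) //= eqxx big1 // => u /negPf; rewrite eq_sym => ->.
rewrite -sum_nat_const; apply: leq_sum => u _; rewrite leqNgt; apply/negP; exact: H.
Qed.

Lemma perm_map_lift (T T' : eqType) (f : T -> T') xs ys : perm_eq (map f xs) ys ->
  exists2 zs, perm_eq xs zs & ys = map f zs.
Proof.
case: xs => [|x xs]; first by rewrite perm_sym => /perm_nilP ->; exists [::].
rewrite perm_sym => /(perm_iotaP (f x)) [Is]; rewrite size_map => pI ->.
exists (map (nth x (x :: xs)) Is); first by rewrite perm_sym; apply/(perm_iotaP x); exists Is.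
rewrite -map_comp; apply/eq_in_map => i; rewrite (perm_mem pI) mem_iota => /= Hi.
by rewrite -[f x :: _]/(map f (x :: xs)) (nth_map x).
Qed.

Section BoundedWeights.
Variables (n : nat) (A : 'M[int]_n) (c : 'I_n -> nat).
Hypothesis csym : forall i j, (c i)%:Z * A i j = (c j)%:Z * A j i.
Local Notation wt := 'rV[int]_n.
Local Notation bf := (bf A c).
Implicit Types (k l z : wt) (ks ls : seq wt).

Definition residue N k : {ffun 'I_n -> 'I_N.+1} :=
  [ffun i => inord `|((k 0 i)%R %% N.+1%:Z)%Z|].
Lemma residue_eq N k l : residue N k = residue N l -> exists d : wt, k = l + N.+1%:Z *: d.
Proof.
move=> E; exists (\row_i (((k 0 i)%R %/ N.+1%:Z)%Z - ((l 0 i)%R %/ N.+1%:Z)%Z)).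
apply/rowP => i; rewrite !mxE.
have := congr1 (fun f : {ffun _ -> _} => val (f i)) E; rewrite !ffunE.
have P x : 0 <= (x %% N.+1%:Z)%Z by rewrite modz_ge0.
have Q x : (`|(x %% N.+1%:Z)%Z| < N.+1)%N.
  by rewrite -ltz_nat gez0_abs ?P // ltz_pmod.
rewrite /= !inordK ?Q // => Er.
have {Er} : ((k 0 i)%R %% N.+1%:Z)%Z = ((l 0 i)%R %% N.+1%:Z)%Z.
  by rewrite -[LHS]gez0_abs ?P // Er gez0_abs ?P.
by move=> Er; rewrite {1}(divz_eq (k 0 i) N.+1%:Z) Er {2}(divz_eq (l 0 i) N.+1%:Z); ring.
Qed.

(** [us] is the part left out: the bound is asked of the sums over all sub-multisets of [ks], the
    empty one included, shifted by [z]. *)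
Definition bounded_sums (M : nat) z ks := forall us vs, perm_eq ks (us ++ vs) ->
  0 < bf (z + \sum_(v <- vs) v) (z + \sum_(v <- vs) v) <= M%:Z.

Lemma bounded_sums_sub M z ks us vs : bounded_sums M z ks -> perm_eq ks (us ++ vs) ->
  bounded_sums M z vs.
Proof.
move=> H p us' vs' p'; apply: (H (us ++ us')); apply: (perm_trans p).
by rewrite -catA perm_cat2l.
Qed.

Lemma congruent_bounded M z ks : bounded_sums M.+1 z ks ->
  (forall k, k \in ks -> 0 < bf k k <= M.+1%:Z) ->
  (forall k l, k \in ks -> l \in ks -> exists d : wt, k = l + (2 * M.+1)%N%:Z *: d) ->
  (size ks < 2 * M.+1)%N.
Proof.
move=> Hb Hq Hc; rewrite ltnNge; apply/negP => Hs.
(* Adding one more weight loses at most [M] through the terms with [z], and gains twice the number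
   of weights already present; the quadratic gain has won at 2(M+1) weights. *)
suff claim us vs : ks = us ++ vs -> let s := z + \sum_(v <- vs) v in
    1 - (size vs)%:Z * M%:Z + (size vs)%:Z * ((size vs)%:Z - 1) <= bf s s.
  have /andP[_] := Hb [::] ks (perm_refl _).
  apply/negP; rewrite -ltNge; apply: lt_le_trans (claim [::] ks erefl).
  move: (size ks) Hs => t; clear; nia.
elim: vs us => [|d vs IH] us E /=.
  rewrite big_nil addr0.
  have := Hb ks [::]; rewrite cats0 perm_refl => /(_ isT) /andP[].
  by rewrite big_nil addr0; move: (bf z z) => a; clear; lia.
have {IH} := IH (rcons us d); rewrite cat_rcons => /(_ E) /=.
set S := \sum_(v <- vs) v.
have cross : (size vs)%:Z <= bf d S.
  have [w Ew] : exists w, w = vs by exists vs.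
  have sub : {subset w <= vs} by rewrite Ew.
  rewrite /S -Ew; elim: w sub {Ew} => [|v w IH] sub /=; first by rewrite big_nil (bf0r csym).
  rewrite big_cons (bfDr csym) -addn1 PoszD addrC lerD //; last first.
    by apply: IH => x xw; apply: sub; rewrite inE xw orbT.
  have vvs : v \in vs by apply: sub; rewrite mem_head.
  case/splitPr: vvs E => v1 v2 E.
  have dk : d \in ks by rewrite E mem_cat mem_head orbT.
  have vk : v \in ks by rewrite E mem_cat inE mem_cat mem_head !orbT.
  have pdv : perm_eq ks ((us ++ v1 ++ v2) ++ [:: d; v]).
    by rewrite E; apply/permP => a; do !rewrite !count_cat /=; lia.
  have pd : perm_eq ks ((us ++ v1 ++ v :: v2) ++ [:: d]).
    by rewrite E; apply/permP => a; do !rewrite !count_cat /=; lia.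
  have pv : perm_eq ks ((us ++ d :: v1 ++ v2) ++ [:: v]).
    by rewrite E; apply/permP => a; do !rewrite !count_cat /=; lia.
  have := Hb _ _ pdv; have := Hb _ _ pd; have := Hb _ _ pv.
  have := Hb ks [::]; rewrite cats0 perm_refl => /(_ isT).
  have [dd Ed] := Hc d v dk vk; have := Hq v vk.
  have Edv : bf d v = bf v v + (2 * M.+1)%N%:Z * bf dd v by rewrite Ed bfDl bfZl.
  rewrite !big_cons !big_nil !addr0 !bfDl !(bfDr csym) (bfC csym v d) (bfC csym d z) (bfC csym v z).
  move: Edv; set x := bf dd v.
  move: (bf d v) (bf v v) (bf z z) (bf z v) (bf z d) (bf d d) => a1 a2 a3 a4 a5 a6.
  move=> Edv /andP[h1 h2] /andP[h3 h4] /andP[h5 h6] /andP[h7 h8] /andP[h9 h10].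
  (* A second difference of norms in [1, M+1] gives |(d|v)| <= M, so (d|v) and (v|v), congruent
     modulo 2(M+1), are equal. *)
  have x0 : x = 0.
    clear -Edv h1 h2 h3 h4 h5 h6 h7 h8 h9 h10.
    have l1 : - M%:Z <= a1 by lia.
    have l2 : a1 <= M%:Z by lia.
    have h11 : -1 < x by nia.
    have h12 : x < 1 by nia.
    lia.
  by rewrite Edv x0 mulr0 addr0 -gtz0_ge1.
have pd : perm_eq ks ((us ++ vs) ++ [:: d]).
  by rewrite E; apply/permP => a; do !rewrite !count_cat /=; lia.
have := Hb _ _ pd; have := Hb ks [::]; rewrite cats0 perm_refl => /(_ isT).
rewrite !big_cons !big_nil -/S !addr0 !bfDl !(bfDr csym) (bfC csym d z) (bfC csym S d).
rewrite (bfC csym S z); move: cross.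
move: (bf d S) (bf z z) (bf z d) (bf d d) (bf z S) (bf S S) => a1 a2 a3 a4 a5 a6.
move: (size vs) => t; clear => cross /andP[h1 h2] /andP[h3 h4] h5.
rewrite -addn1 PoszD; nia.
Qed.

Lemma bounded_sums_size M : exists N, forall z ks, bounded_sums M z ks ->
  (forall k, k \in ks -> 0 < bf k k <= M%:Z) -> (size ks < N)%N.
Proof.
case: M => [|M].
  exists 0%N => z ks Hb _; have := Hb ks [::]; rewrite cats0 perm_refl => /(_ isT).
  by move: (bf _ _) => a; clear; lia.
(* The boxes are the residues modulo 2(M+1), each holding fewer than 2(M+1) of the weights. *)
exists (#|{ffun 'I_n -> 'I_(2 * M.+1).-1.+1}| * (2 * M.+1)).+1%N => z ks Hb Hq.
rewrite ltnS leqNgt; apply/negP => /(@pigeonhole _ _ (residue (2 * M.+1).-1)) [u].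
rewrite -size_filter; apply/negP; rewrite -leqNgt.
set P := fun x => _ == u; apply: ltnW; apply: (congruent_bounded (z := z)).
- apply: (bounded_sums_sub (us := filter (predC P) ks) Hb).
  by rewrite perm_sym perm_catC; apply/permPl; apply: perm_filterC.
- by move=> k; rewrite mem_filter => /andP[_]; apply: Hq.
- move=> k l; rewrite !mem_filter => /andP[/eqP Pk _] /andP[/eqP Pl _].
  by apply: residue_eq; rewrite Pk Pl.
Qed.
End BoundedWeights.

Section Nilpotency.
Variables (K : numClosedFieldType) (n m : nat) (A : 'M[int]_n).
Variables (V : lmodType K) (br : V -> V -> V) (b : 'I_m -> V).
Variables (Aroot Acor : 'M[K]_(n, m)) (e f : 'I_n -> V).
Hypothesis ac : forall x y, br x y = - br y x.
Hypothesis KM : KacMoody_model A br b Aroot Acor e f.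
Variable c : 'I_n -> nat.
Hypothesis csym : forall i j, (c i)%:Z * A i j = (c j)%:Z * A j i.
Local Notation wt := 'rV[int]_n.
Local Notation g := (wtsp br b Aroot).
Implicit Types (k l : wt) (x y z : V) (S T P B C : V -> Prop).
Local Notation Hbr := (KM_lie ac KM).
Local Notation bf := (bf A c).
Local Notation pr := (proj (KM_total ac KM)).
Local Notation rk := (KM_rk KM).
Variables (H : V -> V -> K) (M0 : int).
Hypothesis U : unitary_form A c br b Aroot H M0.

Definition stable S := subspace S /\ forall k x, S x -> S (pr k x).

Lemma lbracket_homog S T P z : stable S -> stable T -> subspace P ->
  (forall k l x y, S x -> g k x -> T y -> g l y -> P (br x y)) ->
  lbracket br S T z -> P z.
Proof.
move=> [_ Sp] [_ Tp] HP Hh Hz; apply: (lbracket_min HP _ Hz) => x y Sx Ty.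
have [s _ ->] := proj_sum (KM_total ac KM) x; have [t _ ->] := proj_sum (KM_total ac KM) y.
rewrite (lie_suml Hbr); apply: sub_sum => // k _; rewrite (lie_sumr Hbr).
apply: sub_sum => // l _; apply: (Hh k l); [exact: Sp | exact: proj_wt | exact: Tp | exact: proj_wt].
Qed.
Lemma lbracket_stable S T : stable S -> stable T -> stable (lbracket br S T).
Proof.
move=> HS HT; split; first exact: lbracket_subspace.
have SB := lbracket_subspace br S T.
move=> q z Hz.
refine (lbracket_homog HS HT (P := fun z => lbracket br S T (pr q z)) _ _ Hz).
  split=> [|a x y Hx Hy]; first by rewrite (proj0 Hbr rk); exact: (sub0 SB).
  by rewrite (proj_lin Hbr rk); exact: (proj2 SB).
move=> k l x y Sx gx Ty gy; have gxy := wtsp_br Hbr gx gy.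
have [->|ne] := eqVneq q (k + l).
  by rewrite (proj_id Hbr rk _ gxy); apply: lbracket_in.
by rewrite (proj_ne Hbr rk _ gxy ne); exact: (sub0 SB).
Qed.
Lemma lbracket_wt S T P q z : stable S -> stable T -> subspace P ->
  (forall k l x y, k + l = q -> S x -> g k x -> T y -> g l y -> P (br x y)) ->
  lbracket br S T z -> g q z -> P z.
Proof.
move=> HS HT HP Hh Hz gz; rewrite -(proj_id Hbr rk (KM_total ac KM) gz).
refine (lbracket_homog HS HT (P := fun z => P (pr q z)) _ _ Hz).
  split=> [|a x y Hx Hy]; first by rewrite (proj0 Hbr rk); exact: (sub0 HP).
  by rewrite (proj_lin Hbr rk); exact: (proj2 HP).
move=> k l x y Sx gx Ty gy; have gxy := wtsp_br Hbr gx gy.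
have [E|ne] := eqVneq q (k + l); last by rewrite (proj_ne Hbr rk _ gxy ne); exact: (sub0 HP).
by rewrite E (proj_id Hbr rk _ gxy); exact: (Hh k l x y (esym E) Sx gx Ty gy).
Qed.
Lemma derived_stable S d : stable S -> stable (derived br S d).
Proof. by move=> HS; elim: d => [//|d IH] /=; apply: lbracket_stable. Qed.

Section ChainLemma.
Variables P B C : V -> Prop.
Hypotheses (PS : stable P) (BS : stable B) (CS : subspace C).
Hypothesis PB : forall x y, P x -> B y -> B (br x y).
Hypothesis PC : forall x y, P x -> C y -> C (br x y).
Hypothesis comm : forall x y z, P x -> P y -> B z -> C (br x (br y z) - br y (br x z)).

Definition chain (xs : seq V) z := foldr br z xs.
Definition allP (xs : seq V) := forall x, x \in xs -> P x.

Lemma allP_cons x xs : allP (x :: xs) <-> P x /\ allP xs.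
Proof.
split=> [Hx|[Px Hx] y]; last by rewrite inE => /orP[/eqP->|/Hx].
by split=> [|y yx]; apply: Hx; rewrite inE ?eqxx // yx orbT.
Qed.
Lemma chain_B xs z : allP xs -> B z -> B (chain xs z).
Proof. by elim: xs => [//|x xs IH] /allP_cons[Px Hx] Bz /=; apply: PB => //; apply: IH. Qed.
Lemma chain_C xs z : allP xs -> C z -> C (chain xs z).
Proof. by elim: xs => [//|x xs IH] /allP_cons[Px Hx] Bz /=; apply: PC => //; apply: IH. Qed.
(** [P] acts on [B] by operators that commute modulo [C], and [C] is stable under them; transposing
    neighbours brings any letter to the front. *)
Lemma chain_perm xs ys z : allP xs -> perm_eq xs ys -> B z -> C (chain xs z - chain ys z).
Proof.
move=> Hxs + Bz; elim: xs ys Hxs => [|x xs IH] ys Hxs p.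
  move: p; rewrite perm_sym => /perm_nilP ->.
  by rewrite subrr; exact: (sub0 CS).
have [Px Hx] := (allP_cons _ _).1 Hxs.
have xy : x \in ys by rewrite -(perm_mem p) mem_head.
case/splitPr: xy p => y1 y2 p.
have p' : perm_eq xs (y1 ++ y2).
  by rewrite -(perm_cons x); apply: (perm_trans p); rewrite -cat1s perm_catCA.
have H12 : allP (y1 ++ y2) by move=> y; rewrite -(perm_mem p'); apply: Hx.
suff E : C (br x (chain (y1 ++ y2) z) - chain (y1 ++ x :: y2) z).
  have := subD CS (PC Px (IH _ Hx p')) E.
  by rewrite (lieBr Hbr) addrA subrK.
elim: y1 {p p'} H12 => [|y y1 IH1] /=; first by rewrite subrr => _; exact: (sub0 CS).
move/allP_cons=> [Py H12]; have Bc := chain_B H12 Bz.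
have := subD CS (comm Px Py Bc) (PC Py (IH1 H12)).
by rewrite (lieBr Hbr) addrA subrK.
Qed.
Lemma chain_sub xs us vs z : allP xs -> B z -> perm_eq xs (us ++ vs) -> ~ C (chain xs z) ->
  ~ C (chain vs z).
Proof.
move=> Hx Bz p nC Cv; apply: nC.
have Hu : allP us by move=> x xu; apply: Hx; rewrite (perm_mem p) mem_cat xu.
have := subD CS (chain_perm Hx p Bz) (chain_C Hu Cv).
by rewrite [chain (us ++ vs) z]/chain foldr_cat subrK.
Qed.

Lemma iter_lbracket S r z : subspace S ->
  (forall k xs y, size xs = r -> (forall x, x \in xs -> P x /\ exists l, g l x) -> B y -> g k y ->
    S (chain xs y)) -> iter r (lbracket br P) B z -> S z.
Proof.
elim: r S z => [|r IH] S z HS Hc /=.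
  move=> Bz; have [s _ ->] := proj_sum (KM_total ac KM) z.
  apply: sub_sum => // k _; apply: (Hc k [::]) => //; first exact: (proj2 BS).
  exact: proj_wt.
move=> Hz; apply: (lbracket_min HS _ Hz) => x y Px Hy.
have [s _ ->] := proj_sum (KM_total ac KM) x; rewrite (lie_suml Hbr).
apply: sub_sum => // k _; set x' := proj _ k x.
have Px' : P x' by exact: (proj2 PS). have gx' : g k x' by apply: proj_wt.
apply: (IH (fun y => S (br x' y)) y _ _ Hy).
  exact: (lie_preimage Hbr _ HS).
move=> l xs w sx Hx Bw gw; apply: (Hc l (x' :: xs)) => //=; first by rewrite sx.
by move=> u; rewrite inE => /orP[/eqP->|/Hx //]; split=> //; exists k.
Qed.
End ChainLemma.

Section Solvable.
Variable L : V -> Prop.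
Hypothesis Lsub : lie_subalgebra br L.
Hypothesis Lsol : solvable_lie br L.
Hypothesis Lst : stable L.
Local Notation D d := (derived br L d).
Let Dst d : stable (D d) := derived_stable d Lst.

(** A weight-0 element of [L, L] is a sum of brackets of opposite nonzero weights, central by
    [opposite_central], and of brackets inside the Cartan subalgebra, which vanish. *)
Lemma derived1_cartan_central x y : D 1 x -> g 0 x -> L y -> br x y = 0.
Proof.
move=> Dx gx.
pose S x := forall y, L y -> br x y = 0.
suff : S x by apply.
refine (lbracket_wt (P := S) Lst Lst _ _ Dx gx).
  split=> [u _|a u v Hu Hv w Lw]; first by rewrite (lie0l Hbr).
  by rewrite (lieDl Hbr) (lieZl Hbr) Hu // Hv // scaler0 addr0.
move=> k l u v kl Lu gu Lv gv w Lw.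
have [s _ ->] := proj_sum (KM_total ac KM) w; rewrite (lie_sumr Hbr) big1 // => q _.
have Lq : L (pr q w) by apply: (proj2 Lst).
have El : l = - k by apply/eqP; rewrite -addr_eq0 addrC kl.
have [k0|nk] := eqVneq k 0; last first.
  by apply: (opposite_central ac KM csym U Lsub Lsol nk Lu Lv gu _ Lq (proj_wt _ _ _)); rewrite -El.
rewrite El k0 oppr0 in gv; rewrite k0 in gu.
have /hspP[cu ->] := g0_hsp ac KM gu.
by rewrite (hv_br ac KM _ gv) /evw big1 ?scale0r ?(lie0l Hbr) // => j _; rewrite wtv0 mulr0.
Qed.
(** This is where the second derived algebra enters: a vector of weight [k] is a sum of brackets of
    weight vectors of [L, L], whose weight-0 elements are already central, and for (k|k) <= 0 the
    other brackets vanish by the commutation lemmas. *)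
Lemma derived2_real k x : k != 0 -> D 2 x -> g k x -> x != 0 -> 0 < bf k k.
Proof.
move=> nk Dx gx; rewrite ltNge; apply: contraNN => qk; apply/eqP.
refine (lbracket_wt (P := fun z => z = 0) (Dst 1) (Dst 1) _ _ Dx gx).
  exact: subspace_zero.
move=> k1 k2 u v kl Du gu Dv gv.
have Lu := derived_sub0 Lsub Du; have Lv := derived_sub0 Lsub Dv.
have [k10|n1] := eqVneq k1 0.
  by rewrite k10 in gu; apply: derived1_cartan_central.
have [k20|n2] := eqVneq k2 0.
  by rewrite ac; rewrite k20 in gv; rewrite (derived1_cartan_central Dv gv Lu) oppr0.
rewrite -kl in qk nk.
have [q1|q1] := ltP 0 (bf k1 k1); have [q2|q2] := ltP 0 (bf k2 k2).
- exact: (real_real_commute ac KM csym U Lsub Lsol n1 n2 nk Lu Lv gu gv).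
- exact: (real_imaginary_commute ac KM csym U Lsub Lsol n1 n2 nk Lu Lv gu gv).
- rewrite ac (real_imaginary_commute ac KM csym U Lsub Lsol n2 n1 _ Lv Lu gv gu) ?oppr0 //.
    by rewrite addrC.
  by rewrite addrC.
- exact: (imaginary_commute ac KM csym U Lsub Lsol n1 n2 nk Lu Lv gu gv).
Qed.
Lemma derived2_cartan_central x y : D 2 x -> g 0 x -> L y -> br x y = 0.
Proof. by move/(derived_sub Lsub); apply: derived1_cartan_central. Qed.

(** The exponent exceeds the bound of [bounded_sums_size] by one: the outermost letter witnesses
    that the chains below it have nonzero weight, since a weight-0 element of L^(2) commutes with
    it. *)
Lemma chain_bound : exists r, forall P B C, stable P -> stable B -> subspace C ->
  (forall x, P x -> D 2 x) -> (forall x, B x -> D 2 x) ->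
  (forall x y, P x -> B y -> B (br x y)) -> (forall x y, P x -> C y -> C (br x y)) ->
  (forall x y z, P x -> P y -> B z -> C (br x (br y z) - br y (br x z))) ->
  forall z, iter r (lbracket br P) B z -> C z.
Proof.
have [N HN] := bounded_sums_size csym `|M0|%N; exists N.+1.
move=> P B C PS BS CS PD BD PB PC comm z.
apply: (iter_lbracket PS BS) => // k [//|x xs] y [sx] Hx By gy.
apply: contrapT => nC.
(* A weight of [x], with default 0 for vectors that have none; all letters of the chain do have
   one. *)
pose gam x : wt := if pselect (exists l, g l x) is left E then projT1 (cid E) else 0.
have gamP u : u \in x :: xs -> g (gam u) u.
  by move/Hx => [_ E]; rewrite /gam; case: pselect => // E'; case: cid.
have HP : forall u, u \in x :: xs -> P u by move=> u /Hx [].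
have chain_g us : {subset us <= x :: xs} -> g (k + \sum_(v <- map gam us) v) (chain us y).
  elim: us => [|u us IH] sub /=; first by rewrite big_nil addr0.
  rewrite big_cons addrCA; apply: (wtsp_br Hbr); first by apply: gamP; apply: sub; rewrite mem_head.
  by apply: IH => v vu; apply: sub; rewrite inE vu orbT.
have nC0 v : ~ C v -> v != 0 by move=> nv; apply: contra_notN nv => /eqP ->; exact: (sub0 CS).
have bound q v : D 2 v -> g q v -> v != 0 -> q != 0 -> 0 < bf q q <= `|M0|%N%:Z.
  move=> Dv gv nv nq; rewrite (derived2_real nq Dv gv nv) /=.
  by apply: (le_trans (uf_bound U nq gv nv)); rewrite abszE ler_norm.
have xs_ne u : u \in x :: xs -> 0 < bf (gam u) (gam u) <= `|M0|%N%:Z.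
  move=> ux; have gu := gamP _ ux; have Du := PD _ (HP _ ux).
  have p : perm_eq (x :: xs) (rem u (x :: xs) ++ [:: u]).
    by rewrite perm_sym perm_catC perm_sym; apply: perm_to_rem.
  have := nC0 _ (chain_sub CS PB PC comm HP By p nC) => /= nz.
  apply: (bound _ u Du gu).
    by apply: contraNneq nz => ->; rewrite (lie0l Hbr).
  apply: contraNneq nz => E; rewrite E in gu.
  by apply/eqP; exact: (derived2_cartan_central Du gu (derived_sub0 Lsub (BD _ By))).
suff : (size (map gam xs) < N)%N by rewrite size_map sx ltnn.
apply: (HN k) => [us vs p | l /mapP[u ux ->]]; last by apply: xs_ne; rewrite inE ux orbT.
(* A sub-multiset of the weights comes from a sub-multiset of the letters, whose chain stays outside
   [C] and so is nonzero. *)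
have [vs' [us' [p' ->]]] : exists vs' us', perm_eq xs (us' ++ vs') /\ vs = map gam vs'.
  have [zs pz Ez] := perm_map_lift p.
  exists (drop (size us) zs), (take (size us) zs); rewrite cat_take_drop; split=> //.
  by rewrite map_drop -Ez drop_size_cat.
have px : perm_eq (x :: xs) ((us' ++ [:: x]) ++ vs').
  by rewrite -catA perm_sym -[x :: xs]cat1s perm_catCA /= perm_cons perm_sym.
have px' : perm_eq (x :: xs) (us' ++ x :: vs') by rewrite -catA in px.
have n1 := nC0 _ (chain_sub CS PB PC comm HP By px nC).
have n2 := nC0 _ (chain_sub CS PB PC comm HP By px' nC).
have sub : {subset vs' <= x :: xs} by move=> u uv; rewrite (perm_mem px) mem_cat uv orbT.
have Bv : B (chain vs' y) by apply: (chain_B PB) => // u /sub; apply: HP.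
apply: (bound _ _ (BD _ Bv) (chain_g _ sub) n1).
apply: contraNneq n2 => E; have := chain_g _ sub; rewrite E => g0 /=.
have Lx : L x by exact: (derived_sub0 Lsub (PD _ (HP _ (mem_head x xs)))).
by rewrite ac oppr_eq0; apply/eqP; exact: (derived2_cartan_central (BD _ Bv) g0 Lx).
Qed.

Lemma iter_lbracket_mono P S T r z : (forall x, S x -> T x) ->
  iter r (lbracket br P) S z -> iter r (lbracket br P) T z.
Proof. by move=> ST; elim: r z => [|r IH] z /=; [exact: ST | apply: lbracket_mono]. Qed.
Lemma iter_lbracket_stable P S r : stable P -> stable S -> stable (iter r (lbracket br P) S).
Proof. by move=> HP HS; elim: r => [//|r IH] /=; apply: lbracket_stable. Qed.
Lemma derived_sub2 j x : D j.+2 x -> D 2 x.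
Proof. by elim: j => [//|j IH] /(derived_sub Lsub). Qed.

Lemma derived_ad_nilpotent j : exists r, forall z, iter r (lbracket br (D j.+2)) (D 2) z -> z = 0.
Proof.
have [d Hd] := Lsol; have [N HN] := chain_bound.
have S0 := @subspace_zero K V.
have [i] := ubnP (d - j)%N; elim: i j => [//|i IH] j Hi.
have [dj|jd] := leqP d j.
  have D0 x : D j.+2 x -> x = 0.
    move=> Dx; apply: Hd; move: Dx; have -> : j.+2 = (j.+2 - d + d)%N by rewrite subnK //; lia.
    by elim: (j.+2 - d)%N => [//|q IHq] /(derived_sub Lsub).
  exists 1%N => z /= Hz; apply: (lbracket_min S0 _ Hz) => x y /D0 -> _.
  by rewrite (lie0l Hbr).
have [r Hr] := IH j.+1 (ltac:(lia)).
(* [B q] is L^(2) after [q] brackets with the next derived algebra [D j.+3]; elements of [D j.+2]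
   act on it by operators that commute modulo [B q.+1]. *)
pose B q := iter q (lbracket br (D j.+3)) (D 2).
have Bst q : stable (B q) by apply: iter_lbracket_stable.
have BD q x : B q x -> D 2 x.
  elim: q x => [//|q IHq] x /= Hx.
  have [HS cl] := lie_subalgebra_derived 2 Lsub.
  by apply: (lbracket_min HS _ Hx) => u v Du /IHq Dv; exact: cl (@derived_sub2 j.+1 u Du) Dv.
have PB q x y : D j.+2 x -> B q y -> B q (br x y).
  elim: q x y => [|q IHq] x y Dx /= By.
    by have [_ cl] := lie_subalgebra_derived 2 Lsub; apply: cl => //; exact: derived_sub2 Dx.
  have SB : subspace (B q.+1) := lbracket_subspace _ _ _.
  refine (lbracket_min (S := fun y => B q.+1 (br x y)) _ _ By).
    exact: (lie_preimage Hbr _ SB).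
  move=> u v Du Bv; rewrite (lieJ Hbr); apply: (subD SB); apply: lbracket_in => //.
    by apply: lbracket_in => //; exact: (@derived_sub _ _ br L j.+2 u Lsub Du).
  exact: IHq.
(* Each passage from [B q] to [B q.+1] takes [N] brackets with [D j.+2]. *)
exists (r * N)%N => z Hz; apply: (Hr z); rewrite -/(B r).
elim: r z Hz {Hr} => [//|r IHr] z.
rewrite mulSn iterD => /(iter_lbracket_mono IHr).
apply: HN => //.
- exact: (proj1 (Bst r.+1)).
- by move=> x; apply: derived_sub2.
- by move=> x; apply: BD.
- by move=> x y; apply: PB.
- by move=> x y; apply: (PB r.+1).
- move=> x y u Px Py Bu; rewrite (lieJ Hbr) addrK.
  by apply: lbracket_in => //; apply: lbracket_in.
Qed.

Lemma derived2_nilpotent : nilpotent_lie br (D 2).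
Proof.
have [r Hr] := derived_ad_nilpotent 0; exists r => x Hx; apply: Hr.
by elim: r x Hx => [//|r IH] x /=; apply: lbracket_mono.
Qed.
End Solvable.
End Nilpotency.

(** By induction, the derived term of index [r + 2] of [L] lies in term [r] of the lower central
    series of L^(2). *)
Lemma nilpotent_derived2_solvable (K : fieldType) (V : lmodType K) (br : V -> V -> V) L :
  lie_subalgebra br L -> nilpotent_lie br (derived br L 2) -> solvable_lie br L.
Proof.
move=> Lsub [r Hr]; exists (r + 2)%N => x Hx; apply: Hr.
elim: r x Hx => [//|r IH] x; rewrite addSn; apply: lbracket_mono => // {}x.
by elim: r {IH} => [//|r IH]; rewrite addSn => /(derived_sub Lsub).
Qed.

(** The functionals of the grading are arbitrary here: the statement is applied to the bilinearised
    model, whose weight vectors inherit their functionals from another bracket. *)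
Theorem anticomm_derived2_nilpotent (K : numClosedFieldType) (n m : nat) (A : 'M[int]_n)
  (V : lmodType K) (br : V -> V -> V) (b : 'I_m -> V)
  (Aroot Acor : 'M[K]_(n, m)) (e f : 'I_n -> V) (L : V -> Prop) :
  (forall x y, br x y = - br y x) -> is_GCM A -> symmetrisable K A ->
  KacMoody_model A br b Aroot Acor e f -> lie_subalgebra br L ->
  (forall x, L x -> span_of (fun y => L y /\ (hsp b y \/ exists alpha, rootsp br b alpha y)) x) ->
  solvable_lie br L -> nilpotent_lie br (derived br L 2).
Proof.
move=> ac gcm sym KM Lsub Lgr Lsol.
have [c [cpos csym]] := integral_symmetriser gcm sym.
have [H [M U]] := unitary_form_exists ac KM gcm csym cpos.
apply: (derived2_nilpotent (ac := ac) (KM := KM) csym U Lsub Lsol).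
have [SL _] := Lsub; split=> // k x Lx.
have Hbr := KM_lie ac KM; have rk := KM_rk KM.
apply: (span_min (S := fun x => L (proj (KM_total ac KM) k x)) _ _ (Lgr _ Lx)).
  split=> [|a u v Hu Hv]; first by rewrite (proj0 Hbr rk); exact: (sub0 SL).
  by rewrite (proj_lin Hbr rk); exact: (proj2 SL).
move=> y [Ly Hy].
have [l gl] : exists l, wtsp br b Aroot l y.
  case: Hy => [hy|[alpha ay]]; first by exists 0; apply: (hsp_g0 ac KM hy).
  exact: (rootsp_wtsp Hbr rk (KM_total ac KM) (KM_bb KM) ay).
have [->|ne] := eqVneq k l; first by rewrite (proj_id Hbr rk _ gl).
by rewrite (proj_ne Hbr rk _ gl ne); exact: (sub0 SL).
Qed.

(** * Brackets that are linear on the left only *)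

Section ShiftAlternating.
Variables (K : numFieldType) (V : lmodType K).
Implicit Types x y z w : V.

Lemma self_opp_eq0 x : x = - x -> x = 0.
Proof.
move/eqP; rewrite -subr_eq0 opprK -mulr2n -scaler_nat scaler_eq0 pnatr_eq0 /=.
by move/eqP.
Qed.
Lemma sym_antisym_eq0 (F : V -> V -> V -> V) : (forall x y z, F x y z = F y x z) ->
  (forall x y z, F x y z = - F z y x) -> forall x y z, F x y z = 0.
Proof.
move=> sym anti x y z; apply: self_opp_eq0.
by rewrite {1}anti sym anti sym opprK anti sym.
Qed.

Variable f : V -> V -> V.
Hypothesis flin : forall a y z w, f y (a *: z + w) = a *: f y z + f y w.
Hypothesis fshift : forall s y z, f (y + s *: z) z = f y z.
Hypothesis f0 : forall z, f 0 z = 0.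

Lemma shift_exchange s y z w : f (y + s *: w) z - f y z = - (f (y + s *: z) w - f y w).
Proof.
have fD u x x' : f u (x + x') = f u x + f u x' by have := flin 1 u x x'; rewrite !scale1r.
have E1 : f (y + s *: (z + w)) z = f (y + s *: w) z.
  by rewrite scalerDr [s *: z + _]addrC addrA fshift.
have E2 : f (y + s *: (z + w)) w = f (y + s *: z) w by rewrite scalerDr addrA fshift.
have := fshift s y (z + w); rewrite !fD E1 E2 => /eqP.
rewrite -subr_eq0 opprD addrACA addr_eq0 => /eqP ->; by rewrite opprB.
Qed.
(** Two uses of [shift_exchange] carry the scalar from the first argument to the second, in which
    [f] is linear. *)
Lemma shift_affine t y w z : f (y + t *: w) z = f y z + t *: (f (y + w) z - f y z).
Proof.
have fZ u a x : f u (a *: x) = a *: f u x.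
  have f00 : f u 0 = 0 by have := flin (-1) u 0 0; rewrite scaler0 addr0 scaleN1r addNr.
  by have := flin a u x 0; rewrite f00 !addr0.
have [->|nt] := eqVneq t 0; first by rewrite !scale0r !addr0.
apply: (addrI (- f y z)); rewrite addKr addrC.
have := shift_exchange t y z w; have := shift_exchange 1 y (t *: z) w.
by rewrite !scale1r !fZ -scalerBr => -> ->.
Qed.
Lemma shift_additive y w z : f (y + w) z = f y z + f w z.
Proof.
have hom t u : f (t *: u) z = t *: f u z.
  by have := shift_affine t 0 u z; rewrite !add0r f0 add0r subr0.
(* Affine along lines and homogeneous from 0, hence additive: evaluate at the midpoint of [y] and
   [w]. *)
have := shift_affine 2^-1 y (w - y) z; rewrite addrCA subrr addr0.
have n2 : (2 : K) != 0 by rewrite pnatr_eq0.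
have -> : y + 2^-1 *: (w - y) = 2^-1 *: (y + w).
  rewrite scalerBr scalerDr addrCA [RHS]addrC; congr (_ + _).
  by rewrite -{1}[y]scale1r -scalerBl; congr (_ *: _); field.
rewrite hom => /(congr1 (fun x => 2 *: x)); rewrite scalerDr !scalerA divff // !scale1r => ->.
by rewrite scaler_nat mulr2n -addrA subrKC.
Qed.
Lemma shift_antisym y z : f y z = - f z y.
Proof.
have fD u x x' : f u (x + x') = f u x + f u x' by have := flin 1 u x x'; rewrite !scale1r.
have fxx x : f x x = 0 by have := fshift 1 0 x; rewrite f0 add0r scale1r.
have := fxx (y + z); rewrite shift_additive !fD !fxx add0r addr0 => /eqP.
by rewrite addr_eq0 => /eqP.
Qed.
End ShiftAlternating.

Section DoubleBracket.
Variables (K : numFieldType) (V : lmodType K) (br : V -> V -> V).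
Hypothesis Hbr : is_lie_bracket br.
Implicit Types x y z w u v : V.

Lemma bLl a x y z : br (a *: x + y) z = a *: br x z + br y z.
Proof. by case: Hbr. Qed.
Lemma bDl x y z : br (x + y) z = br x z + br y z.
Proof. by have := bLl 1 x y z; rewrite !scale1r. Qed.
Lemma b0l z : br 0 z = 0.
Proof. by apply: (addrI (br 0 z)); rewrite -bDl !addr0. Qed.
Lemma bZl a x z : br (a *: x) z = a *: br x z.
Proof. by have := bLl a x 0 z; rewrite b0l !addr0. Qed.
Lemma bNl x z : br (- x) z = - br x z.
Proof. by rewrite -scaleN1r bZl scaleN1r. Qed.
Lemma bsuml I (r : seq I) (P : pred I) (F : I -> V) z :
  br (\sum_(i <- r | P i) F i) z = \sum_(i <- r | P i) br (F i) z.
Proof. by apply: (big_morph (br^~ z)) => [x y|]; rewrite ?bDl ?b0l. Qed.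
Lemma bxx x : br x x = 0. Proof. by case: Hbr. Qed.
Lemma bJ x y z : br x (br y z) + br y (br z x) + br z (br x y) = 0.
Proof. by case: Hbr. Qed.
Lemma b0r x : br x 0 = 0.
Proof. by have := bJ x 0 0; rewrite !b0l !addr0. Qed.

Definition br2 x y z := br x (br y z).
Local Notation T := br2.

Lemma br2Dl x x' y z : T (x + x') y z = T x y z + T x' y z. Proof. exact: bDl. Qed.
Lemma br2Zl a x y z : T (a *: x) y z = a *: T x y z. Proof. exact: bZl. Qed.
Lemma br2J x y z : T x y z = - T y z x - T z x y.
Proof. by apply/eqP; rewrite -subr_eq0 !opprD !opprK addrA; apply/eqP/bJ. Qed.
Lemma br20m x z : T x 0 z = 0. Proof. by rewrite /T b0l b0r. Qed.

(** The defect [A] of additivity is symmetric in [y1] and [y2]. It is linear in [z] by the Jacobi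
    identity and unchanged by adding multiples of [z] to [y1] because [z, z] = 0, hence
    antisymmetric in [y1] and [z] by [shift_antisym]; the two symmetries together force it to
    vanish. *)
Lemma br2Dm x y y' z : T x (y + y') z = T x y z + T x y' z.
Proof.
pose A y1 y2 x z := T x (y1 + y2) z - T x y1 z - T x y2 z.
suff : A y y' x z = 0.
  by move/eqP; rewrite /A -addrA -opprD subr_eq0 => /eqP.
have Asym y1 y2 z' : A y1 y2 x z' = A y2 y1 x z'.
  by rewrite /A [y1 + y2]addrC -!addrA [- _ - _]addrC.
apply: (@sym_antisym_eq0 _ _ (fun y1 y2 z => A y1 y2 x z)) => // {y y' z Asym} y1 y2 z.
apply: (@shift_antisym _ _ (fun y z => A y y2 x z)) => [a y z1 z2|s y z'|z'].
- have E z' : A y y2 x z' = - (T z' x (y + y2) - T z' x y - T z' x y2).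
    rewrite /A (br2J x (y + y2)) (br2J x y) (br2J x y2) [T (y + y2) z' x]br2Dl.
    by module V.
  by rewrite !E !br2Dl !br2Zl; module V.
- by rewrite /A /T !bDl bZl bxx scaler0 !addr0.
- by rewrite /A add0r br20m subr0 subrr.
Qed.
Lemma br2Dr x y z z' : T x y (z + z') = T x y z + T x y z'.
Proof. by rewrite !(br2J x y) br2Dl br2Dm; module V. Qed.
Lemma br2C x y z : T x y z = - T x z y.
Proof.
have Txx u v : T u v v = 0 by rewrite /T bxx b0r.
have := Txx x (y + z); rewrite br2Dm !br2Dr !Txx add0r addr0 => /eqP.
by rewrite addr_eq0 => /eqP.
Qed.
Lemma br2Zm a x y z : T x (a *: y) z = a *: T x y z.
Proof.
(* The defect of homogeneity falls to the same clash: symmetric in [x] and [z], antisymmetric in [z]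
   and [y]. *)
pose G x z y := T x (a *: y) z - a *: T x y z.
suff : G x z y = 0 by move/eqP; rewrite subr_eq0 => /eqP.
have sym x' z' y' : G x' z' y' = G z' x' y'.
  rewrite /G (br2J x' (a *: y')) (br2J x' y') br2Zl (br2C z' x' (a *: y')) (br2C z' x' y').
  by module V.
have Gxx x' y' : G x' y' y' = 0.
  by rewrite /G /T bZl bxx scaler0 b0r scaler0 subrr.
have anti x' z' y' : G x' z' y' = - G x' y' z'.
  apply/eqP; rewrite -addr_eq0; apply/eqP.
  have -> : G x' z' y' + G x' y' z' = G x' (z' + y') (z' + y') - G x' z' z' - G x' y' y'.
    by rewrite /G scalerDr !br2Dm !br2Dr; module V.
  by rewrite !Gxx !subr0.
apply: (@sym_antisym_eq0 _ _ G) => // u v w.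
by rewrite sym anti sym.
Qed.
Lemma br2Zr a x y z : T x y (a *: z) = a *: T x y z.
Proof. by rewrite br2C br2Zm -scalerN -br2C. Qed.
Lemma br2Nr x y z : T x y (- z) = - T x y z.
Proof. by rewrite -scaleN1r br2Zr scaleN1r. Qed.
Lemma br2Nm x y z : T x (- y) z = - T x y z.
Proof. by rewrite -scaleN1r br2Zm scaleN1r. Qed.
Lemma br2Br x y z z' : T x y (z - z') = T x y z - T x y z'.
Proof. by rewrite br2Dr br2Nr. Qed.
Lemma br20r x y : T x y 0 = 0. Proof. by rewrite /T !b0r. Qed.
Lemma br2_sumr I (r : seq I) (P : pred I) (F : I -> V) x y :
  T x y (\sum_(i <- r | P i) F i) = \sum_(i <- r | P i) T x y (F i).
Proof. by apply: (big_morph (T x y)) => [u v|]; rewrite ?br2Dr ?br20r. Qed.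

(* A double bracket is trilinear and alternating in its last two arguments even though
   [br] is only left linear; hence [br] is a genuine Lie bracket modulo [center2]. *)
Definition center2 w := forall x y, T x y w = 0.

Lemma center2_subspace : subspace center2.
Proof.
split=> [x y|a u v Hu Hv x y]; first exact: br20r.
by rewrite br2Dr br2Zr Hu Hv scaler0 addr0.
Qed.
Local Notation CS := center2_subspace.
Lemma center2m w x y : center2 w -> T x w y = 0.
Proof. by move=> Hw; rewrite br2C Hw oppr0. Qed.
Lemma center2l w x y : center2 w -> T w x y = 0.
Proof. by move=> Hw; rewrite br2J Hw (center2m _ _ Hw) oppr0 addr0. Qed.
Lemma center2_brC x y : center2 (br x y + br y x).
Proof.
move=> u v; rewrite br2Dr.
have -> : T u v (br y x) = T u (- v) (br x y).
  by rewrite {1}/T -/(T v y x) br2C /T bNl.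
by rewrite br2Nm subrr.
Qed.
Lemma center2_brr x w : center2 w -> center2 (br x w).
Proof. by move=> Hw u v; rewrite {1}/T -/(T v x w) Hw b0r. Qed.
Lemma center2_lin a x y z : center2 (br x (a *: y + z) - (a *: br x y + br x z)).
Proof.
have H1 := center2_brC x (a *: y + z); rewrite bLl in H1.
have H2 := subD CS (subZ a CS (center2_brC x y)) (center2_brC x z).
have := subB CS H1 H2; congr center2; by module V.
Qed.
Lemma center2_J x y z : center2 (br (br x y) z - (br x (br y z) - br y (br x z))).
Proof.
have := center2_brC (br x y) z; congr center2.
rewrite -/(T z x y) -/(T x y z) -/(T y x z) (br2J z x y) (br2C y x z).
rewrite -/(T y z x) (br2C y z x) -/(T y x z) (br2C y x z); by module V.
Qed.
End DoubleBracket.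

(** * Weight vectors for a bracket linear on the left only *)

Section OneSidedModel.
Variables (K : numClosedFieldType) (n m : nat) (A : 'M[int]_n).
Variables (V : lmodType K) (br : V -> V -> V) (b : 'I_m -> V).
Variables (Aroot Acor : 'M[K]_(n, m)) (e f : 'I_n -> V).
Hypothesis KM : KacMoody_model A br b Aroot Acor e f.
Local Notation wt := 'rV[int]_n.
Local Notation g := (wtsp br b Aroot).
Local Notation dl i := (delta_mx 0 i : 'rV[int]_n).
Local Notation T := (br2 br).
Local Notation C2 := (center2 br).
Implicit Types (k l : wt) (x y z u v w : V) (d : 'rV[K]_m).

Lemma KM_bracket : is_lie_bracket br. Proof. by case: KM => [[]]. Qed.
Local Notation Hl := KM_bracket.

Lemma hv_wt k d x : g k x -> br (hv b d) x = evw Aroot k d *: x.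
Proof.
move=> gx; rewrite /hv (bsuml Hl) /evw scaler_suml; apply: eq_bigr => j _.
by rewrite (bZl Hl) gx scalerA.
Qed.
Lemma evwZ k a d : evw Aroot k (a *: d) = a * evw Aroot k d.
Proof. by rewrite /evw mulr_sumr; apply: eq_bigr => j _; rewrite mxE mulrA. Qed.
Lemma hvZ a d : hv b (a *: d) = a *: hv b d.
Proof. by rewrite /hv scaler_sumr; apply: eq_bigr => j _; rewrite mxE scalerA. Qed.
Lemma hsp_br_b x j : hsp b x -> br x (b j) = 0.
Proof.
by case=> c ->; rewrite (bsuml Hl) big1 // => i _; rewrite (bZl Hl) (KM_bb KM) scaler0.
Qed.
Lemma br2_hsp x y z : hsp b y -> hsp b z -> T x y z = 0.
Proof.
move=> hy [c ->]; rewrite (br2_sumr Hl) big1 // => j _.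
by rewrite (br2Zr Hl) /T (hsp_br_b _ hy) (b0r Hl) scaler0.
Qed.
Lemma center2_hsp y z : hsp b y -> hsp b z -> C2 (br y z).
Proof. by move=> hy hz u v; rewrite {1}/T -/(T v y z) (br2_hsp _ hy hz) (b0r Hl). Qed.

(** [z, [h, [h, w]]] is a double bracket linear in [h, w], and [h, w] is linear in [w] up to
    [center2], which double brackets ignore. A weight vector on which [h] acts by 1 has the form [h,
    [h, w]]. *)
Lemma brr_br2 h a w w' z : br z (a *: T h h w + T h h w') = a *: br z (T h h w) + br z (T h h w').
Proof.
rewrite -(br2Zr Hl) -(br2Dr Hl) -/(T z h (br h (a *: w + w'))) -/(T z h (br h w)) -/(T z h (br h w')).
have := center2_lin Hl a h w w' z h; rewrite (br2Br Hl) (br2Dr Hl) (br2Zr Hl) => /eqP.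
by rewrite subr_eq0 => /eqP.
Qed.
Lemma wtv_neq0 k : k != 0 -> exists d, evw Aroot k d = 1.
Proof.
move=> nk; have [j nj] : exists j, wtv Aroot k j != 0.
  apply/not_existsP => H; case/eqP: nk; apply: (wtv_inj (KM_rk KM)) => j.
  by rewrite wtv0; have /negP := H j; rewrite negbK => /eqP.
exists ((wtv Aroot k j)^-1 *: delta_mx 0 j).
rewrite evwZ /evw (bigD1 j) //= mxE !eqxx mul1r big1 ?addr0 ?mulVf // => i ni.
by rewrite mxE (negPf ni) andbF mul0r.
Qed.
Lemma wtsp_br2 k d x : evw Aroot k d = 1 -> g k x -> x = T (hv b d) (hv b d) x.
Proof. by move=> E gx; rewrite /T (hv_wt _ gx) E scale1r (hv_wt _ gx) E scale1r. Qed.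
Lemma wtsp_center2 k x : k != 0 -> g k x -> C2 x -> x = 0.
Proof. by move=> /wtv_neq0 [d Ed] gx Cx; rewrite (wtsp_br2 Ed gx). Qed.
Lemma wtsp_subspace k : k != 0 -> subspace (g k).
Proof.
move=> /wtv_neq0 [d Ed]; split=> [j|a x y gx gy j]; first by rewrite (b0r Hl) scaler0.
rewrite {1}(wtsp_br2 Ed gx) {1}(wtsp_br2 Ed gy) brr_br2 -(wtsp_br2 Ed gx) -(wtsp_br2 Ed gy) gx gy.
by module V.
Qed.

(** The simple roots being independent, some Cartan element takes the value 1 on all of them; its
    eigenvalues are the heights. *)
Lemma rho_exists : exists r : 'rV[K]_m, forall k, evw Aroot k r = (ht k)%:~R.
Proof.
have rf : row_free Aroot by rewrite /row_free (KM_rk KM).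
pose c : 'cV[K]_m := pinvmx Aroot *m const_mx 1.
exists c^T => k.
have E i : \sum_j c^T 0 j * Aroot i j = 1.
  have -> : \sum_j c^T 0 j * Aroot i j = (Aroot *m c) i 0.
    by rewrite mxE; apply: eq_bigr => j _; rewrite mxE mulrC.
  by rewrite mulmxA mulmxVp // mul1mx mxE.
rewrite /evw /wtv /ht rmorph_sum; under eq_bigr => j _ do rewrite mulr_sumr.
rewrite exchange_big /=; apply: eq_bigr => i _.
rewrite -[RHS]mulr1 -(E i) mulr_sumr; apply: eq_bigr => j _; ring.
Qed.

Variable r : 'rV[K]_m.
Hypothesis Hr : forall k, evw Aroot k r = (ht k)%:~R.
Local Notation rho := (hv b r).

(* The bracket is linear in a second argument of this form: [br z] of it is
   [T z rho (br rho w)]. *)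
Definition regular x := exists w, x = T rho rho w.

Lemma regular_subspace : subspace regular.
Proof.
split=> [|a x y [u ->] [v ->]]; first by exists 0; rewrite (br20r Hl).
by exists (a *: u + v); rewrite (br2Dr Hl) (br2Zr Hl).
Qed.
Local Notation RS := regular_subspace.
Lemma reg_lin a x y z : regular x -> regular y -> br z (a *: x + y) = a *: br z x + br z y.
Proof. by case=> u -> [v ->]; rewrite brr_br2. Qed.
Lemma reg_D x y z : regular x -> regular y -> br z (x + y) = br z x + br z y.
Proof. by move=> Rx Ry; have := reg_lin 1 z Rx Ry; rewrite !scale1r. Qed.
Lemma reg_Z a x z : regular x -> br z (a *: x) = a *: br z x.
Proof. by move=> Rx; have := reg_lin a z Rx (sub0 RS); rewrite (b0r Hl) !addr0. Qed.
Lemma reg_sum I (s : seq I) (F : I -> V) z : (forall i, regular (F i)) ->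
  br z (\sum_(i <- s) F i) = \sum_(i <- s) br z (F i).
Proof.
move=> RF; elim: s => [|i s IH]; first by rewrite !big_nil (b0r Hl).
rewrite !big_cons reg_D ?IH //.
by apply: (sub_sum _ RS) => j _; apply: RF.
Qed.
Lemma reg_ac x y : regular x -> regular y -> br x y = - br y x.
Proof.
move=> Rx Ry; have := bxx Hl (x + y); rewrite (bDl Hl) !reg_D // !(bxx Hl) add0r addr0.
by move/eqP; rewrite addr_eq0 => /eqP.
Qed.
Lemma reg_g k x : ht k != 0 -> g k x -> regular x.
Proof.
move=> nk gx; have E : evw Aroot k ((ht k)%:~R^-1 *: r) = 1.
  by rewrite evwZ Hr mulVf // intr_eq0.
exists ((ht k)%:~R^-1 *: ((ht k)%:~R^-1 *: x)).
rewrite {1}(wtsp_br2 E gx) hvZ (br2Zl Hl) (br2Zm Hl) !(br2Zr Hl) //.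
Qed.
Lemma reg_center2 w x : regular x -> C2 w -> br w x = 0.
Proof. by case=> u -> Cw; apply: (center2l Hl). Qed.
Lemma wtsp_br_reg k l x y : ht k != 0 -> ht l != 0 -> g k x -> g l y -> g (k + l) (br x y).
Proof.
move=> nk nl gx gy j; have Rx := reg_g nk gx; have Ry := reg_g nl gy.
rewrite -/(T (b j) x y) (br2J Hl) (br2C Hl x y) opprK /T gx gy !reg_Z // (reg_ac Ry Rx) wtvD.
by module V.
Qed.

(** Zero is allowed at every weight because a word may vanish; a nonzero height makes a weight
    vector [regular]. *)
Definition nzht k x := x = 0 \/ (ht k != 0 /\ g k x).

Lemma nzht_reg k x : nzht k x -> regular x.
Proof. by case=> [->|[nk gx]]; [exact: (sub0 RS) | exact: reg_g gx]. Qed.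
Lemma nzht_Z k a x : nzht k x -> nzht k (a *: x).
Proof.
case=> [->|[nk gx]]; [left | right]; first by rewrite scaler0.
by split=> //; apply: (subZ _ (wtsp_subspace _)) gx; apply: contraNneq nk => ->; rewrite ht0.
Qed.
Lemma nzht_hv k d x : nzht k x -> br (hv b d) x = evw Aroot k d *: x.
Proof. by case=> [->|[_ gx]]; [rewrite (b0r Hl) scaler0 | exact: hv_wt]. Qed.

Lemma weights_shift (s : seq wt) (F : wt -> V) d l : (forall k, nzht k (F k)) ->
  br (hv b d) (\sum_(k <- s) F k) - evw Aroot l d *: (\sum_(k <- s) F k) =
  \sum_(k <- s) evw Aroot (k - l) d *: F k.
Proof.
move=> HF; rewrite reg_sum => [|k]; last exact: nzht_reg (HF k).
rewrite scaler_sumr -sumrB; apply: eq_bigr => k _; rewrite (nzht_hv _ (HF k)) -scalerBl.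
by congr (_ *: _); rewrite /evw -sumrB; apply: eq_bigr => j _; rewrite wtvB mulrBr.
Qed.
Lemma weights_indep0 (s : seq wt) (F : wt -> V) : uniq s -> (forall k, nzht k (F k)) ->
  \sum_(k <- s) F k = 0 -> forall k, k \in s -> F k = 0.
Proof.
elim: s F => [//|l s IH] F /= /andP[ls us] HF; rewrite big_cons => Hsum.
have rest k : k \in s -> F k = 0.
  move=> ks; have kl : k - l != 0 by rewrite subr_eq0; apply: contraNneq ls => <-.
  have [d Ed] := wtv_neq0 kl; rewrite -[F k]scale1r -Ed.
  apply: (IH (fun k => evw Aroot (k - l) d *: F k)) => // [k'|]; first exact: nzht_Z.
  have E : \sum_(k <- s) F k = - F l by apply/eqP; rewrite -addr_eq0 addrC Hsum.
  rewrite -weights_shift // E -scaleN1r (reg_Z _ _ (nzht_reg (HF l))) (nzht_hv _ (HF l)).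
  by module V.
move=> k; rewrite inE => /orP[/eqP->|]; last exact: rest.
by move: Hsum; rewrite big_seq big1 ?addr0.
Qed.
Lemma weights_indep (s : seq wt) (F : wt -> V) q : uniq s -> (forall k, nzht k (F k)) ->
  g q (\sum_(k <- s) F k) -> forall k, k \in s -> k != q -> F k = 0.
Proof.
move=> us HF gq k ks kq.
have [d Ed] : exists d, evw Aroot (k - q) d = 1 by apply: wtv_neq0; rewrite subr_eq0.
rewrite -[F k]scale1r -Ed.
apply: (weights_indep0 (F := fun k => evw Aroot (k - q) d *: F k) us) => // [k'|].
  exact: nzht_Z.
by rewrite -weights_shift // (hv_wt _ gq) subrr.
Qed.

Lemma ht_delta_neq0 i : ht (dl i) != 0. Proof. by rewrite ht_delta. Qed.
Lemma reg_e i : regular (e i).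
Proof. exact: reg_g (ht_delta_neq0 i) (KM_ge KM i). Qed.
Lemma reg_f i : regular (f i).
Proof. by apply: reg_g (KM_gf KM i); rewrite htN ht_delta. Qed.
Lemma KM_mirror1 : KacMoody_model A br b (- Aroot) (- Acor) f e.
Proof. by apply: (KM_mirror_of _ KM) => i j; apply: reg_ac; [exact: reg_f | exact: reg_e]. Qed.

Lemma words_wt k x : words br e k x -> x = 0 \/ (kpos k /\ g k x).
Proof.
elim=> {k x} [k|i|k a x y _ Hx _ Hy|k j x _ [->|[kk gx]]].
- by left.
- by right; split; [exact: kpos_delta | exact: (KM_ge KM)].
- case: Hx => [->|[kk gx]]; first by rewrite scaler0 add0r.
  right; split=> //; have HS := wtsp_subspace (kpos_neq0 kk).
  by case: Hy => [->|[_ gy]]; apply: (proj2 HS) => //; exact: (sub0 HS).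
- by left; rewrite (b0r Hl).
- right; split; first by apply: kposD => //; apply: kpos_delta.
  apply: wtsp_br_reg gx; [exact: ht_delta_neq0 | | exact: (KM_ge KM)].
  by rewrite gt_eqF // kpos_ht.
Qed.
Lemma words_nzht k x : words br e k x -> nzht k x.
Proof. by case/words_wt => [->|[kk gx]]; [left | right; rewrite gt_eqF ?kpos_ht]. Qed.

(** [br x] is linear only modulo [center2], so preimages of [S] are subspaces once [S] contains
    [center2]. *)
Lemma stable_brr (S : V -> Prop) x : subspace S -> (forall w, C2 w -> S w) ->
  subspace (fun z => S (br x z)).
Proof.
move=> HS SC; split=> [|a y z Hy Hz]; first by rewrite (b0r Hl); exact: (sub0 HS).
rewrite -(subrK (a *: br x y + br x z) (br x _)); apply: (subD HS); last exact: (proj2 HS).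
exact: (SC _ (center2_lin Hl a x y z)).
Qed.

Definition etri y := hsp b y \/ (exists l, words br e l y) \/ C2 y.
Lemma words_f_raw j k x : words br e k x -> span_of etri (br (f j) x).
Proof.
have SS := span_subspace etri.
have SC w : C2 w -> span_of etri w by move=> Hw; apply: span_in; right; right.
have Sh y : hsp b y -> span_of etri y by move=> Hy; apply: span_in; left.
have Se l y : words br e l y -> span_of etri y by move=> Hy; apply: span_in; right; left; exists l.
have fe i : br (f j) (e i) = - ((i == j)%:R *: hv b (row i Acor)).
  by rewrite (reg_ac (reg_f j) (reg_e i)) (br_ef KM).
elim=> {k x} [k|i|k a x y _ Hx _ Hy|k i x Wx Hx].
- by rewrite (b0r Hl); exact: (sub0 SS).
- by rewrite fe; apply: (subN SS); apply: (subZ _ SS); apply: Sh; apply: hv_hsp.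
- have := stable_brr (f j) SS SC; case=> _; exact.
have := center2_J Hl (f j) (e i) x; rewrite fe (bNl Hl) (bZl Hl) => /SC.
rewrite opprB addrA => H.
have {}H := subN SS H.
have Se1 : span_of etri (br (e i) (br (f j) x)).
  refine (span_min (S := fun z => span_of etri (br (e i) z)) (stable_brr (e i) SS SC) _ Hx).
  move=> z [/hspP[d ->]|[[l Wl]|Cz]].
  - have := SC _ (center2_brC Hl (e i) (hv b d)).
    rewrite (hv_wt _ (KM_ge KM i)) => H'.
    rewrite -(addrK (evw Aroot (dl i) d *: e i) (br _ _)); apply: (subB SS H').
    by apply: (subZ _ SS); apply: Se (words_gen _ _ _).
  - by apply: Se; apply: words_ad Wl.
  - exact: (SC _ (center2_brr Hl _ Cz)).
have Se2 : span_of etri (br (hv b (row i Acor)) x).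
  by rewrite (nzht_hv _ (words_nzht Wx)); apply: (subZ _ SS); apply: Se Wx.
have := subD SS (subD SS H (subN SS (subZ (i == j)%:R SS Se2))) Se1; congr (span_of etri _).
by module V.
Qed.
End OneSidedModel.

Lemma span_family (K : fieldType) (V : lmodType K) (I : eqType) (H : I -> V -> Prop) x :
  (forall i, subspace (H i)) -> span_of (fun y => exists i, H i y) x ->
  exists F : I -> V, (forall i, H i (F i)) /\
    exists s : seq I, forall t, uniq t -> {subset s <= t} -> x = \sum_(i <- t) F i.
Proof.
move=> HS Hx; refine (span_min (S := fun x => exists F : I -> V, (forall i, H i (F i)) /\
  exists s : seq I, forall t, uniq t -> {subset s <= t} -> x = \sum_(i <- t) F i) _ _ Hx).
  split.
    exists (fun=> 0); split=> [i|]; first exact: (sub0 (HS i)).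
    by exists [::] => t _ _; rewrite big1.
  move=> a u v [F [HF [s Hs]]] [G [HG [t Ht]]]; exists (fun k => a *: F k + G k); split=> [i|].
    exact: (proj2 (HS i) _ _ _ (HF i) (HG i)).
  exists (s ++ t) => q uq sub; rewrite big_split -scaler_sumr /=.
  by rewrite -(Hs q) // -?(Ht q) // => k Hk; apply: sub; rewrite mem_cat Hk ?orbT.
move=> y [k Hy]; exists (fun l => if l == k then y else 0); split=> [l|].
  by case: eqP => [->|_] //; exact: (sub0 (HS l)).
exists [:: k] => t ut sub; rewrite (bigD1_seq k) ?sub ?mem_head //= eqxx big1 ?addr0 // => l.
by move/negPf->.
Qed.

(** * Triangular decomposition modulo [center2] *)

Section OneSidedTriangular.
Variables (K : numClosedFieldType) (n m : nat) (A : 'M[int]_n).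
Variables (V : lmodType K) (br : V -> V -> V) (b : 'I_m -> V).
Variables (Aroot Acor : 'M[K]_(n, m)) (e f : 'I_n -> V).
Hypothesis KM : KacMoody_model A br b Aroot Acor e f.
Local Notation wt := 'rV[int]_n.
Local Notation g := (wtsp br b Aroot).
Local Notation dl i := (delta_mx 0 i : 'rV[int]_n).
Local Notation T := (br2 br).
Local Notation C2 := (center2 br).
Implicit Types (k l q : wt) (x y z u v w : V) (d : 'rV[K]_m).
Local Notation Hl := (KM_bracket KM).
Let CS : subspace C2 := center2_subspace Hl.
Variable r : 'rV[K]_m.
Hypothesis Hr : forall k, evw Aroot k r = (ht k)%:~R.
Local Notation rho := (hv b r).
Local Notation KM' := (KM_mirror1 KM Hr).
Local Notation regular := (regular br b r).
Local Notation nzht := (nzht br b Aroot).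
Local Notation homog := (homog br b e f).

Lemma mirror_rho k : evw (- Aroot) k (- r) = (ht k)%:~R.
Proof.
rewrite -Hr /evw; apply: eq_bigr => j _; rewrite mxE mulNr -mulrN; congr (_ * _).
by rewrite /wtv -sumrN; apply: eq_bigr => i _; rewrite mxE mulrN opprK.
Qed.
Lemma wordsf_nzht k x : words br f k x -> nzht (- k) x.
Proof.
case/(words_nzht KM' mirror_rho) => [->|[nk /wtsp_mirror gx]]; [by left | right].
by rewrite htN oppr_eq0.
Qed.

Lemma homog_hsp x : hsp b x -> homog 0 x. Proof. by rewrite /homog eqxx. Qed.
Lemma homog_e k x : words br e k x -> homog k x.
Proof.
move=> Wx; have [->|[kk _]] := words_wt KM Hr Wx; first exact: (sub0 (homog_subspace _ _ _ _ _)).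
by rewrite /homog (negPf (kpos_neq0 kk)) kk.
Qed.
Lemma homog_f k x : words br f k x -> homog (- k) x.
Proof.
move=> Wx; have [->|[kk _]] := words_wt KM' mirror_rho Wx.
  exact: (sub0 (homog_subspace _ _ _ _ _)).
by rewrite /homog oppr_eq0 (negPf (kpos_neq0 kk)) (negPf (kposN kk)) opprK kk.
Qed.
Lemma homog_nzht k x : k != 0 -> homog k x -> nzht k x.
Proof.
rewrite /homog => /negPf ->; case: ifP => kk; first exact: (words_nzht KM Hr).
case: ifP => [_ /wordsf_nzht|_ ->]; first by rewrite opprK.
by left.
Qed.

Definition graded_span x := span_of (fun y => exists k, homog k y) x.
Definition offdiag x := span_of (fun y => exists k, k != 0 /\ homog k y) x.
Local Notation V0 := graded_span.
Local Notation S := offdiag.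

Lemma V0_subspace : subspace V0. Proof. exact: span_subspace. Qed.
Lemma S_subspace : subspace S. Proof. exact: span_subspace. Qed.
Lemma V0_homog k x : homog k x -> V0 x. Proof. by move=> Hx; apply: span_in; exists k. Qed.
Lemma S_homog k x : k != 0 -> homog k x -> S x.
Proof. by move=> nk Hx; apply: span_in; exists k. Qed.
Lemma V0_hsp x : hsp b x -> V0 x. Proof. by move/homog_hsp/V0_homog. Qed.
Lemma S_V0 x : S x -> V0 x. Proof. by apply: span_mono => y [k [_ Hy]]; exists k. Qed.

Definition V0C x := exists x0 c, [/\ V0 x0, C2 c & x = x0 + c].
Lemma V0C_subspace : subspace V0C.
Proof.
split; first by exists 0, 0; rewrite addr0; split=> //; [exact: (sub0 V0_subspace) | exact: (sub0 CS)].
move=> a x y [x0 [c [H1 H2 ->]]] [y0 [c' [H3 H4 ->]]].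
exists (a *: x0 + y0), (a *: c + c'); split; last by module V.
  exact: (proj2 V0_subspace _ _ _ H1 H3).
exact: (proj2 CS _ _ _ H2 H4).
Qed.
Lemma V0_V0C x : V0 x -> V0C x.
Proof. by move=> Hx; exists x, 0; rewrite addr0; split=> //; exact: (sub0 CS). Qed.
Lemma C2_V0C x : C2 x -> V0C x.
Proof. by move=> Hx; exists 0, x; rewrite add0r; split=> //; exact: (sub0 V0_subspace). Qed.

Lemma V0C_gen y z : (exists j, y = b j) \/ (exists i, y = e i) \/ (exists i, y = f i) ->
  V0C z -> V0C (br y z).
Proof.
move=> Hy [z0 [c [Hz0 Cc ->]]].
have st := stable_brr KM y V0C_subspace C2_V0C.
apply: (subD st); last exact: (C2_V0C (center2_brr Hl y Cc)).
have lift (h : 'I_n -> V) w : (forall k x, words br h k x -> V0 x) ->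
    span_of (etri br b h) w -> V0C w.
  move=> Hh Hw; refine (span_min V0C_subspace _ Hw) => x [hx|[[l Wl]|Cx]].
  - exact: (V0_V0C (V0_hsp hx)).
  - exact: (V0_V0C (Hh _ _ Wl)).
  - exact: C2_V0C.
have ve k x : words br e k x -> V0 x by move=> W; apply: V0_homog (homog_e W).
have vf k x : words br f k x -> V0 x by move=> W; apply: V0_homog (homog_f W).
have anti x d : V0C (br (hv b d) x) -> V0C (br x (hv b d)).
  move=> H; have := subB V0C_subspace (C2_V0C (center2_brC Hl x (hv b d))) H.
  by rewrite addrK.
have sgn w k : homog k w ->
    hsp b w \/ (exists k, words br e k w) \/ (exists k, words br f k w).
  rewrite /homog; case: eqP => _; first by left.
  case: ifP => _; first by right; left; exists k.
  case: ifP => _; first by right; right; exists (- k).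
  by move=> ->; left; apply: (sub0 (hsp_subspace _)).
refine (span_min (S := fun z => V0C (br y z)) st _ Hz0) => w [k /[dup] Hw /sgn Sw].
case: Hy => [[j ->]|[[i ->]|[i ->]]].
- have [k0|nk] := eqVneq k 0.
    apply: C2_V0C; apply: (center2_hsp KM); first exact: hsp_b.
    by move: Hw; rewrite /homog k0 eqxx.
  have [->|[_ gw]] := homog_nzht nk Hw; first by rewrite (b0r Hl); exact: (sub0 V0C_subspace).
  by rewrite gw; apply: (subZ _ V0C_subspace); apply: V0_V0C; apply: V0_homog Hw.
- case: Sw => [/hspP[d ->]|[[l Wl]|[l Wl]]].
  + apply: anti; rewrite (hv_wt KM _ (KM_ge KM i)).
    by apply: (subZ _ V0C_subspace); apply: V0_V0C; apply: (ve _ _ (words_gen _ _ _)).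
  + by apply: V0_V0C; apply: (ve _ _ (words_ad _ Wl)).
  + exact: (lift _ _ vf (words_f_raw KM' mirror_rho i Wl)).
- case: Sw => [/hspP[d ->]|[[l Wl]|[l Wl]]].
  + apply: anti; rewrite (hv_wt KM _ (KM_gf KM i)).
    by apply: (subZ _ V0C_subspace); apply: V0_V0C; apply: (vf _ _ (words_gen _ _ _)).
  + exact: (lift _ _ ve (words_f_raw KM Hr i Wl)).
  + by apply: V0_V0C; apply: (vf _ _ (words_ad _ Wl)).
Qed.

(** The elements whose left bracket preserves [V0C] form a subalgebra containing the generators. The
    algebra thus exceeds its graded part only by vectors that double brackets do not see. *)
Lemma V0C_total x : V0C x.
Proof.
have [_ _ _ G _] := KM.
have VS := V0C_subspace.
have stab y : forall z, V0C z -> V0C (br y z).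
  apply: (gen_subalgebra_min (S := fun y => forall z, V0C z -> V0C (br y z)) _ _ (G y)).
    split; [split|].
    - by move=> z _; rewrite (b0l Hl); exact: (sub0 VS).
    - move=> a u v Hu Hv z Hz; rewrite (bLl Hl).
      exact: (proj2 VS _ _ _ (Hu _ Hz) (Hv _ Hz)).
    - move=> u v Hu Hv z Hz.
      rewrite -(subrK (br u (br v z) - br v (br u z)) (br _ z)).
      apply: (subD VS); first exact: (C2_V0C (center2_J Hl u v z)).
      by apply: (subB VS); [apply: Hu; apply: Hv | apply: Hv; apply: Hu].
  by move=> u Hu z; apply: V0C_gen.
apply: (gen_subalgebra_min _ _ (G x)) => [|y [[k ->]|[[i ->]|[i ->]]]].
- by split=> // u v _; apply: stab.
- by apply: V0_V0C; apply: V0_hsp; apply: hsp_b.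
- by apply: V0_V0C; apply: V0_homog (homog_e (words_gen _ _ _)).
- by apply: V0_V0C; apply: V0_homog (homog_f (words_gen _ _ _)).
Qed.

Lemma br2_nzht k d x : nzht k x -> T (hv b d) (hv b d) x = (evw Aroot k d ^+ 2) *: x.
Proof.
move=> Nx; rewrite /T (nzht_hv KM _ Nx).
by rewrite (reg_Z KM _ _ (nzht_reg KM Hr Nx)) (nzht_hv KM _ Nx) scalerA expr2.
Qed.
Lemma br2_homog k d x : homog k x -> T (hv b d) (hv b d) x = (evw Aroot k d ^+ 2) *: x.
Proof.
have [->|nk] := eqVneq k 0.
  rewrite /homog eqxx => hx; rewrite (br2_hsp KM _ (hv_hsp _ _) hx).
  by rewrite /evw big1 ?expr0n ?scale0r // => j _; rewrite wtv0 mulr0.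
move/(homog_nzht nk) => Nx; rewrite /T (nzht_hv KM _ Nx).
by rewrite (reg_Z KM _ _ (nzht_reg KM Hr Nx)) (nzht_hv KM _ Nx) scalerA expr2.
Qed.

Lemma homog_wtsp q x : q != 0 -> g q x -> homog q x.
Proof.
move=> nq gx; have [d Ed] := wtv_neq0 KM nq.
have [x0 [c [Hx0 Cc E]]] := V0C_total x.
have [F [HF [s Hs]]] := span_family (homog_subspace _ _ _ _) Hx0.
(* The double bracket with [hv b d] fixes [x], deletes the [center2] part and acts on graded
   components by squares of eigenvalues. *)
have Ex : x = \sum_(k <- undup (q :: s)) (evw Aroot k d ^+ 2) *: F k.
  rewrite (wtsp_br2 KM Ed gx) E (br2Dr Hl) Cc addr0.
  rewrite (Hs (undup (q :: s))) ?undup_uniq // => [|k ks]; last by rewrite mem_undup inE ks orbT.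
  by rewrite (br2_sumr Hl); apply: eq_bigr => k _; apply: br2_homog.
have HN k : nzht k ((evw Aroot k d ^+ 2) *: F k).
  have [->|nk] := eqVneq k 0; last exact: nzht_Z KM _ _ _ (homog_nzht nk (HF k)).
  by rewrite /evw big1 ?expr0n ?scale0r; [left | move=> j _; rewrite wtv0 mulr0].
have := weights_indep KM Hr (undup_uniq (q :: s)) HN; rewrite -Ex => /(_ q gx) Z.
rewrite Ex (bigD1_seq q) ?mem_undup ?mem_head ?undup_uniq //= big_seq_cond big1 ?addr0.
  by rewrite Ed expr1n scale1r.
by move=> k /andP[ks kq]; apply: Z.
Qed.

Lemma nzht_br k l x y : nzht k x -> nzht l y -> g (k + l) (br x y).
Proof.
have g0 q : g q 0 by move=> j; rewrite (b0r Hl) scaler0.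
case=> [->|[nk gx]]; first by rewrite (b0l Hl).
case=> [->|[nl gy]]; first by rewrite (b0r Hl).
exact: (wtsp_br_reg KM Hr).
Qed.
(** Weights alone do not suffice, as the weight-0 space is not identified with the Cartan subalgebra
    here. Induction on the negative word, through the Jacobi identity. *)
Lemma hsp_br_ef l v : words br f l v -> forall u, words br e l u -> hsp b (br u v).
Proof.
have HS := hsp_subspace b.
have Re k x : words br e k x -> regular x := fun W => nzht_reg KM Hr (words_nzht KM Hr W).
have Rf k x : words br f k x -> regular x := fun W => nzht_reg KM Hr (wordsf_nzht W).
have delta i x : words br e (dl i) x -> exists a, x = a *: e i.
  by move=> W; apply: (words_delta (b0r Hl) W).
elim=> {l v} [k|i|k a x y Wx Hx Wy Hy|k j w Ww IH] u Wu.
- by rewrite (b0r Hl); exact: (sub0 HS).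
- have [a ->] := delta _ _ Wu; rewrite (bZl Hl) (br_ef KM).
  by apply: (subZ _ HS); apply: (subZ _ HS); apply: hv_hsp.
- by rewrite (reg_lin KM _ _ (Rf _ _ Wx) (Rf _ _ Wy)); apply: (proj2 HS); [exact: Hx | exact: Hy].
have [->|[kk _]] := words_wt KM' mirror_rho Ww; first by rewrite !(b0r Hl); exact: (sub0 HS).
have nk := kpos_neq0 kk.
have N1 : words br e (dl j) (br w u).
  have : g (dl j) (br w u).
    by have := nzht_br (wordsf_nzht Ww) (words_nzht KM Hr Wu); rewrite addrCA addNr addr0.
  by move/(homog_wtsp (kpos_neq0 (kpos_delta j))); rewrite /homog (negPf (kpos_neq0 (kpos_delta j))) kpos_delta.
have N2 : words br e k (br u (f j)).
  have : g k (br u (f j)).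
    have := nzht_br (words_nzht KM Hr Wu) (wordsf_nzht (words_gen br f j)).
    by rewrite addrAC addrN add0r.
  by move/(homog_wtsp nk); rewrite /homog (negPf nk) kk.
have [a Ea] := delta _ _ N1.
rewrite -/(T u (f j) w) (br2J Hl) /T Ea (reg_Z KM _ _ (reg_e KM Hr j)).
apply: (subB HS).
  apply: (subN HS); apply: (subZ _ HS).
  rewrite (reg_ac KM (reg_f KM Hr j) (reg_e KM Hr j)) (br_ef KM).
  by apply: (subN HS); apply: (subZ _ HS); apply: hv_hsp.
rewrite (reg_ac KM (Rf _ _ Ww) (Re _ _ N2)); apply: (subN HS); exact: IH.
Qed.

Lemma homog_reg k x : k != 0 -> homog k x -> regular x.
Proof. by move=> nk Hx; exact: (nzht_reg KM Hr (homog_nzht nk Hx)). Qed.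
Lemma homog_br k l x y : k != 0 -> l != 0 -> homog k x -> homog l y -> homog (k + l) (br x y).
Proof.
move=> nk nl Hx Hy; have [kl|nkl] := eqVneq (k + l) 0; last first.
  by apply: (homog_wtsp nkl); apply: nzht_br; apply: homog_nzht.
have El : l = - k by apply/eqP; rewrite -addr_eq0 addrC kl.
rewrite kl; apply: homog_hsp.
have HS := hsp_subspace b.
have := Hx; rewrite /homog (negPf nk); case: ifP => [kk Wx|_].
  by move: Hy; rewrite /homog (negPf nl) El opprK (negPf (kposN kk)) kk => Wy; exact: hsp_br_ef Wy _ Wx.
case: ifP => [kk Wx|_ ->]; last by rewrite (b0l Hl); exact: (sub0 HS).
move: Hy; rewrite /homog (negPf nl) El kk => Wy.
rewrite (reg_ac KM (nzht_reg KM Hr (wordsf_nzht Wx)) (nzht_reg KM Hr (words_nzht KM Hr Wy))).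
by apply: (subN HS); exact: hsp_br_ef Wx _ Wy.
Qed.
Lemma hv_homog k d x : k != 0 -> homog k x -> br (hv b d) x = evw Aroot k d *: x.
Proof. by move=> nk Hx; exact: (nzht_hv KM d (homog_nzht nk Hx)). Qed.

Lemma S_reg x : S x -> regular x.
Proof.
by move=> Hx; apply: (span_min (regular_subspace KM r) _ Hx) => y [k [nk]]; apply: homog_reg.
Qed.
Definition homog_nz k y := if k == 0 then y = 0 else homog k y.
Lemma homog_nz_subspace k : subspace (homog_nz k).
Proof.
by rewrite /homog_nz; case: eqP => _; [exact: subspace_zero | exact: homog_subspace].
Qed.
Lemma homog_nz_nzht k y : homog_nz k y -> nzht k y.
Proof. by rewrite /homog_nz; case: eqP => [_ ->|/eqP nk]; [left | apply: homog_nzht]. Qed.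
Lemma homog_nz_S k y : homog_nz k y -> S y.
Proof.
rewrite /homog_nz; case: eqP => [_ ->|/eqP nk]; first exact: (sub0 S_subspace).
exact: S_homog.
Qed.
Lemma S_decomp x : S x -> exists F, (forall k, homog_nz k (F k)) /\
  exists2 s, uniq s & x = \sum_(k <- s) F k.
Proof.
move=> Hx; have [|F [HF [s Hs]]] := span_family (x := x) homog_nz_subspace.
  by apply: span_mono Hx => y [k [nk Hy]]; exists k; rewrite /homog_nz (negPf nk).
exists F; split=> //; exists (undup s); first exact: undup_uniq.
by apply: Hs; rewrite ?undup_uniq // => k; rewrite mem_undup.
Qed.
(** The operator acts on each piece by the square of its height, nonzero wherever the piece is
    nonzero. In particular [S] meets the Cartan subalgebra trivially. *)
Lemma S_br2_inj x : S x -> T rho rho x = 0 -> x = 0.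
Proof.
move=> Hx E; have [F [HF [s us Ex]]] := S_decomp Hx.
have HN k : nzht k (F k) := homog_nz_nzht (HF k).
have E2 : \sum_(k <- s) evw Aroot k r ^+ 2 *: F k = 0.
  by rewrite -[RHS]E Ex (br2_sumr Hl); apply: eq_bigr => k _; rewrite (br2_nzht r (HN k)).
have Z := weights_indep0 KM Hr us (fun k => nzht_Z KM _ (HN k)) E2.
rewrite Ex big_seq big1 // => k /Z /eqP.
rewrite scaler_eq0 expf_eq0 Hr intr_eq0 /= => /orP[/eqP hk|/eqP //].
by case: (HN k) => // -[]; rewrite hk eqxx.
Qed.

Lemma V0_decomp x : V0 x -> exists h, hsp b h /\ S (x - h).
Proof.
move=> Hx; refine (span_min (S := fun x => exists h, hsp b h /\ S (x - h)) _ _ Hx).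
  split; first by exists 0; rewrite subrr; split; [exact: (sub0 (hsp_subspace b)) | exact: (sub0 S_subspace)].
  move=> a u v [h [Hh Su]] [h' [Hh' Sv]]; exists (a *: h + h'); split.
    exact: (proj2 (hsp_subspace b) _ _ _ Hh Hh').
  have := proj2 S_subspace a _ _ Su Sv; congr S; module V.
move=> y [k Hy]; have [k0|nk] := eqVneq k 0.
  exists y; rewrite subrr; split; last exact: (sub0 S_subspace).
  by move: Hy; rewrite k0 /homog eqxx.
exists 0; rewrite subr0; split; [exact: (sub0 (hsp_subspace b)) | exact: S_homog nk Hy].
Qed.
Definition hpart x : V :=
  if pselect (exists h, hsp b h /\ S (x - h)) is left E then projT1 (cid E) else 0.
Definition upart x := x - hpart x.
Lemma hpart_hsp x : hsp b (hpart x).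
Proof.
rewrite /hpart; case: pselect => [E|_]; last exact: (sub0 (hsp_subspace b)).
by case: cid => h [].
Qed.
Lemma upart_S x : V0 x -> S (upart x).
Proof.
move=> Hx; rewrite /upart /hpart; case: pselect => [E|[]]; last exact: V0_decomp.
by case: cid => h [].
Qed.
Lemma br2_rho_hsp h : hsp b h -> T rho rho h = 0.
Proof. by apply: (br2_hsp KM); apply: hv_hsp. Qed.
Lemma S_hsp_eq0 u : S u -> hsp b u -> u = 0.
Proof. by move=> Su hu; apply: (S_br2_inj Su); apply: br2_rho_hsp. Qed.
Lemma hpartE h u : hsp b h -> S u -> hpart (h + u) = h.
Proof.
move=> hh Su; apply/eqP; rewrite -subr_eq0; apply/eqP.
have V1 : V0 (h + u) := subD V0_subspace (V0_hsp hh) (S_V0 Su).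
apply: S_hsp_eq0; last exact: (subB (hsp_subspace b) (hpart_hsp _) hh).
have := subB S_subspace Su (upart_S V1); rewrite /upart; congr S; module V.
Qed.
Lemma hpart_lin a x y : V0 x -> V0 y -> hpart (a *: x + y) = a *: hpart x + hpart y.
Proof.
move=> Hx Hy; have := hpartE (proj2 (hsp_subspace b) a _ _ (hpart_hsp x) (hpart_hsp y))
  (proj2 S_subspace a _ _ (upart_S Hx) (upart_S Hy)).
move=> <-; congr hpart; rewrite /upart; module V.
Qed.
Lemma upart_lin a x y : V0 x -> V0 y -> upart (a *: x + y) = a *: upart x + upart y.
Proof. by move=> Hx Hy; rewrite /upart hpart_lin //; module V. Qed.
Lemma hpart_h x : hsp b x -> hpart x = x.
Proof. by move=> hx; rewrite -{1}[x]addr0 hpartE //; exact: (sub0 S_subspace). Qed.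
Lemma hpart_S x : S x -> hpart x = 0.
Proof. by move=> hx; rewrite -[x]add0r hpartE //; exact: (sub0 (hsp_subspace b)). Qed.
Lemma upart_h x : hsp b x -> upart x = 0.
Proof. by move=> hx; rewrite /upart hpart_h ?subrr. Qed.
Lemma upart_id x : S x -> upart x = x.
Proof. by move=> hx; rewrite /upart hpart_S ?subr0. Qed.

(* [br] may fail to be bilinear and antisymmetric on [V0] only through the brackets
   [x, h] with [h] in the Cartan subalgebra; these are replaced by [- [h, x]], or by
   [0] when [x] lies in the Cartan subalgebra too. *)
Definition nb x y := br x (upart y) - br (hpart y) (upart x).

Lemma nb_linl a x y z : V0 x -> V0 y -> nb (a *: x + y) z = a *: nb x z + nb y z.
Proof.
move=> Hx Hy; rewrite /nb (bLl Hl) upart_lin //.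
rewrite (reg_lin KM _ _ (S_reg (upart_S Hx)) (S_reg (upart_S Hy))); module V.
Qed.
Lemma nb_ac x y : V0 x -> V0 y -> nb x y = - nb y x.
Proof.
move=> Hx Hy; have Rx := S_reg (upart_S Hx); have Ry := S_reg (upart_S Hy).
have D z w : br z w = br (hpart z) w + br (upart z) w by rewrite -(bDl Hl) /upart subrKC.
rewrite /nb (D x) (D y (upart x)) (reg_ac KM Rx Ry); module V.
Qed.
Lemma nb_linr a x y z : V0 x -> V0 y -> V0 z -> nb z (a *: x + y) = a *: nb z x + nb z y.
Proof.
move=> Hx Hy Hz; have Hxy := proj2 V0_subspace a _ _ Hx Hy.
by rewrite nb_ac // nb_linl // (nb_ac Hz Hx) (nb_ac Hz Hy); module V.
Qed.
Lemma nb_hh x y : hsp b x -> hsp b y -> nb x y = 0.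
Proof. by move=> hx hy; rewrite /nb !upart_h // !(b0r Hl) subrr. Qed.
Lemma nb_S x y : V0 x -> S y -> nb x y = br x y.
Proof. by move=> Hx Sy; rewrite /nb upart_id // hpart_S // (b0l Hl) subr0. Qed.
Lemma nb_homog k l x y : homog k x -> homog l y -> homog (k + l) (nb x y).
Proof.
move=> Hx Hy; have [k0|nk] := eqVneq k 0; have [l0|nl] := eqVneq l 0.
- rewrite k0 l0 addr0; move: Hx Hy; rewrite k0 l0 /homog eqxx => hx hy; rewrite nb_hh //.
  exact: (sub0 (hsp_subspace b)).
- move: Hx; rewrite k0 add0r {1}/homog eqxx => /hspP[d ->].
  rewrite nb_S ?(hv_homog _ nl Hy); [|exact: V0_hsp (hv_hsp _ _)|exact: S_homog nl Hy].
  exact: (subZ _ (homog_subspace _ _ _ _ _) Hy).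
- move: Hy; rewrite l0 addr0 {1}/homog eqxx => /hspP[d ->].
  rewrite (nb_ac (V0_homog Hx) (V0_hsp (hv_hsp b d))).
  rewrite nb_S ?(hv_homog _ nk Hx); [|exact: V0_hsp (hv_hsp _ _)|exact: S_homog nk Hx].
  exact: (subN (homog_subspace _ _ _ _ _) (subZ _ (homog_subspace _ _ _ _ _) Hx)).
- by rewrite nb_S; [exact: homog_br | exact: V0_homog Hx | exact: S_homog nl Hy].
Qed.
Lemma nb_V0 x y : V0 x -> V0 y -> V0 (nb x y).
Proof.
move=> Hx Hy.
have lx z : V0 z -> subspace (fun x => V0 x /\ V0 (nb x z)).
  move=> Hz; split; first by rewrite /nb (b0l Hl) upart_h ?(b0r Hl) ?subrr; [split; exact: (sub0 V0_subspace)| exact: (sub0 (hsp_subspace b))].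
  move=> a u v [Vu Hu] [Vv Hv]; split; first exact: (proj2 V0_subspace).
  by rewrite nb_linl //; exact: (proj2 V0_subspace).
have key k z : homog k z -> V0 (nb x z).
  move=> Hz; suff [] : V0 x /\ V0 (nb x z) by [].
  refine (span_min (lx _ (V0_homog Hz)) _ Hx) => w [l Hw].
  by split; [exact: V0_homog Hw | exact: V0_homog (nb_homog Hw Hz)].
rewrite nb_ac //; apply: (subN V0_subspace).
suff [] : V0 y /\ V0 (nb y x) by [].
refine (span_min (lx _ Hx) _ Hy) => w [l Hw]; split; first exact: V0_homog Hw.
rewrite (nb_ac (V0_homog Hw) Hx); apply: (subN V0_subspace); exact: key Hw.
Qed.
Lemma nb_center2 x y : V0 x -> V0 y -> C2 (br x y - nb x y).
Proof.
move=> Hx Hy.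
have Dx : x = hpart x + upart x by rewrite /upart subrKC.
have Dy : y = hpart y + upart y by rewrite /upart subrKC.
have H1 := center2_lin Hl 1 x (hpart y) (upart y).
have H2 := center2_brC Hl x (hpart y).
have H3 := center2_hsp KM (hpart_hsp y) (hpart_hsp x).
have H4 := center2_lin Hl 1 (hpart y) (hpart x) (upart x).
have := subB CS (subB CS (subD CS H1 H2) H4) H3.
rewrite !scale1r -Dx -Dy /nb; congr C2; module V.
Qed.

Lemma center2_congr x u v : C2 (u - v) -> C2 (br x u - br x v).
Proof.
move=> Cuv; have := subD CS (center2_lin Hl 1 x (u - v) v) (center2_brr Hl x Cuv).
rewrite !scale1r subrK; congr C2; module V.
Qed.
Lemma nb_nb_center2 x y z : V0 x -> V0 y -> V0 z -> C2 (nb x (nb y z) - br x (br y z)).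
Proof.
move=> Hx Hy Hz; have H1 := nb_center2 Hx (nb_V0 Hy Hz).
have H2 := center2_congr x (nb_center2 Hy Hz).
have := subN CS (subD CS H1 H2); congr C2; module V.
Qed.
Lemma nb_Zr a x z : V0 x -> V0 z -> nb z (a *: x) = a *: nb z x.
Proof.
move=> Hx Hz; have V00 := sub0 V0_subspace.
have n0 : nb z 0 = 0 by have := nb_linr (-1) V00 V00 Hz; rewrite scaler0 addr0 scaleN1r addNr.
by have := nb_linr a Hx V00 Hz; rewrite n0 !addr0.
Qed.
Lemma nb_h d k x : k != 0 -> homog k x -> nb (hv b d) x = evw Aroot k d *: x.
Proof.
move=> nk Hx; rewrite nb_S ?(hv_homog _ nk Hx) //; first exact: V0_hsp (hv_hsp b d).
exact: S_homog nk Hx.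
Qed.

Definition jacobiator x y z := nb x (nb y z) + nb y (nb z x) + nb z (nb x y).
Local Notation J3 := jacobiator.

Lemma jacobiator_cyc x y z : J3 x y z = J3 y z x.
Proof. by rewrite /jacobiator -addrA addrC. Qed.
Lemma jacobiator_lin a x x' y z : V0 x -> V0 x' -> V0 y -> V0 z ->
  J3 (a *: x + x') y z = a *: J3 x y z + J3 x' y z.
Proof.
move=> Hx Hx' Hy Hz; have Hyz := nb_V0 Hy Hz.
have Hzx := nb_V0 Hz Hx; have Hzx' := nb_V0 Hz Hx'.
have Hxy := nb_V0 Hx Hy; have Hx'y := nb_V0 Hx' Hy.
rewrite /J3 nb_linl // (nb_linr a Hx Hx' Hz) (nb_linr a Hzx Hzx' Hy).
by rewrite (nb_linl a y Hx Hx') (nb_linr a Hxy Hx'y Hz); module V.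
Qed.
Lemma jacobiator_hsp d l y z : l != 0 -> homog l y -> homog (- l) z -> J3 (hv b d) y z = 0.
Proof.
move=> nl Hy Hz; have Vy := V0_homog Hy; have Vz := V0_homog Hz; have Vh := V0_hsp (hv_hsp b d).
have nl' : - l != 0 by rewrite oppr_eq0.
have hyz : hsp b (nb y z).
  by have := nb_homog Hy Hz; rewrite subrr /homog eqxx.
rewrite /J3 (nb_hh (hv_hsp b d) hyz) add0r (nb_ac Vz Vh) !(nb_h _ _ Hy, nb_h _ _ Hz) //.
rewrite -scaleNr !nb_Zr // (nb_ac Vz Vy).
have -> : evw Aroot (- l) d = - evw Aroot l d.
  by rewrite /evw -sumrN; apply: eq_bigr => j _; rewrite wtvN mulrN.
by module V.
Qed.
(** At a nonzero total weight the jacobiator lies in that weight space and, by comparison with the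
    Jacobi identity of [br], in [center2], so it vanishes. At total weight zero either a Cartan
    element is involved and a direct computation settles it, or [nb] and [br] agree on all brackets
    involved. *)
Lemma jacobiator_homog k l q x y z : homog k x -> homog l y -> homog q z -> J3 x y z = 0.
Proof.
move=> Hx Hy Hz; have Vx := V0_homog Hx; have Vy := V0_homog Hy; have Vz := V0_homog Hz.
have [E|ne] := eqVneq (k + l + q) 0; last first.
  have HJ : homog (k + l + q) (J3 x y z).
    have HS := homog_subspace br b e f (k + l + q).
    apply: (subD HS); [apply: (subD HS)|].
    - by rewrite -addrA; exact: (nb_homog Hx (nb_homog Hy Hz)).
    - have -> : k + l + q = l + (q + k) by rewrite -addrA addrC -addrA.
      exact: (nb_homog Hy (nb_homog Hz Hx)).
    - by rewrite addrC; exact: (nb_homog Hz (nb_homog Hx Hy)).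
  have CJ : C2 (J3 x y z).
    have := subD CS (subD CS (nb_nb_center2 Vx Vy Vz) (nb_nb_center2 Vy Vz Vx)) (nb_nb_center2 Vz Vx Vy).
    congr C2; rewrite /J3; have := bJ Hl x y z => EJ.
    by rewrite -[RHS]subr0 -EJ; module V.
  by have [->//|[_ gJ]] := homog_nzht ne HJ; exact: (wtsp_center2 KM ne gJ CJ).
have hsp0 k' w : k' = 0 -> homog k' w -> exists d, w = hv b d.
  by move=> ->; rewrite /homog eqxx => /hspP.
have z0 k' l' (w : wt) x' y' : k' = 0 -> k' + l' + w = 0 -> homog k' x' -> homog l' y' ->
    forall z', homog w z' -> J3 x' y' z' = 0.
  move=> k0 E' Hx' Hy' z' Hz'; have [d ->] := hsp0 _ _ k0 Hx'.
  have Ew : w = - l' by apply/eqP; rewrite -addr_eq0 addrC; move: E'; rewrite k0 add0r => ->.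
  rewrite Ew in Hz'; have [l0|nl] := eqVneq l' 0; last exact: (jacobiator_hsp d nl Hy' Hz').
  rewrite l0 oppr0 in Hz'; have [d1 ->] := hsp0 _ _ l0 Hy'; have [d2 ->] := hsp0 _ _ erefl Hz'.
  have Hv := hv_hsp b; have H0 := sub0 (hsp_subspace b).
  by rewrite /J3 !(nb_hh (Hv _) (Hv _)) !(nb_hh (Hv _) H0) !addr0.
have [k0|nk] := eqVneq k 0; first exact: (z0 k l q).
have [l0|nl] := eqVneq l 0.
  by rewrite jacobiator_cyc; apply: (z0 l q k) => //; rewrite addrC addrA E.
have [q0|nq] := eqVneq q 0.
  by rewrite -jacobiator_cyc; apply: (z0 q k l) => //; rewrite -addrA addrC E.
have pair k1 k2 k3 x1 x2 x3 : k1 != 0 -> k2 != 0 -> k3 != 0 -> k1 + k2 + k3 = 0 ->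
    homog k1 x1 -> homog k2 x2 -> homog k3 x3 -> nb x1 (nb x2 x3) = br x1 (br x2 x3).
  move=> n1 n2 n3 E' H1 H2 H3; rewrite (nb_S (V0_homog H2) (S_homog n3 H3)).
  apply: nb_S; first exact: V0_homog H1.
  apply: (S_homog _ (homog_br n2 n3 H2 H3)).
  by apply: contraNneq n1 => E2; rewrite -E' -addrA E2 addr0.
rewrite /J3 (pair k l q) // (pair l q k) // ?(pair q k l) //; first exact: (bJ Hl).
  by rewrite -addrA addrC E.
by rewrite addrC addrA E.
Qed.
Lemma nb_jacobi x y z : V0 x -> V0 y -> V0 z -> J3 x y z = 0.
Proof.
have V00 := sub0 V0_subspace.
have lin y' z' : V0 y' -> V0 z' -> subspace (fun x => V0 x /\ J3 x y' z' = 0).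
  move=> Hy Hz; split=> [|a u v [Vu Eu] [Vv Ev]].
    split=> //; have := jacobiator_lin (-1) V00 V00 Hy Hz.
    by rewrite scaler0 addr0 scaleN1r addNr.
  by split; [exact: (proj2 V0_subspace) | rewrite jacobiator_lin // Eu Ev scaler0 addr0].
have step P y' z' x' : (forall k w, homog k w -> J3 w y' z' = 0) -> V0 y' -> V0 z' -> P ->
    V0 x' -> J3 x' y' z' = 0.
  move=> H Hy Hz _ Hx; suff [] : V0 x' /\ J3 x' y' z' = 0 by [].
  refine (span_min (lin _ _ Hy Hz) _ Hx) => w [k Hw].
  by split; [exact: V0_homog Hw | exact: H Hw].
move=> Hx Hy Hz; apply: (step True) => // k u Hu.
rewrite jacobiator_cyc; apply: (step True) => //; last exact: V0_homog Hu.
move=> l v Hv; rewrite jacobiator_cyc; apply: (step True) => //; [|exact: V0_homog Hu|exact: V0_homog Hv].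
by move=> q w Hw; apply: jacobiator_homog Hw Hu Hv.
Qed.
End OneSidedTriangular.

(** * The associated antisymmetric model *)

Section SubspaceType.
Variables (K : fieldType) (V : lmodType K) (S : V -> Prop).
Definition subspace_pred : {pred V} := fun x => `[< S x >].
Hypothesis HS : subspace S.
(** The proof argument makes the module structure of the subtype inferable from the type alone. *)
Definition subspace_type (_ : subspace S) := {x : V | x \in subspace_pred}.
Local Notation W := (subspace_type HS).
HB.instance Definition _ := SubChoice.copy W {x : V | x \in subspace_pred}.
Fact subspace_pred_closed : subsemimod_closed subspace_pred.
Proof.
split; [split; first exact/asboolP/(sub0 HS)|].
  by move=> u v /asboolP Hu /asboolP Hv; apply/asboolP; exact: subD.
by move=> a u /asboolP Hu; apply/asboolP; exact: subZ.
Qed.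
HB.instance Definition _ :=
  GRing.SubChoice_isSubLmodule.Build K V subspace_pred W subspace_pred_closed.

Definition sub_in x (Sx : S x) : W := exist _ x (asboolT Sx).
Lemma sub_valP (x : W) : S (val x). Proof. exact: asboolW (valP x). Qed.
Lemma sub_val_lin a (x y : W) : val (a *: x + y) = a *: val x + val y.
Proof. exact: linearP. Qed.
Lemma sub_val_sum I (s : seq I) (c : I -> K) (F : I -> W) :
  val (\sum_(i <- s) c i *: F i) = \sum_(i <- s) c i *: val (F i).
Proof. by rewrite linear_sum; apply: eq_bigr => i _; rewrite linearZ. Qed.
End SubspaceType.

Section Bilinearised.
Variables (K : numClosedFieldType) (n m : nat) (A : 'M[int]_n).
Variables (V : lmodType K) (br : V -> V -> V) (b : 'I_m -> V).
Variables (Aroot Acor : 'M[K]_(n, m)) (e f : 'I_n -> V).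
Hypothesis KM : KacMoody_model A br b Aroot Acor e f.
Local Notation wt := 'rV[int]_n.
Implicit Types (k l q : wt) (x y z u v w : V) (d : 'rV[K]_m).
Local Notation Hl := (KM_bracket KM).
Variable r : 'rV[K]_m.
Hypothesis Hr : forall k, evw Aroot k r = (ht k)%:~R.
Local Notation rho := (hv b r).
Local Notation homog := (homog br b e f).
Local Notation V0 := (graded_span br b e f).
Local Notation S := (offdiag br b e f).
Local Notation nb := (nb br b e f).
Let VS : subspace V0 := V0_subspace br b e f.
Local Notation W := (subspace_type VS).
Let vP (x : W) : V0 (val x) := @sub_valP _ _ _ VS x.

Lemma words_S k x : words br e k x -> S x.
Proof.
move=> Wx; have [->|[kk _]] := words_wt KM Hr Wx; first exact: (sub0 (S_subspace _ _ _ _)).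
exact: S_homog (kpos_neq0 kk) (homog_e KM Hr Wx).
Qed.
Lemma wordsf_S k x : words br f k x -> S x.
Proof.
move=> Wx; have [->|[kk _]] := words_wt (KM_mirror1 KM Hr) (mirror_rho Hr) Wx.
  exact: (sub0 (S_subspace _ _ _ _)).
by apply: S_homog (homog_f KM Hr Wx); rewrite oppr_eq0 kpos_neq0.
Qed.
Let Se i : S (e i) := words_S (words_gen _ _ i).
Let Sf i : S (f i) := wordsf_S (words_gen _ _ i).

Definition nbB j : W := sub_in VS (V0_hsp (hsp_b b j)).
Definition nbE i : W := sub_in VS (S_V0 (Se i)).
Definition nbF i : W := sub_in VS (S_V0 (Sf i)).
Definition nbW (x y : W) : W := sub_in VS (nb_V0 KM Hr (vP x) (vP y)).

Lemma nbW_val (x y : W) : val (nbW x y) = nb (val x) (val y). Proof. by []. Qed.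
Lemma nbB_hsp (x : W) : hsp nbB x <-> hsp b (val x).
Proof.
split=> [[c ->]|[c Ex]]; exists c; first by rewrite sub_val_sum.
by apply: val_inj; rewrite /= Ex sub_val_sum.
Qed.
Lemma nbW_lie : is_lie_bracket nbW.
Proof.
split=> [a x y z|x|x y z]; apply: val_inj.
- rewrite sub_val_lin !nbW_val sub_val_lin; exact: (nb_linl KM Hr) (vP x) (vP y).
- by apply: self_opp_eq0; exact: (nb_ac KM Hr (vP x) (vP x)).
- have := nb_jacobi KM Hr (vP x) (vP y) (vP z).
  by rewrite /jacobiator !linearD.
Qed.
Lemma nbW_ac (x y : W) : nbW x y = - nbW y x.
Proof. by apply: val_inj; rewrite linearN; exact: (nb_ac KM Hr (vP x) (vP y)). Qed.

Lemma nbW_gen (x : W) : gen_subalgebra nbW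
  (fun y : W => (exists j, y = nbB j) \/ (exists i, y = nbE i) \/ (exists i, y = nbF i)) x.
Proof.
move=> P [HP cl] gen.
pose Q v := exists2 w : W, val w = v & P w.
have HQ : subspace Q.
  split; first by exists 0; [exact: linear0 | exact: (sub0 HP)].
  move=> a u v [u' <- Pu] [v' <- Pv]; exists (a *: u' + v'); first exact: sub_val_lin.
  exact: (proj2 HP).
have gE i : P (nbE i) by apply: gen; right; left; exists i.
have gF i : P (nbF i) by apply: gen; right; right; exists i.
have Qw (h : 'I_n -> V) (hW : 'I_n -> W) : (forall i, val (hW i) = h i) -> (forall i, P (hW i)) ->
    (forall k x, words br h k x -> S x) -> forall k x, words br h k x -> Q x.
  move=> hE hP hS k v; elim=> {k v} [k|i|k a u v _ Hu _ Hv|k j v Wv [w Ew Pw]].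
  - exact: (sub0 HQ).
  - by exists (hW i).
  - exact: (proj2 HQ).
  - exists (nbW (hW j) w); last exact: cl.
    rewrite nbW_val Ew hE; apply: (nb_S KM Hr); last exact: hS Wv.
    exact: (S_V0 (hS _ _ (words_gen _ _ j))).
suff [w /val_inj <- //] : Q (val x).
refine (span_min HQ _ (vP x)) => v [k].
rewrite /homog; case: eqP => _.
  case=> c ->; apply: (sub_sum _ HQ) => j _; apply: (subZ _ HQ).
  by exists (nbB j) => //; apply: gen; left; exists j.
case: ifP => _; first exact: (Qw e nbE (fun=> erefl) gE words_S).
case: ifP => _; first exact: (Qw f nbF (fun=> erefl) gF wordsf_S).
by move=> ->; exact: (sub0 HQ).
Qed.

(** [J] is carried over to an ideal for [br]. For this its elements must have no Cartan part: they
    are then regular, and the [center2] part of any [v] brackets them to zero. *)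
Lemma nbW_ideal J : lie_ideal nbW J -> (forall x : W, J x -> hsp nbB x -> x = 0) ->
  forall x : W, J x -> x = 0.
Proof.
move=> [HJ Jid] J0.
have claim (s : seq wt) (x : W) h (F : wt -> V) : J x -> hsp b h -> (forall k, homog_nz br b e f k (F k)) ->
    val x = h + \sum_(k <- s) F k -> h = 0.
  elim: s x h F => [|k s IH] x h F Jx hh HF; rewrite ?big_nil ?big_cons ?addr0 => Ex.
    by rewrite -Ex (J0 x Jx) ?linear0 //; apply/nbB_hsp; rewrite Ex.
  have [hk|hk] := eqVneq (ht k) 0.
    case: (homog_nz_nzht KM Hr (HF k)) => [F0|[]]; last by rewrite hk eqxx.
    by apply: (IH x h F Jx hh HF); rewrite Ex F0 add0r.
  pose t : K := (ht k)%:~R.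
  have nt : t != 0 by rewrite intr_eq0.
  pose rhoW : W := sub_in VS (V0_hsp (hv_hsp b r)).
  (* Subtracting the eigenvalue of rho at [k] deletes the component [F k] and multiplies [h] by the
     nonzero scalar [- t]. *)
  have Jx' : J (- t *: x + nbW rhoW x) by apply: (proj2 HJ) => //; exact: Jid.
  have : - t *: h = 0.
    apply: (IH _ _ (fun l => ((ht l)%:~R - t) *: F l) Jx').
    - exact: (subZ _ (hsp_subspace b)).
    - by move=> l; exact: (subZ _ (homog_nz_subspace _ _ _ _ l)).
    have SF : S (\sum_(l <- k :: s) F l).
      by apply: (sub_sum _ (S_subspace br b e f)) => l _; exact: homog_nz_S (HF l).
    have {}Ex : val x = h + \sum_(l <- k :: s) F l by rewrite Ex big_cons.
    rewrite sub_val_lin nbW_val Ex /=.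
    have -> : nb rho (h + \sum_(l <- k :: s) F l) = \sum_(l <- k :: s) (ht l)%:~R *: F l.
      have := nb_linr KM Hr 1 (V0_hsp hh) (S_V0 SF) (V0_hsp (hv_hsp b r)).
      rewrite !scale1r (nb_hh KM Hr (hv_hsp b r) hh) add0r => ->.
      rewrite (nb_S KM Hr (V0_hsp (hv_hsp b r)) SF) (reg_sum KM (r := r)) => [|l].
        by apply: eq_bigr => l _; rewrite (nzht_hv KM r (homog_nz_nzht KM Hr (HF l))) Hr.
      exact: (nzht_reg KM Hr (homog_nz_nzht KM Hr (HF l))).
    rewrite scalerDr scaler_sumr -addrA -big_split /= big_cons -scalerDl addNr scale0r add0r.
    by congr (_ + _); apply: eq_bigr => l _; rewrite -scalerDl addrC.
  by move/eqP; rewrite scaler_eq0 oppr_eq0 (negPf nt) => /eqP.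
have JS (x : W) : J x -> S (val x).
  move=> Jx; have Ex : val x = hpart br b e f (val x) + upart br b e f (val x).
    by rewrite /upart subrKC.
  have [F [HF [s _ Es]]] := S_decomp (upart_S (vP x)).
  have E0 : hpart br b e f (val x) = 0.
    by apply: (claim s x _ F Jx (hpart_hsp _ _ _ _ _) HF); rewrite -Es.
  by rewrite Ex E0 add0r; exact: upart_S (vP x).
have [_ _ _ _ NI] := KM.
move=> x Jx; apply: val_inj; rewrite linear0.
apply: (NI (fun v => exists2 w : W, val w = v & J w)) => [|v [w <- Jw] hw|]; last by exists x.
  split; first split.
  - by exists 0; [exact: linear0 | exact: (sub0 HJ)].
  - move=> a u v [u' <- Pu] [v' <- Pv]; exists (a *: u' + v'); first exact: sub_val_lin.
    exact: (proj2 HJ).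
  - move=> v _ [w <- Jw]; have [v0 [c [Hv0 Cc ->]]] := V0C_total KM Hr v.
    rewrite (bDl Hl) (reg_center2 KM (S_reg KM Hr (JS _ Jw)) Cc) addr0.
    exists (nbW (sub_in VS Hv0) w); last exact: Jid.
    by rewrite nbW_val; apply: (nb_S KM Hr) => //; exact: JS.
by rewrite (J0 w Jw) ?linear0 //; apply/nbB_hsp.
Qed.

Lemma nbW_model : KacMoody_model A nbW nbB Aroot Acor nbE nbF.
Proof.
have [[_ Em free] RA [R1 R2 R3 R4] _ _] := KM.
split=> //; [split=> //| |exact: nbW_gen|exact: nbW_ideal].
- exact: nbW_lie.
- move=> c E k; apply: free; have := congr1 val E; rewrite sub_val_sum linear0; exact.
split=> [i j|k l|k i|k i]; apply: val_inj; rewrite nbW_val.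
- rewrite -[LHS]/(nb (e i) (f j)) (nb_S KM Hr (S_V0 (Se i)) (Sf j)).
  by rewrite R1; case: eqP => _; rewrite ?linear0 // sub_val_sum.
- by rewrite linear0; exact: (nb_hh KM Hr (hsp_b b k) (hsp_b b l)).
- by rewrite -[LHS]/(nb (b k) (e i)) (nb_S KM Hr (V0_hsp (hsp_b b k)) (Se i)) R3 linearZ.
- rewrite -[LHS]/(nb (b k) (f i)) (nb_S KM Hr (V0_hsp (hsp_b b k)) (Sf i)) R4.
  by rewrite linearN linearZ.
Qed.
End Bilinearised.

(** * Transfer from the bilinear model to the original bracket *)

Section Transfer.
Variables (K : numClosedFieldType) (n m : nat) (A : 'M[int]_n).
Variables (V : lmodType K) (br : V -> V -> V) (b : 'I_m -> V).
Variables (Aroot Acor : 'M[K]_(n, m)) (e f : 'I_n -> V).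
Hypothesis KM : KacMoody_model A br b Aroot Acor e f.
Local Notation wt := 'rV[int]_n.
Local Notation C2 := (center2 br).
Local Notation T := (br2 br).
Local Notation Hl := (KM_bracket KM).
Variable r : 'rV[K]_m.
Hypothesis Hr : forall k : wt, evw Aroot k r = (ht k)%:~R.
Local Notation rho := (hv b r).
Local Notation V0 := (graded_span br b e f).
Local Notation S := (offdiag br b e f).
Local Notation nb := (nb br b e f).
Local Notation VS := (V0_subspace br b e f).
Local Notation SS := (S_subspace br b e f).
Local Notation W := (subspace_type VS).
Local Notation nbB := (nbB br b e f).
Local Notation nbW := (nbW KM Hr).
Let vP (x : W) : V0 (val x) := @sub_valP _ _ _ VS x.
Let val0 : val (0 : W) = 0 := linear0 _.
Let CS : subspace C2 := center2_subspace Hl.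
Let HS : subspace (hsp b) := hsp_subspace b.

Lemma S_br_hsp h u : hsp b h -> S u -> S (br h u).
Proof.
move=> /hspP[d ->] Su; suff [] : S u /\ S (br (hv b d) u) by [].
refine (span_min (S := fun u => S u /\ S (br (hv b d) u)) _ _ Su).
  split=> [|a v w [Sv Hv] [Sw Hw]]; first by rewrite (b0r Hl); split; exact: (sub0 SS).
  split; first exact: (proj2 SS).
  by rewrite (reg_lin KM _ _ (S_reg KM Hr Sv) (S_reg KM Hr Sw)); exact: (proj2 SS).
move=> v [k [nk Hv]]; split; first exact: S_homog nk Hv.
by rewrite (hv_homog KM Hr d nk Hv); apply: (subZ _ SS); apply: S_homog nk Hv.
Qed.
(** With alpha(h) = 1, [y] equals [h, [h, y]], and this double bracket deletes the [center2] part
    and the Cartan part of [y]. *)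
Lemma root_S alpha y : is_root br b alpha -> rootsp br b alpha y -> S y.
Proof.
move=> [_ [h0 hh0 nh0] _] ay.
pose h := (alpha h0)^-1 *: h0.
have hh : hsp b h := subZ _ HS hh0.
have Ey : br h y = y by rewrite (bZl Hl) ay // scalerA mulVf // scale1r.
have [y0 [c [Hy0 Cc E]]] := V0C_total KM Hr y.
have E1 : y = T h h y by rewrite /T !Ey.
have E2 : y0 = hpart br b e f y0 + upart br b e f y0 by rewrite /upart subrKC.
rewrite E1 E (br2Dr Hl) Cc addr0 E2 (br2Dr Hl) (br2_hsp KM _ hh (hpart_hsp _ _ _ _ _)) add0r.
by apply: S_br_hsp => //; apply: S_br_hsp => //; apply: upart_S.
Qed.

Definition cartan_center x := C2 x /\ hsp b x.
Local Notation Z := cartan_center.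
Lemma Z_subspace : subspace Z.
Proof.
split; first by split; [exact: (sub0 CS) | exact: (sub0 HS)].
by move=> a x y [H1 H2] [H3 H4]; split; [exact: (proj2 CS) | exact: (proj2 HS)].
Qed.
Local Notation ZS := Z_subspace.
Lemma Z_V0 x : Z x -> V0 x. Proof. by case=> _; apply: V0_hsp. Qed.
Lemma center2_V0_Z x : V0 x -> C2 x -> Z x.
Proof.
move=> Hx Cx; split=> //.
have E2 : x = hpart br b e f x + upart br b e f x by rewrite /upart subrKC.
suff E : upart br b e f x = 0 by rewrite E2 E addr0; exact: hpart_hsp.
apply: (S_br2_inj KM Hr (upart_S Hx)).
by have := Cx rho rho; rewrite {1}E2 (br2Dr Hl) (br2_rho_hsp KM r (hpart_hsp _ _ _ _ _)) add0r.
Qed.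
Lemma nb_Zl x y : Z x -> V0 y -> nb x y = 0.
Proof.
move=> [Cx hx] Hy; rewrite /nb (upart_h KM Hr hx) (b0r Hl) subr0.
exact: (reg_center2 KM (S_reg KM Hr (upart_S Hy)) Cx).
Qed.
Lemma nb_mod x y z z' : V0 x -> V0 y -> Z z -> Z z' -> nb (x + z) (y + z') = nb x y.
Proof.
move=> Hx Hy Hz Hz'.
have E1 := nb_linl KM Hr 1 (y + z') Hx (Z_V0 Hz); rewrite !scale1r in E1.
have Hyz := subD VS Hy (Z_V0 Hz').
have E2 := nb_linr KM Hr 1 Hy (Z_V0 Hz') Hx; rewrite !scale1r in E2.
rewrite E1 E2 (nb_Zl Hz Hyz) addr0.
by rewrite (nb_ac KM Hr Hx (Z_V0 Hz')) (nb_Zl Hz' Hx) oppr0 addr0.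
Qed.
Lemma br_nb_Z x y : V0 x -> V0 y -> V0 (br x y) -> Z (br x y - nb x y).
Proof.
move=> Hx Hy Hxy.
exact: (center2_V0_Z (subB VS Hxy (nb_V0 KM Hr Hx Hy)) (nb_center2 KM Hx Hy)).
Qed.

(** All simple roots vanish on [x]. Since m = 2n - rank A, their common kernel has dimension n -
    rank A, which is also the dimension of the coroot combinations it contains. *)
Lemma Z_coroots x : Z x -> exists a : 'rV[K]_n, x = hv b (a *m Acor).
Proof.
move=> [Cx /hspP[d Ex]].
have [[_ Em free] [rA rC CR] _ _ _] := KM.
have rfC : row_free Acor by rewrite /row_free rC.
have ne i : e i != 0.
  apply/eqP => E; have := KM_ef KM i i; rewrite eqxx E (b0l Hl) => /esym H0.
  have r0 : row i Acor = 0.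
    by apply/rowP => j; rewrite [RHS]mxE (free (fun j => row i Acor 0 j)).
  have : (delta_mx 0 i : 'rV[K]_n) *m Acor = 0 *m Acor by rewrite -rowE r0 mul0mx.
  by move/(row_free_inj rfC)/rowP/(_ i)/eqP; rewrite !mxE !eqxx oner_eq0.
have d0 : d *m Aroot^T = 0.
  apply/rowP => i; rewrite !mxE.
  have := center2l Hl x (e i) Cx; rewrite {2}Ex /T (hv_wt KM d (KM_ge KM i)).
  rewrite Ex (reg_Z KM _ _ (reg_e KM Hr i)) (hv_wt KM d (KM_ge KM i)) scalerA => /eqP.
  rewrite scaler_eq0 (negPf (ne i)) orbF mulf_eq0 orbb /evw => /eqP E.
  by rewrite -[RHS]E; apply: eq_bigr => j _; rewrite mxE wtv_delta.
pose N := kermx (intmx K A) *m Acor.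
have sub1 : (N <= kermx Aroot^T)%MS.
  by apply/sub_kermxP; rewrite /N -mulmxA CR mulmx_ker.
have rk : \rank N = \rank (kermx Aroot^T).
  rewrite /N mxrankMfree // !mxrank_ker mxrank_tr rA Em.
  by have := rank_leq_row (intmx K A); lia.
have : (d <= N)%MS.
  have := mxrank_leqif_sup sub1; rewrite /leqif rk eqxx => -[_ /esym sub2].
  by apply: submx_trans sub2; apply/sub_kermxP.
move=> dN; have /submxP[D ED] := submx_trans dN (submxMl _ _).
by exists D; rewrite Ex ED.
Qed.
(** A combination of coroots is the bracket of the same combination of the [e i] with the sum of the
    [f j], so bracketing [z] with it is a double bracket, linear in its middle argument. *)
Lemma Z_lin a x y z : Z x -> Z y -> br z (a *: x + y) = a *: br z x + br z y.
Proof.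
move=> /Z_coroots[c ->] /Z_coroots[d ->].
pose F := \sum_j f j; pose E (c : 'rV[K]_n) := \sum_i c 0 i *: e i.
have key c' : hv b (c' *m Acor) = br (E c') F.
  rewrite /E /F (bsuml Hl) /hv.
  transitivity (\sum_i c' 0 i *: hv b (row i Acor)); last first.
    apply: eq_bigr => i _; rewrite (bZl Hl) (reg_sum KM (r := r)) => [|j]; last exact: (reg_f KM Hr).
    congr (_ *: _); rewrite (bigD1 i) //= (br_ef KM) eqxx scale1r big1 ?addr0 // => j ji.
    by rewrite (br_ef KM) eq_sym (negPf ji) scale0r.
  under [RHS]eq_bigr => i _ do rewrite /hv scaler_sumr.
  rewrite exchange_big; apply: eq_bigr => j _; rewrite mxE scaler_suml.
  by apply: eq_bigr => i _; rewrite mxE scalerA.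
have El : E (a *: c + d) = a *: E c + E d.
  rewrite /E scaler_sumr -big_split; apply: eq_bigr => i _.
  by rewrite !mxE scalerDl scalerA.
have -> : a *: hv b (c *m Acor) + hv b (d *m Acor) = br (E (a *: c + d)) F.
  by rewrite El (bLl Hl) -!key.
by rewrite !key El -!/(T _ _ _) (br2Dm Hl) (br2Zm Hl).
Qed.

Lemma nb_br_Z x y z z' : V0 x -> V0 y -> V0 (br x y) -> Z z -> Z z' ->
  Z (br x y - nb (x + z) (y + z')).
Proof. by move=> Hx Hy Hxy Hz Hz'; rewrite nb_mod //; apply: br_nb_Z. Qed.

Section Subalgebra.
Variable L : V -> Prop.
Hypotheses (Lsub : lie_subalgebra br L) (Lgr : graded br b L) (Lsol : solvable_lie br L).
Let LS : subspace L := proj1 Lsub.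
Local Notation D d := (derived br L d).

Lemma graded_V0 x : L x -> V0 x.
Proof.
move/Lgr => Hx; refine (span_min VS _ Hx) => y [_ [hy|[alpha [Ha ay]]]]; first exact: V0_hsp.
exact: (S_V0 (root_S Ha ay)).
Qed.
Local Notation LV := graded_V0.
Lemma L_br_V0 x y : L x -> L y -> V0 (br x y).
Proof. by move=> Lx Ly; apply: LV; apply: (proj2 Lsub). Qed.

(** [L] need not be closed under [nb], since the two brackets differ on it by elements of [Z];
    [lift L] is L + Z seen in the graded part. *)
Definition lift (P : V -> Prop) (w : W) := exists2 z, Z z & P (val w - z).
Definition cover (R : W -> Prop) x := exists2 w : W, R w & Z (x - val w).

Lemma lift_subspace P : subspace P -> subspace (lift P).
Proof.
move=> HP; split.
  by exists 0; [exact: (sub0 ZS) | rewrite val0 subr0; exact: (sub0 HP)].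
move=> a u v [z Hz Hu] [z' Hz' Hv]; exists (a *: z + z'); first exact: (proj2 ZS).
have := proj2 HP a _ _ Hu Hv; congr P; rewrite sub_val_lin; module V.
Qed.
Lemma cover_subspace R : subspace R -> subspace (cover R).
Proof.
move=> HR; split.
  by exists 0; [exact: (sub0 HR) | rewrite val0 subr0; exact: (sub0 ZS)].
move=> a u v [w Hw Hu] [w' Hw' Hv]; exists (a *: w + w'); first exact: (proj2 HR).
have := proj2 ZS a _ _ Hu Hv; congr Z; rewrite sub_val_lin; module V.
Qed.
Lemma lift_lbracket (R R' : W -> Prop) P P' w :
  (forall w, R w -> lift P w) -> (forall w, R' w -> lift P' w) ->
  (forall x, P x -> L x) -> (forall x, P' x -> L x) ->
  lbracket nbW R R' w -> lift (lbracket br P P') w.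
Proof.
move=> HR HR' PL PL' Hw; refine (span_min (lift_subspace (lbracket_subspace br P P')) _ Hw).
move=> _ [u [v [/HR[z Hz Pu] /HR'[z' Hz' Pv] ->]]].
have Lu := PL _ Pu; have Lv := PL' _ Pv.
have := nb_br_Z (LV Lu) (LV Lv) (L_br_V0 Lu Lv) Hz Hz'; rewrite !subrK => HZ.
exists (- (br (val u - z) (val v - z') - nb (val u) (val v))); first exact: (subN ZS).
rewrite nbW_val opprK addrC subrK; exact: lbracket_in.
Qed.
Lemma cover_lbracket (R R' : W -> Prop) P P' x :
  (forall x, P x -> L x /\ cover R x) -> (forall x, P' x -> L x /\ cover R' x) ->
  lbracket br P P' x -> cover (lbracket nbW R R') x.
Proof.
move=> HP HP' Hx; refine (span_min (cover_subspace (lbracket_subspace nbW R R')) _ Hx).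
move=> _ [u [v [/HP[Lu [w Rw Hw]] /HP'[Lv [w' Rw' Hw']] ->]]].
exists (nbW w w'); first exact: lbracket_in.
have := nb_br_Z (LV Lu) (LV Lv) (L_br_V0 Lu Lv) (subN ZS Hw) (subN ZS Hw').
by rewrite !opprB ![_ + (val _ - _)]addrC !subrK.
Qed.

Local Notation L1 := (lift L).
Lemma lift_subalgebra : lie_subalgebra nbW L1.
Proof.
split; first exact: lift_subspace.
move=> u v Hu Hv.
have [|z Hz Hw] := @lift_lbracket L1 L1 L L (nbW u v) (fun _ => id) (fun _ => id) (fun _ => id) (fun _ => id).
  exact: lbracket_in.
by exists z => //; apply: (lbracket_min LS _ Hw) => x y Lx Ly; apply: (proj2 Lsub).
Qed.
Lemma derived_lift d w : derived nbW L1 d w -> lift (D d) w.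
Proof.
elim: d w => [//|d IH] w; apply: lift_lbracket => // x; exact: derived_sub0.
Qed.
Lemma derived_cover d x : D d x -> cover (derived nbW L1 d) x.
Proof.
elim: d x => [|d IH] x.
  move=> Lx; exists (sub_in VS (LV Lx)); last by rewrite subrr; exact: (sub0 ZS).
  by exists 0; [exact: (sub0 ZS) | rewrite subr0].
by apply: cover_lbracket => y Dy; split; [exact: derived_sub0 Dy | exact: IH | exact: derived_sub0 Dy | exact: IH].
Qed.
Lemma lcs_cover k x : lcs br (D 2) k x ->
  L x /\ cover (lcs nbW (derived nbW L1 2) k) x.
Proof.
have D2 y : D 2 y -> L y /\ cover (derived nbW L1 2) y.
  by move=> Dy; split; [exact: derived_sub0 Dy | exact: derived_cover].
elim: k x => [|k IH] x; first exact: D2.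
move=> Hx; split; last exact: cover_lbracket D2 IH Hx.
apply: (lbracket_min LS _ Hx) => u v /D2[Lu _] /IH[Lv _]; exact: (proj2 Lsub).
Qed.
Lemma lift_solvable : solvable_lie nbW L1.
Proof.
(* One step more than for [L]: the [d]-th derived algebra of the lift is only known to lie in [Z],
   which [nb] kills. *)
have [d Hd] := Lsol; exists d.+1 => w Hw.
have S0 : subspace (fun w : W => w = 0) := @subspace_zero _ _.
apply: (lbracket_min S0 _ Hw) => u v /derived_lift[z Hz /Hd Hu] _.
apply: val_inj; rewrite nbW_val val0; apply: nb_Zl => //.
by move/eqP: Hu; rewrite subr_eq0 => /eqP ->.
Qed.
Lemma lift_graded w : L1 w ->
  span_of (fun y => L1 y /\ (hsp nbB y \/ exists alpha, rootsp nbW nbB alpha y)) w.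
Proof.
set P := (fun y => _); have PS := span_subspace P.
case=> z Hz Lw; have hz := Z_V0 Hz; have Vl := LV Lw.
have Lift (x : W) : L (val x) -> L1 x.
  by move=> Lx; exists 0; [exact: (sub0 ZS) | rewrite subr0].
have -> : w = sub_in VS Vl + sub_in VS hz by apply: val_inj; rewrite linearD /= subrK.
apply: (subD PS); last first.
  apply: span_in; split; last by left; apply/nbB_hsp; exact: (proj2 Hz).
  by exists z => //=; rewrite subrr; exact: (sub0 LS).
suff [w' /(_ =P _)] : exists2 w' : W, val w' = val w - z & span_of P w'.
  by move=> Ew Pw; have <- : w' = sub_in VS Vl by apply: val_inj; apply/eqP.
refine (span_min (S := fun x => exists2 w' : W, val w' = x & span_of P w') _ _ (Lgr Lw)).
  split; first by exists 0; [exact: val0 | exact: (sub0 PS)].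
  move=> a u v [u' <- Pu] [v' <- Pv]; exists (a *: u' + v'); first exact: sub_val_lin.
  exact: (proj2 PS).
move=> y [Ly Hy]; exists (sub_in VS (LV Ly)) => //; apply: span_in; split; first exact: Lift.
case: Hy => [hy|[alpha [Ha ay]]]; [left | right]; first exact/nbB_hsp.
exists (fun w => alpha (val w)) => h /nbB_hsp hh; apply: val_inj.
rewrite nbW_val linearZ (nb_S KM Hr (vP h) (root_S Ha ay)); exact: ay.
Qed.

Lemma derived2_nilpotent_raw : is_GCM A -> symmetrisable K A -> nilpotent_lie br (D 2).
Proof.
move=> gcm sym.
have [k Hk] := anticomm_derived2_nilpotent (nbW_ac KM Hr) gcm sym (nbW_model KM Hr)
  lift_subalgebra lift_graded lift_solvable.
have D2L y : D 2 y -> L y := @derived_sub0 _ _ br L 2 y Lsub.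
have Zk x : lcs br (D 2) k x -> L x /\ Z x.
  by move/lcs_cover => [Lx [w /Hk ->]]; rewrite val0 subr0.
have NS : subspace (fun w => Z w /\ forall x, br x w = 0).
  split; first by split; [exact: (sub0 ZS) | move=> x; exact: (b0r Hl)].
  move=> a u v [Hu Nu] [Hv Nv]; split; first exact: (proj2 ZS).
  by move=> x; rewrite Z_lin // Nu Nv scaler0 addr0.
have S0 := @subspace_zero K V.
(* Term [k] lies in [Z]; one bracket leads to elements that every vector kills from the left, and
   the next one to 0. *)
exists k.+2 => x Hx; apply: (lbracket_min S0 _ Hx) => u v _ Hv.
suff [] : Z v /\ forall x, br x v = 0 by [].
apply: (lbracket_min NS _ Hv) => y z Dy /Zk[Lz [Cz hz]]; split=> [|w]; last exact: Cz.
exact: (center2_V0_Z (L_br_V0 (D2L _ Dy) Lz) (center2_brr Hl y Cz)).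
Qed.
End Subalgebra.
End Transfer.

Theorem theorem5p14 (K : numClosedFieldType) (n m : nat) (A : 'M[int]_n)
  (V : lmodType K) (br : V -> V -> V) (b : 'I_m -> V)
  (Aroot Acor : 'M[K]_(n, m)) (e f : 'I_n -> V) :
  is_GCM A -> symmetrisable K A ->
  KacMoody_model A br b Aroot Acor e f ->
  forall L : V -> Prop, lie_subalgebra br L -> graded br b L ->
    (solvable_lie br L <-> nilpotent_lie br (derived br L 2)).
Proof.
move=> gcm sym KM L Lsub Lgr; split; last exact: nilpotent_derived2_solvable.
by move=> Lsol; have [r Hr] := rho_exists KM; apply: (derived2_nilpotent_raw KM Hr).
Qed.
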